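(* For every deterministic Turing machine $M$ there exists a mean-payoff game with limited-observation $G$, constructible from $M$ in polynomial time, such that Eve has a winning strategy in the reachability game $\Gamma_G$ if and only if $M$ halts in the accept state, and Adam has a winning strategy in $\Gamma_G$ if and only if $M$ halts in the reject state.
   Context: An MPG with limited-observation is a tuple $G=\langle Q,q_I,\Sigma,\Delta,w,Obs\rangle$: $Q$ a finite set of states, $q_I\in Q$, $\Sigma$ a finite set of actions, $\Delta\subseteq Q\times\Sigma\times Q$ total, $w:\Delta\to\mathbb{Z}$, $Obs$ a partition of $Q$ with $\{q_I\}\in Obs$ and $\mathrm{post}_\sigma(o)=\{q':\exists q\in o,(q,\sigma,q')\in\Delta\}$ a union of elements of $Obs$ for all $o\in Obs,\sigma\in\Sigma$. Reachability game $\Gamma_G$: $\mathcal{F}$ is the set of $f:Q\to\mathbb{Z}\cup\{+\infty,\bot\}$, $\mathrm{supp}(f)=\{q:f(q)\ne\bot\}$; $f'$ is a $\sigma$-successor of $f$ if $\mathrm{supp}(f')\in Obs$, $\mathrm{supp}(f')\subseteq\mathrm{post}_\sigma(\mathrm{supp}(f))$ and each $f'(q)$, $q\in\mathrm{supp}(f')$, is $\min\{f(q')+w(q',\sigma,q):q'\in\mathrm{supp}(f),(q',\sigma,q)\in\Delta\}$ or $+\infty$. $f\preceq_k f'$ iff $\mathrm{supp}(f)=\mathrm{supp}(f')$ and $f(q)+k\le f'(q)$ on the support ($+\infty+k=+\infty$). $f_I(q_I)=0$, else $\bot$. $\Pi_G$: sequences $f_0\sigma_0\ldots f_n$ with $f_0=f_I$,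 $f_{i+1}$ a $\sigma_i$-successor of $f_i$, and $f_i\not\preceq_0f_j$, $f_j\not\preceq_1 f_i$ for $0\le i<j<n$. $\mathcal{T}_\exists$: such sequences with $f_i\preceq_0 f_n$ for some $i<n$; $\mathcal{T}_\forall$: such sequences with, for some $i<n$, $f_n\preceq_1 f_i$ and $f_i(q)\ne+\infty$ for some $q\in\mathrm{supp}(f_i)$. In $\Gamma_G$, starting at $f_I$, Eve repeatedly picks an action $\sigma$ and Adam picks $f$ with $x\sigma f\in\Pi_G$ ($x$ the current sequence); the play stops with Eve winning upon reaching $\mathcal{T}_\exists$ and with Adam winning upon reaching $\mathcal{T}_\forall$. A player has a winning strategy if (s)he can ensure that every play reaches her/his target set. *)

(* Defs.v *)
From mathcomp Require Import all_boot all_order all_algebra.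
Set Implicit Arguments. Unset Strict Implicit. Unset Printing Implicit Defensive.
Import Order.TTheory GRing.Theory Num.Theory.

(* States are 0..tm_nst-1, tape symbols 0..tm_nsym-1 (0 = blank).      *)
(* The transition table lists, at index q * tm_nsym + a, the triple     *)
(* (new state, written symbol, move right?) ; tm_acc / tm_rej halt.     *)
Record tm := TM {
  tm_nst : nat; tm_nsym : nat;
  tm_start : nat; tm_acc : nat; tm_rej : nat;
  tm_delta : seq (nat * nat * bool) }.

Definition valid_tm (M : tm) : bool :=
  [&& tm_start M < tm_nst M, tm_acc M < tm_nst M, tm_rej M < tm_nst M,
      tm_acc M != tm_rej M, 0 < tm_nsym M,
      size (tm_delta M) == tm_nst M * tm_nsym M &
      all (fun e : nat * nat * bool => (e.1.1 < tm_nst M) && (e.1.2 < tm_nsym M))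
          (tm_delta M)].

Definition tconfig := (nat * (int -> nat) * int)%type.

Definition tm_step (M : tm) (c : tconfig) : tconfig :=
  let: (q, t, h) := c in
  if (q == tm_acc M) || (q == tm_rej M) then c else
  let: (q', b, d) := nth (0, 0, false) (tm_delta M) (q * tm_nsym M + t h) in
  (q', (fun i => if i == h then b else t i), if d then (h + 1)%R else (h - 1)%R).

Definition tm_run (M : tm) (c : tconfig) (n : nat) : tconfig := iter n (tm_step M) c.

Definition tape_of (w : seq nat) : int -> nat :=
  fun i => match i with Posz k => nth 0 w k | Negz _ => 0 end.

Definition tm_init (M : tm) (w : seq nat) : tconfig := (tm_start M, tape_of w, 0%R).

Definition tm_halts_accept (M : tm) : Prop :=
  exists n, (tm_run M (tm_init M [::]) n).1.1 = tm_acc M.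
Definition tm_halts_reject (M : tm) : Prop :=
  exists n, (tm_run M (tm_init M [::]) n).1.1 = tm_rej M.

(* Q = {0..g_nQ-1}, Sigma = {0..g_nS-1}, transitions (q, s, q', w(q,s,q'))*)
Record mpg := MPG {
  g_nQ : nat; g_nS : nat; g_qI : nat;
  g_delta : seq (nat * nat * nat * int);
  g_obs : seq (seq nat) }.

Definition trans (G : mpg) (q s q' : nat) : Prop :=
  exists w, (q, s, q', w) \in g_delta G.

Definition valid_mpg (G : mpg) : Prop :=
  g_qI G < g_nQ G /\ 0 < g_nS G /\
  (* transitions are in range, and w is a function on Delta *)
  (forall e, e \in g_delta G ->
     [&& e.1.1.1 < g_nQ G, e.1.1.2 < g_nS G & e.1.2 < g_nQ G]) /\
  uniq (map (fun e : nat * nat * nat * int => e.1) (g_delta G)) /\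
  (forall q s, q < g_nQ G -> s < g_nS G -> exists q', trans G q s q') /\
  (forall o, o \in g_obs G -> o != [::] /\ (forall q, q \in o -> q < g_nQ G)) /\
  (forall q, q < g_nQ G -> exists o, o \in g_obs G /\ q \in o) /\
  (forall o o' q, o \in g_obs G -> o' \in g_obs G -> q \in o -> q \in o' -> o =i o') /\
  (exists o, o \in g_obs G /\ o =i [:: g_qI G]) /\
  (* post_s(o) is a union of observations *)
  (forall o o' s, o \in g_obs G -> o' \in g_obs G ->
     (exists q', q' \in o' /\ exists q, q \in o /\ trans G q s q') ->
     forall q', q' \in o' -> exists q, q \in o /\ trans G q s q').

Inductive ext := Bot | Inf | Fin of int.

Definition eadd (x : ext) (k : int) : ext :=
  match x with Bot => Bot | Inf => Inf | Fin a => Fin (a + k)%R end.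

Definition ele (x y : ext) : Prop :=
  match x, y with
  | Fin a, Fin b => (a <= b)%R
  | Fin _, Inf => True
  | Inf, Inf => True
  | _, _ => False
  end.

(* elements of the set F: functions Q -> Z u {+oo, bot} (bot outside Q) *)
Definition Ffun := nat -> ext.

Definition fI (G : mpg) : Ffun := fun q => if q == g_qI G then Fin 0 else Bot.

Definition supp_in_obs (G : mpg) (f : Ffun) : Prop :=
  exists o, o \in g_obs G /\ forall q, q \in o <-> f q <> Bot.

Definition is_min_val (G : mpg) (f : Ffun) (s q : nat) (v : ext) : Prop :=
  (exists q0 w, f q0 <> Bot /\ (q0, s, q, w) \in g_delta G /\ v = eadd (f q0) w) /\
  (forall q0 w, f q0 <> Bot -> (q0, s, q, w) \in g_delta G -> ele v (eadd (f q0) w)).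

Definition succ (G : mpg) (f : Ffun) (s : nat) (f' : Ffun) : Prop :=
  [/\ supp_in_obs G f',
      (forall q, f' q <> Bot -> exists q0, f q0 <> Bot /\ trans G q0 s q) &
      (forall q, f' q <> Bot -> f' q = Inf \/ is_min_val G f s q (f' q))].

Definition prec (k : int) (f f' : Ffun) : Prop :=
  (forall q, f q = Bot <-> f' q = Bot) /\
  (forall q, f q <> Bot -> ele (eadd (f q) k) (f' q)).

(* a history f_0 s_0 f_1 ... s_{n-1} f_n is represented by the list
   [(s_0,f_1); ...; (s_{n-1},f_n)], with f_0 = f_I *)
Definition hist := seq (nat * Ffun).
Definition fseq (G : mpg) (x : hist) : seq Ffun := fI G :: map snd x.
Definition fat (G : mpg) (x : hist) (i : nat) : Ffun := nth (fI G) (fseq G x) i.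
Definition sat (x : hist) (i : nat) : nat := nth 0 (map fst x) i.

Definition inPi (G : mpg) (x : hist) : Prop :=
  (forall i, i < size x -> succ G (fat G x i) (sat x i) (fat G x i.+1)) /\
  (forall i j, i < j -> j < size x ->
     ~ prec 0 (fat G x i) (fat G x j) /\ ~ prec 1 (fat G x j) (fat G x i)).

Definition inTE (G : mpg) (x : hist) : Prop :=
  inPi G x /\ exists i, i < size x /\ prec 0 (fat G x i) (fat G x (size x)).

Definition inTA (G : mpg) (x : hist) : Prop :=
  inPi G x /\ exists i, i < size x /\ prec 1 (fat G x (size x)) (fat G x i) /\
    exists q z, fat G x i q = Fin z.

(* Eve's strategy sE ensures that every play from x reaches T_exists *)
Inductive eve_wf (G : mpg) (sE : hist -> nat) : hist -> Prop :=
| EW_target x : inTE G x -> eve_wf G sE x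
| EW_step x :
    (exists f, inPi G (rcons x (sE x, f))) ->
    (forall f, inPi G (rcons x (sE x, f)) -> eve_wf G sE (rcons x (sE x, f))) ->
    eve_wf G sE x.

Definition eve_wins (G : mpg) : Prop := exists sE, eve_wf G sE [::].

(* Adam's strategy sA ensures that every play from x reaches T_forall *)
Inductive adam_wf (G : mpg) (sA : hist -> nat -> Ffun) : hist -> Prop :=
| AW_target x : inTA G x -> adam_wf G sA x
| AW_step x :
    (forall s, s < g_nS G ->
       inPi G (rcons x (s, sA x s)) /\ adam_wf G sA (rcons x (s, sA x s))) ->
    adam_wf G sA x.

Definition adam_wins (G : mpg) : Prop := exists sA, adam_wf G sA [::].

Definition unary_enc (s : seq nat) : seq bool :=
  flatten (map (fun n => rcons (nseq n true) false) s).

Definition bits_to_syms (s : seq bool) : seq nat :=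
  map (fun b : bool => if b then 2 else 1) s.

Definition enc_tm (M : tm) : seq nat :=
  [:: tm_nst M; tm_nsym M; tm_start M; tm_acc M; tm_rej M] ++
  flatten (map (fun e : nat * nat * bool => [:: e.1.1; e.1.2; nat_of_bool e.2])
               (tm_delta M)).

Definition enc_int (z : int) : seq nat :=
  match z with Posz n => [:: 0; n] | Negz n => [:: 1; n.+1] end.

Definition enc_mpg (G : mpg) : seq nat :=
  [:: g_nQ G; g_nS G; g_qI G; size (g_delta G)] ++
  flatten (map (fun e : nat * nat * nat * int =>
                  [:: e.1.1.1; e.1.1.2; e.1.2] ++ enc_int e.2) (g_delta G)) ++
  [:: size (g_obs G)] ++ flatten (map (fun o => size o :: o) (g_obs G)).

Definition tm_word (M : tm) : seq nat := bits_to_syms (unary_enc (enc_tm M)).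
Definition mpg_word (G : mpg) : seq nat := bits_to_syms (unary_enc (enc_mpg G)).

Definition tape_output (t : int -> nat) (u : seq nat) : Prop :=
  (forall k, k < size u -> t (Posz k) = nth 0 u k) /\ t (Posz (size u)) = 0.

Definition computes_within (R : tm) (w : seq nat) (T : nat) (u : seq nat) : Prop :=
  let c := tm_run R (tm_init R w) T in
  c.1.1 = tm_acc R /\ tape_output c.1.2 u.

Definition poly_time_reduction (red : tm -> mpg) : Prop :=
  exists R : tm, valid_tm R /\ 3 <= tm_nsym R /\
  exists c k : nat, forall M, valid_tm M ->
    exists T, T <= c * (size (tm_word M)).+1 ^ k /\
              computes_within R (tm_word M) T (mpg_word (red M)).

(* Main.v *)
(* A play that returns to the initial state is decided at once, by the sign of the minimum of the
   weights carried back; this lets Adam test inequalities between the weights accumulated on a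
   fixed set of tracks, and so lets the game simulate a machine with counters and zero tests: Eve
   proposes the steps, Adam returns to the initial state as soon as she cheats.  Adam gains nothing
   by forgetting a track, because Eve then has an action that punishes exactly this, and no other
   play stops, because one track stays constant and another decreases at each step.  Two counters
   hold the two halves of the tape as numbers in base [S]; two more serve to multiply and divide
   them by [S] by repeated subtraction.  Rejection leaves Eve without an honest action.

   The number of states of the game is constant and each entry of the transition table contributes
   three actions, so the description of the game is produced by nested loops over registers that
   never exceed the input length.  Such loop programs run in polynomial time on a one-tape machine
   which keeps the registers as pebbles on the tape. *)

(* A guard is a one-sided test: it only asks whether a track plus a constant is nonnegative. Each
   counter therefore comes with a second track for its negative, and a zero test is a guard on that
   track. The control location is such a counter too, so choosing an action of the wrong table entry
   is cheating like any other and needs no states of its own. Weights are written as sums of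
   products of machine parameters, or as minus such a sum minus 1. Locations are shifted by 1, and
   [x] is paired with [1 - x], so that every weight needed has one of these two forms. The same
   expressions define the game and drive the program that prints it, and the endpoints of edges do
   not involve them, so that validity of the game is a finite computation independent of the
   machine. If the machine runs forever, neither player wins. Hence neither equivalence follows from
   the other, and refuting a win of Adam cannot always mean exhibiting a win of Eve: there an
   invariant of endless honest play takes its place. *)
Require Import Defs.
From mathcomp Require Import all_boot all_order all_algebra.
From Stdlib Require Import FunctionalExtensionality Classical_Prop.
From mathcomp Require Import zify.
Set Implicit Arguments. Unset Strict Implicit. Unset Printing Implicit Defensive.
Import Order.TTheory GRing.Theory Num.Theory.

(** * Turing machines over finite types *)

Section FiniteMachine.

Variables (St Sy : finType) (syms : seq Sy) (blank : Sy).
Variables (step : St -> Sy -> St * Sy * bool) (q0 qacc qrej : St).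
Hypothesis syms_all : forall a, a \in syms.
Hypothesis acc_neq_rej : qacc != qrej.

Definition fmconfig := (St * (int -> Sy) * int)%type.

Definition fmstep (c : fmconfig) : fmconfig :=
  let: (q, t, h) := c in
  if (q == qacc) || (q == qrej) then c else
  let: (q', b, d) := step q (t h) in
  (q', (fun i => if i == h then b else t i), if d then (h + 1)%R else (h - 1)%R).

(** Symbols are numbered by their position in [syms], an order left free because the input encoding
    prescribes the numbers of some symbols; states are numbered by [enum_rank]. *)
Definition tm_of_fm : tm :=
  TM #|St| (size syms) (enum_rank q0) (enum_rank qacc) (enum_rank qrej)
     (mkseq (fun k =>
        let: (q', b, d) := step (nth q0 (enum St) (k %/ size syms))
                                (nth blank syms (k %% size syms)) in
        (nat_of_ord (enum_rank q'), index b syms, d))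
       (#|St| * size syms)).

Definition code_config (c : fmconfig) : tconfig :=
  (nat_of_ord (enum_rank c.1.1), fun i => index (c.1.2 i) syms, c.2).

Lemma tm_of_fm_valid : valid_tm tm_of_fm.
Proof.
rewrite /valid_tm /= !ltn_ord size_mkseq eqxx /=.
apply/and3P; split.
- by apply: contra acc_neq_rej => /eqP /ord_inj /enum_rank_inj ->.
- by case: (syms) (syms_all blank).
apply/allP => e /mapP [k _ ->].
by case: step => [[q b] d] /=; rewrite ltn_ord index_mem syms_all.
Qed.

Lemma tm_step_fm (c : fmconfig) : tm_step tm_of_fm (code_config c) = code_config (fmstep c).
Proof.
case: c => [[q t] h]; rewrite /tm_step /code_config /=.
have eqr p : (nat_of_ord (enum_rank q) == enum_rank p) = (q == p).
  by apply/eqP/eqP => [/ord_inj /enum_rank_inj | ->].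
rewrite !eqr; case: ifP => //= _.
have lt : index (t h) syms < size syms by rewrite index_mem.
rewrite nth_mkseq; last first.
  apply: (@leq_trans ((enum_rank q).+1 * size syms)); first by rewrite mulSn addnC ltn_add2r.
  by rewrite leq_mul2r ltn_ord orbT.
rewrite divnMDl ?(leq_ltn_trans _ lt) // divn_small // addn0.
rewrite modnMDl modn_small // nth_index // nth_enum_rank.
case: step => [[q' b] d] /=; congr (_, _, _).
by apply: functional_extensionality => i; case: eqP.
Qed.

Lemma tm_run_fm (c : fmconfig) n :
  tm_run tm_of_fm (code_config c) n = code_config (iter n fmstep c).
Proof. by elim: n => //= n IH; rewrite -tm_step_fm -IH. Qed.

End FiniteMachine.

(** * Register machines on a one-tape machine *)

(* Registers are pebbles on the tape: register [r] holds [k] when pebble [r] lies on cell [k]. *)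
Definition reg := 'I_17.

Definition cell := (option bool * option bool * bool * {set reg})%type.
Definition c_inp (c : cell) : option bool := c.1.1.1.
Definition c_out (c : cell) : option bool := c.1.1.2.
Definition c_org (c : cell) : bool := c.1.2.
Definition c_peb (c : cell) : {set reg} := c.2.
Definition raw (x : option bool) : cell := (x, None, false, set0).

Definition raws : seq cell := [:: raw None; raw (Some false); raw (Some true)].
(* The first three symbols are the blank and the two input letters, as the input encoding demands. *)
Definition cells : seq cell := raws ++ [seq c <- enum {: cell} | c \notin raws].

Lemma cells_all c : c \in cells.
Proof. by rewrite mem_cat mem_filter mem_enum andbT orbN. Qed.

Inductive instr :=
| IHalt
| IEmit of bool & nat
| IInc of reg & nat
| IZero of reg & nat
| IEq of reg & reg & nat & nat
| IRead of reg & nat & nat.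

Definition state := ((reg -> nat) * seq bool)%type.

Definition upd (rho : reg -> nat) (r : reg) (v : nat) : reg -> nat :=
  fun r' => if r' == r then v else rho r'.

(* Incrementation saturates at the input length, which bounds all registers. *)
Definition incr (n : nat) (rho : reg -> nat) (r : reg) : reg -> nat :=
  if rho r < n then upd rho r (rho r).+1 else rho.

Section Flat.

Variables (code : seq instr) (w : seq bool).

Definition fstep (c : nat * state) : nat * state :=
  let: (pc, (rho, o)) := c in
  match nth IHalt code pc with
  | IHalt => c
  | IEmit b x => (x, (rho, rcons o b))
  | IInc r x => (x, (incr (size w) rho r, o))
  | IZero r x => (x, (upd rho r 0, o))
  | IEq r r' x y => (if rho r == rho r' then x else y, (rho, o))
  | IRead r x y => (if onth w (rho r) == Some true then x else y, (rho, o))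
  end.

Definition bounded (st : state) : Prop := forall r, st.1 r <= size w.

(* Modes of the control; the machine is ready to execute an instruction when it is
   in mode [mBack] on the cell carrying the origin mark. *)
Definition mInit := 0.
Definition mBack := 1.
Definition mSeek := 2.
Definition mPut := 3.
Definition mBackPut := 4.
Definition mSweep := 5.
Definition mAcc := 6.
Definition mRej := 7.

Definition c_rem (c : cell) r : cell := (c_inp c, c_out c, c_org c, c_peb c :\ r).
Definition c_add (c : cell) r : cell := (c_inp c, c_out c, c_org c, r |: c_peb c).

(** Replaces each output cell by the plain letter; the first cell without output becomes blank,
    which is the end marker that [tape_output] asks for. *)
Definition sweep (c : cell) : nat * nat * cell * bool :=
  if c_out c is Some b then (0, mSweep, raw (Some b), true) else (0, mAcc, raw None, true).

(** Emission looks for the first cell without output, the other instructions for a pebble. Equality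
    of two registers is then visible locally, as two pebbles on one cell. *)
Definition seek (pc : nat) (c : cell) : nat * nat * cell * bool :=
  let on_pebble r res := if r \in c_peb c then res else (pc, mSeek, c, true) in
  match nth IHalt code pc with
  | IHalt => sweep c
  | IEmit b x => if c_out c is None then (x, mBack, (c_inp c, Some b, c_org c, c_peb c), true)
                 else (pc, mSeek, c, true)
  | IInc r x => on_pebble r (if c_inp c is None then (x, mBack, c, true)
                             else (pc, mPut, c_rem c r, true))
  | IZero r x => on_pebble r (pc, mBackPut, c_rem c r, true)
  | IEq r r' x y => on_pebble r (if r' \in c_peb c then x else y, mBack, c, true)
  | IRead r x y => on_pebble r (if c_inp c == Some true then x else y, mBack, c, true)
  end.

Definition put_back (pc : nat) (c : cell) : nat * nat * cell * bool :=
  match nth IHalt code pc with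
  | IInc r x | IZero r x => (x, mBack, c_add c r, true)
  | _ => (pc, mRej, c, true)
  end.

Definition micro (pc m : nat) (c : cell) : nat * nat * cell * bool :=
  match m with
  | 0 => (0, mBack, (c_inp c, None, true, setT), true)
  | 1 => if c_org c then seek pc c else (pc, mBack, c, false)
  | 2 => seek pc c
  | 3 => put_back pc c
  | 4 => if c_org c then put_back pc c else (pc, mBackPut, c, false)
  | 5 => sweep c
  | _ => (pc, mRej, c, true)
  end.

Definition ctrl := ('I_(size code).+1 * 'I_8)%type.
Definition mk (pc m : nat) : ctrl := (inord pc, inord m).

Definition mstep (q : ctrl) (c : cell) : ctrl * cell * bool :=
  let: (pc, m, c', d) := micro q.1 q.2 c in (mk pc m, c', d).

Notation qacc := (mk 0 mAcc).
Notation qrej := (mk 0 mRej).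
Notation mach := (fmstep mstep qacc qrej).

Lemma acc_neq_rej_mk : qacc != qrej.
Proof. by apply/negP => /eqP [] /(congr1 val); rewrite /= !inordK. Qed.

Definition setc (t : int -> cell) (h : int) (c : cell) : int -> cell :=
  fun i => if i == h then c else t i.

Definition apply_micro (t : int -> cell) (h : int) (res : nat * nat * cell * bool) :=
  let: (pc, m, c, d) := res in
  (mk pc m, setc t h c, if d then (h + 1)%R else (h - 1)%R).

Lemma setc_id t h : setc t h (t h) = t.
Proof. by apply: functional_extensionality => i; rewrite /setc; case: eqP => [->|]. Qed.

Lemma mach_micro pc m t h : pc <= size code -> m < 6 ->
  mach (mk pc m, t, h) = apply_micro t h (micro pc m (t h)).
Proof.
move=> hpc hm; rewrite /fmstep.
have hne m' : 5 < m' < 8 -> (mk pc m == mk 0 m') = false.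
  move=> hm'; apply/negP => /eqP [] _ /(congr1 val); rewrite /= !inordK; lia.
rewrite !hne //= /mstep /= !inordK //; last by lia.
by case: micro => [[[pc' m'] c] d].
Qed.

Definition tape (st : state) : int -> cell := fun i =>
  match i with
  | Posz k => (onth w k, onth st.2 k, k == 0, [set r | st.1 r == k])
  | Negz _ => raw None
  end.

Lemma go_back pc m t k : pc <= size code -> (m == mBack) || (m == mBackPut) ->
  (forall j, 0 < j <= k -> c_org (t (Posz j)) = false) ->
  iter k mach (mk pc m, t, Posz k) = (mk pc m, t, Posz 0) :> fmconfig ctrl cell.
Proof.
move=> hpc hm; elim: k => // k IH h; rewrite iterSr mach_micro //; last first.
  by case/orP: hm => /eqP ->.
have hk : c_org (t (Posz k.+1)) = false by apply: h; lia.
have -> : micro pc m (t (Posz k.+1)) = (pc, m, t (Posz k.+1), false).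
  by case/orP: hm => /eqP -> /=; rewrite hk.
rewrite /apply_micro setc_id.
have -> : (Posz k.+1 - 1)%R = Posz k by lia.
by apply: IH => j hj; apply: h; lia.
Qed.

Lemma go_seek pc st x pc' m' c : pc <= size code ->
  (forall j, j < x -> seek pc (tape st (Posz j)) = (pc, mSeek, tape st (Posz j), true)) ->
  seek pc (tape st (Posz x)) = (pc', m', c, true) ->
  iter x.+1 mach (mk pc mBack, tape st, Posz 0)
    = (mk pc' m', setc (tape st) (Posz x) c, Posz x.+1).
Proof.
move=> hpc h hx.
have -> : iter x.+1 mach (mk pc mBack, tape st, Posz 0)
    = apply_micro (tape st) (Posz x) (seek pc (tape st (Posz x))).
  elim: x h {hx} => [|x IH] h; first exact: mach_micro.
  rewrite iterS IH; last by move=> j hj; apply: h; lia.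
  rewrite h // /apply_micro setc_id.
  have -> : (Posz x + 1)%R = Posz x.+1 by lia.
  by rewrite mach_micro.
by rewrite hx /=; congr (_, _, _); lia.
Qed.

Definition targets_ok (i : instr) : bool :=
  match i with
  | IHalt => true
  | IEmit _ x | IInc _ x | IZero _ x => x <= size code
  | IEq _ _ x y | IRead _ x y => (x <= size code) && (y <= size code)
  end.

Lemma onth_rcons (T : Type) (s : seq T) x k :
  onth (rcons s x) k = if k < size s then onth s k else if k == size s then Some x else None.
Proof. by rewrite !onthE map_rcons nth_rcons size_map. Qed.

Lemma tape_org st j : 0 < j -> c_org (tape st (Posz j)) = false.
Proof. by case: j. Qed.

Lemma tape_peb st j r : (r \in c_peb (tape st (Posz j))) = (st.1 r == j).
Proof. by rewrite inE. Qed.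

Lemma fstep_bounded c : bounded c.2 -> bounded (fstep c).2.
Proof.
case: c => pc [rho o] hb; rewrite /fstep; case: nth => //= [r x|r x] r' /=.
- rewrite /incr; case: ifP => h; last exact: hb.
  by rewrite /upd; case: eqP => _ //; apply: hb.
- by rewrite /upd; case: eqP => _ //; apply: hb.
Qed.

(** Each instruction is a round trip from the origin to a pebble or to the end of the output, hence
    the linear bound. *)
Lemma mach_fstep pc st : all targets_ok code -> pc <= size code -> bounded st ->
  exists2 k, k <= 2 * (size w + size st.2) + 8 &
    iter k mach (mk pc mBack, tape st, Posz 0)
    = (mk (fstep (pc, st)).1 mBack, tape (fstep (pc, st)).2, Posz 0)
    /\ (fstep (pc, st)).1 <= size code.
Proof.
move=> hall hpc hb; case: st hb => rho o hb /=.
have htg : targets_ok (nth IHalt code pc).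
  case: (ltnP pc (size code)) => h; first exact: (all_nthP IHalt hall).
  by rewrite nth_default.
have nxt k : (Posz k + 1)%R = Posz k.+1 by lia.
have found r j : j < rho r -> r \in c_peb (tape (rho, o) (Posz j)) = false.
  by move=> h; rewrite tape_peb /=; apply/eqP; lia.
have here r : r \in c_peb (tape (rho, o) (Posz (rho r))) by rewrite tape_peb.
case E: (nth IHalt code pc) htg => [|b x|r x|r x|r r' x y|r x y] /= htg.
- by exists 0.
- exists ((size o).+1 + (size o).+1); first by lia.
  split=> //; rewrite iterD (@go_seek _ _ _ x mBack
     (onth w (size o), Some b, size o == 0, [set r | rho r == size o])) //; first last.
  + by rewrite /seek E /c_out /= onth_default.
  + by move=> j hj; rewrite /seek E; rewrite /c_out /= onthE (nth_map false).
  set t := setc _ _ _.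
  have -> : t = tape (rho, rcons o b).
    apply: functional_extensionality => -[k|k] //.
    rewrite /t /setc /=; case: eqP => [[->]|hk].
      by rewrite onth_rcons ltnn eqxx.
    congr (_, _, _, _); rewrite onth_rcons.
    case: ltnP => // h; case: eqP => // h'; first by case: hk; rewrite h'.
    by rewrite onth_default.
  by rewrite go_back // => j /andP [hj _]; rewrite tape_org.
- have hr := hb r; rewrite /= in hr.
  have nf j : j < rho r ->
      seek pc (tape (rho, o) (Posz j)) = (pc, mSeek, tape (rho, o) (Posz j), true).
    by move=> hj; rewrite /seek E found.
  rewrite /incr; case: ltnP => h.
    exists ((rho r).+2 + (1 + (rho r).+1)); first by lia.
    split=> //; rewrite iterD iterD (@go_seek _ _ _ pc mPut
       (c_rem (tape (rho, o) (Posz (rho r))) r)) //; last first.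
      by rewrite /seek E here /c_inp /= onthE (nth_map false).
    rewrite [iter 1 _ _]mach_micro // /micro /mPut /put_back E /apply_micro nxt.
    set t := setc _ _ _.
    have -> : t = tape (upd rho r (rho r).+1, o).
      apply: functional_extensionality => -[k|k] //.
      rewrite /t /setc /=; case: eqP => [[->]|hk].
        rewrite (_ : Posz (rho r).+1 == Posz (rho r) = false); last by apply/eqP; lia.
        congr (_, _, _, _) => //=.
        apply/setP => r0; rewrite /upd !inE /c_peb /=.
        by case: eqP => [->|hn] //=; rewrite eqxx.
      case: eqP => [[->]|hk'].
        congr (_, _, _, _) => //=.
        apply/setP => r0; rewrite /upd !inE /c_peb /= ?inE.
        by case: (r0 =P r) => //= _; apply/esym/eqP; lia.
      congr (_, _, _, _) => //=; apply/setP => r0; rewrite !inE /upd.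
      case: (r0 =P r) => [->|//]; apply/eqP/eqP => h'; last by case: hk; rewrite h'.
      by case: hk'; rewrite h'.
    by rewrite go_back // => j /andP [hj _]; rewrite tape_org.
  exists ((rho r).+1 + (rho r).+1); first by lia.
  split=> //; rewrite iterD (@go_seek _ _ _ x mBack (tape (rho, o) (Posz (rho r)))) //; last first.
    by rewrite /seek E here /c_inp /= onth_default.
  by rewrite setc_id go_back // => j /andP [hj _]; rewrite tape_org.
- have hr := hb r; rewrite /= in hr.
  (* After the trip back, one step drops the pebble on the origin and moves right, as every put
     does; the last step returns from cell 1. *)
  exists (1 + (1 + ((rho r).+1 + (rho r).+1))); first by lia.
  split=> //; rewrite !iterD (@go_seek _ _ _ pc mBackPut
       (c_rem (tape (rho, o) (Posz (rho r))) r)) //; first last.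
  + by rewrite /seek E here.
  + by move=> j hj; rewrite /seek E found.
  set t := setc _ _ _.
  have ht j : 0 < j -> c_org (t (Posz j)) = false.
    by move=> hj; rewrite /t /setc; case: eqP => [[<-]|_]; apply: tape_org.
  have horg : c_org (t (Posz 0)).
    by rewrite /t /setc; case: eqP => // [[<-]].
  rewrite go_back //; last by move=> j /andP [hj _]; apply: ht.
  rewrite [iter 1 _ (mk pc _, _, _)]mach_micro // /micro /mBackPut horg /put_back E /apply_micro nxt.
  set t' := setc _ _ _.
  have -> : t' = tape (upd rho r 0, o).
    apply: functional_extensionality => -[k|k] //.
    have hn r0 : r0 \in c_peb (t (Posz k)) = (r0 != r) && (rho r0 == k).
      rewrite /t /setc; case: eqP => [[->]|hk]; rewrite /c_peb /= !inE //.
      by case: (r0 =P r) => // ->; apply/eqP => h; case: hk; rewrite h.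
    have hc : (c_inp (t (Posz k)), c_out (t (Posz k)), c_org (t (Posz k)))
              = (onth w k, onth o k, k == 0).
      by rewrite /t /setc; case: eqP => [[->]|].
    have hcell : t' (Posz k) = (onth w k, onth o k, k == 0,
       if k == 0 then r |: c_peb (t (Posz k)) else c_peb (t (Posz k))).
      case: hc => h1 h2 h3; rewrite /t' /setc.
      case: k h1 h2 h3 {hn} => [|k] h1 h2 h3; first by rewrite /= /c_add h1 h2 h3.
      have cellE c : c = (c_inp c, c_out c, c_org c, c_peb c) by case: c => [[[]]].
      by transitivity (t (Posz k.+1)) => //; rewrite [LHS]cellE h1 h2 h3.
    rewrite hcell; congr (_, _, _, _).
    apply/setP => r0; rewrite inE /upd /=.
    case: k hn {hc hcell} => [|k] hn /=; rewrite ?in_setU1 hn; by case: (r0 =P r).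
  rewrite [iter 1 _ _]mach_micro // /micro /mBack tape_org // /apply_micro setc_id.
  by have -> : (Posz 1 - 1)%R = Posz 0 by lia.
- have hr := hb r; rewrite /= in hr.
  have htg' : (if rho r == rho r' then x else y) <= size code by case: ifP; case/andP: htg.
  exists ((rho r).+1 + (rho r).+1); first by lia.
  split=> //; rewrite iterD (@go_seek _ _ _ (if rho r == rho r' then x else y) mBack
     (tape (rho, o) (Posz (rho r)))) //; first last.
  + by rewrite /seek E here tape_peb /= (eq_sym (rho r')).
  + by move=> j hj; rewrite /seek E (found r).
  by rewrite setc_id go_back // => j /andP [hj _]; rewrite tape_org.
- have hr := hb r; rewrite /= in hr.
  have htg' : (if onth w (rho r) == Some true then x else y) <= size code.
    by case: ifP; case/andP: htg.
  exists ((rho r).+1 + (rho r).+1); first by lia.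
  split=> //; rewrite iterD (@go_seek _ _ _ (if onth w (rho r) == Some true then x else y) mBack
     (tape (rho, o) (Posz (rho r)))) //; first last.
  + by rewrite /seek E here.
  + by move=> j hj; rewrite /seek E found.
  by rewrite setc_id go_back // => j /andP [hj _]; rewrite tape_org.
Qed.

Lemma fstep_size c : size (fstep c).2.2 <= (size c.2.2).+1.
Proof.
case: c => pc [rho o] /=; case: nth => //=.
by move=> b _; rewrite size_rcons.
Qed.

Lemma iter_fstep_size k c : size (iter k fstep c).2.2 <= size c.2.2 + k.
Proof.
by elim: k => [|k IH] /=; [lia | have := fstep_size (iter k fstep c); lia].
Qed.

(** The output grows by at most one letter per instruction, so [size st.2 + k] bounds it
    throughout. *)
Lemma mach_iter_fstep k pc st : all targets_ok code -> pc <= size code -> bounded st ->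
  exists2 T, T <= k * (2 * (size w + (size st.2 + k)) + 8) &
    iter T mach (mk pc mBack, tape st, Posz 0)
    = (mk (iter k fstep (pc, st)).1 mBack, tape (iter k fstep (pc, st)).2, Posz 0).
Proof.
move=> hall hpc hb.
suff H : forall j, j <= k ->
  (bounded (iter j fstep (pc, st)).2 /\ (iter j fstep (pc, st)).1 <= size code) /\
  exists2 T, T <= j * (2 * (size w + (size st.2 + k)) + 8) &
    iter T mach (mk pc mBack, tape st, Posz 0)
    = (mk (iter j fstep (pc, st)).1 mBack, tape (iter j fstep (pc, st)).2, Posz 0).
  by case: (H k (leqnn k)).
elim=> [|j IH] hj; first by split=> //; exists 0.
have [[hb' hpc'] [T hT eT]] := IH (ltnW hj).
move: hb' hpc' eT (iter_fstep_size j (pc, st)).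
rewrite iterS; case: (iter j fstep (pc, st)) => pc1 st1 hb1 hpc1 eT hs.
have [T1 hT1 [eT1 hpc2]] := mach_fstep hall hpc1 hb1.
split; first by split=> //; apply: fstep_bounded.
exists (T1 + T); last by rewrite iterD eT.
rewrite mulSn; apply: leq_add => //; apply: (leq_trans hT1).
have {}hs : size st1.2 <= size st.2 + k by apply: (leq_trans hs); rewrite leq_add2l ltnW.
by rewrite leq_add2r leq_pmul2l // leq_add2l.
Qed.

Definition rawtape : int -> cell := fun i => if i is Posz k then raw (onth w k) else raw None.

Lemma mach_init : iter 2 mach (mk 0 mInit, rawtape, Posz 0)
   = (mk 0 mBack, tape (fun=> 0, [::]), Posz 0).
Proof.
rewrite (iterD 1 1) [iter 1 _ (mk 0 mInit, _, _)]mach_micro // /micro /mInit /apply_micro.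
set t := setc _ _ _.
have -> : t = tape (fun=> 0, [::]).
  apply: functional_extensionality => -[k|k] //.
  rewrite /t /setc /=; case: eqP => [[->]|hk].
    congr (_, _, _, _) => //=; apply/setP => r; by rewrite !inE.
  rewrite /raw onth0n; congr (_, _, _, _).
    by case: k hk.
  by apply/setP => r; rewrite !inE; case: k hk.
have -> : (Posz 0 + 1)%R = Posz 1 by lia.
rewrite [iter 1 _ _]mach_micro // /micro /mBack tape_org // /apply_micro setc_id.
by have -> : (Posz 1 - 1)%R = Posz 0 by lia.
Qed.

Lemma mach_sweep st : exists t h,
  iter (size st.2).+1 mach (mk (size code) mBack, tape st, Posz 0) = (qacc, t, h)
  /\ forall k, k <= size st.2 -> t (Posz k) = raw (onth st.2 k).
Proof.
pose tj j : int -> cell := fun i =>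
  if i is Posz k then if k < j then raw (onth st.2 k) else tape st i else tape st i.
have tjS j c : c = raw (onth st.2 j) -> setc (tj j) (Posz j) c = tj j.+1.
  move=> ->; apply: functional_extensionality => -[k|k] //.
  rewrite /setc /tj ltnS -[Posz k == Posz j]/(k == j).
  by case: (k =P j) => [->|hk]; rewrite ?leqnn //; case: ltngtP hk.
(* Cell 0 is swept while still in mode [mBack] at address [size code], where the default instruction
   is [IHalt]; later cells are swept in mode [mSweep]. *)
have hstep j m : m = (if j == 0 then mBack else mSweep) ->
    forall pc, pc = (if j == 0 then size code else 0) ->
    mach (mk pc m, tj j, Posz j)
    = (mk 0 (if j < size st.2 then mSweep else mAcc), tj j.+1, Posz j.+1).
  move=> -> pc ->.
  rewrite mach_micro; [|by case: ifP|by case: ifP].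
  have -> : micro (if j == 0 then size code else 0) (if j == 0 then mBack else mSweep)
              (tj j (Posz j)) = sweep (tape st (Posz j)).
    by rewrite /tj ltnn; case: j => [|j] //=; rewrite /seek nth_default.
  rewrite /sweep (_ : c_out (tape st (Posz j)) = onth st.2 j) //.
  have -> : Posz j.+1 = (Posz j + 1)%R by lia.
  case: ltnP => h.
    have [b hb] : exists b, onth st.2 j = Some b.
      by rewrite onthE (nth_map false) //; eexists.
    by rewrite hb /apply_micro tjS ?hb.
  by rewrite onth_default // /apply_micro tjS ?onth_default.
have t0 : tape st = tj 0 by apply: functional_extensionality => -[].
have H j : j < size st.2 -> iter j.+1 mach (mk (size code) mBack, tape st, Posz 0)
    = (mk 0 mSweep, tj j.+1, Posz j.+1).
  elim: j => [|j IH] hj; first by rewrite t0 [LHS]hstep // hj.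
  by rewrite iterS IH ?hstep ?hj //; lia.
exists (tj (size st.2).+1), (Posz (size st.2).+1); split; last first.
  by move=> k hk; rewrite /tj ltnS hk.
case E : (size st.2) => [|j]; first by rewrite t0 [LHS]hstep // E.
by rewrite iterS H ?hstep ?E ?ltnn.
Qed.

Definition flat_tm : tm :=
  tm_of_fm cells (raw None) mstep (mk 0 mInit) qacc qrej.

Lemma flat_tm_valid : valid_tm flat_tm.
Proof. exact: (tm_of_fm_valid _ _ _ cells_all acc_neq_rej_mk). Qed.

Lemma flat_tm_syms : 3 <= tm_nsym flat_tm.
Proof. by rewrite -[tm_nsym _]/(size (raws ++ _)) size_cat. Qed.

Lemma index_raw x : index (raw x) cells = if x is Some b then if b then 2 else 1 else 0.
Proof. by case: x => [[]|]; rewrite /cells /= !xpair_eqE /= ?eqxx. Qed.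

Lemma flat_tm_computes k st : all targets_ok code ->
  iter k fstep (0, (fun=> 0, [::])) = (size code, st) ->
  exists2 T, T <= 3 + k * (2 * (size w + k) + 9) &
    computes_within flat_tm (bits_to_syms w) T (bits_to_syms st.2).
Proof.
move=> hall hk.
have hb : bounded (fun=> 0, [::]) by [].
have [T hT eT] := mach_iter_fstep k hall (leq0n _) hb.
have [t [h [et ht]]] := mach_sweep st.
have hs : size st.2 <= k by have := iter_fstep_size k (0, (fun=> 0, [::])); rewrite hk /=; lia.
exists ((size st.2).+1 + (T + 2)).
  rewrite /= add0n in hT; nia.
rewrite /computes_within.
have -> : tm_init flat_tm (bits_to_syms w)
    = code_config cells (mk 0 mInit, rawtape, Posz 0).
  rewrite /tm_init /code_config; congr (_, _, _).
  apply: functional_extensionality => i; apply/esym.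
  rewrite -[LHS]/(index (rawtape i) cells).
  case: i => i; rewrite /rawtape index_raw //.
  case: (ltnP i (size w)) => hi.
    by rewrite [RHS](nth_map false) // onthE (nth_map false).
  by rewrite [RHS]nth_default ?size_map // onth_default.
rewrite tm_run_fm; last exact: cells_all.
rewrite !iterD mach_init eT hk et; split=> //.
rewrite /code_config -[(_, _, _).1.2]/(fun i => index (t i) cells); split.
  move=> i; rewrite size_map => hi; rewrite ht ?index_raw; last exact: ltnW.
  by rewrite [RHS](nth_map false) // onthE (nth_map false).
by rewrite size_map ht // index_raw onth_default.
Qed.

End Flat.

(** * Loop programs *)

Inductive cmd :=
| Emit of bool
| Inc of reg
| Zero of reg
| Seq of cmd & cmd
| IfEq of reg & reg & cmd & cmd
| For of reg & reg & cmd
| WhileRead of reg & cmd.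

Fixpoint modifies (c : cmd) (r : reg) : bool :=
  match c with
  | Emit _ => false
  | Inc r' | Zero r' => r == r'
  | Seq c1 c2 | IfEq _ _ c1 c2 => modifies c1 r || modifies c2 r
  | For i _ c | WhileRead i c => (r == i) || modifies c r
  end.

(** A loop body changes neither counter nor bound, so the number of rounds is known on entry and is
    at most the input length; [cost] relies on this. *)
Fixpoint wf_cmd (c : cmd) : bool :=
  match c with
  | Seq c1 c2 | IfEq _ _ c1 c2 => wf_cmd c1 && wf_cmd c2
  | For i r c => [&& i != r, ~~ modifies c i, ~~ modifies c r & wf_cmd c]
  | WhileRead r c => ~~ modifies c r && wf_cmd c
  | _ => true
  end.

Fixpoint len (c : cmd) : nat :=
  match c with
  | Seq c1 c2 => len c1 + len c2
  | IfEq _ _ c1 c2 => (len c1 + len c2).+1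
  | For _ _ c => (len c).+3
  | WhileRead _ c => (len c).+2
  | _ => 1
  end.

(** The code is to be placed at address [a] and leaves by jumping to [x]. *)
Fixpoint compile (c : cmd) (a x : nat) : seq instr :=
  match c with
  | Emit b => [:: IEmit b x]
  | Inc r => [:: IInc r x]
  | Zero r => [:: IZero r x]
  | Seq c1 c2 => compile c1 a (a + len c1) ++ compile c2 (a + len c1) x
  | IfEq r r' c1 c2 =>
      IEq r r' a.+1 (a.+1 + len c1) :: compile c1 a.+1 x ++ compile c2 (a.+1 + len c1) x
  | For i r c =>
      [:: IZero i a.+1, IEq i r x a.+2 & compile c a.+2 (a.+2 + len c)] ++ [:: IInc i a.+1]
  | WhileRead r c =>
      (IRead r a.+1 x :: compile c a.+1 (a.+1 + len c)) ++ [:: IInc r a]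
  end.

Fixpoint cost (c : cmd) (n : nat) : nat :=
  match c with
  | Seq c1 c2 => cost c1 n + cost c2 n
  | IfEq _ _ c1 c2 => (cost c1 n + cost c2 n).+1
  | For _ _ c | WhileRead _ c => 2 + n * (cost c n + 2)
  | _ => 1
  end.

Lemma size_compile c a x : size (compile c a x) = len c.
Proof.
elim: c a x => //= [c1 IH1 c2 IH2|r r' c1 IH1 c2 IH2|i r c IH|r c IH] a x;
  by rewrite size_cat ?IH1 ?IH2 ?IH //= ?addn1.
Qed.

Lemma len_gt0 c : 0 < len c.
Proof. by elim: c => //= c1 IH1 c2 IH2; rewrite addn_gt0 IH1. Qed.

Lemma compile_targets code c a x : a + len c <= size code -> x <= size code ->
  all (targets_ok code) (compile c a x).
Proof.
elim: c a x => //= [b|r|r|c1 IH1 c2 IH2|r r' c1 IH1 c2 IH2|i r c IH|r c IH] a x hm hx;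
  rewrite ?hx //.
- have := len_gt0 c2 => h2; rewrite all_cat IH1 ?IH2 //; lia.
- have := len_gt0 c1; have := len_gt0 c2 => h2 h1; rewrite all_cat IH1 ?IH2 ?andbT //; lia.
- rewrite all_cat IH //=; lia.
- rewrite all_cat IH //=; lia.
Qed.

(** * Semantics of loop programs and correctness of their compilation *)

Section Semantics.

Variable w : seq bool.

Definition incr_st (r : reg) (st : state) : state := (incr (size w) st.1 r, st.2).

Fixpoint sem (c : cmd) (st : state) : state :=
  match c with
  | Emit b => (st.1, rcons st.2 b)
  | Inc r => incr_st r st
  | Zero r => (upd st.1 r 0, st.2)
  | Seq c1 c2 => sem c2 (sem c1 st)
  | IfEq r r' c1 c2 => if st.1 r == st.1 r' then sem c1 st else sem c2 st
  | For i r c => iter (st.1 r) (fun s => incr_st i (sem c s)) (upd st.1 i 0, st.2)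
  | WhileRead r c =>
      iter (find negb (drop (st.1 r) w)) (fun s => incr_st r (sem c s)) st
  end.

Lemma incr_st_bounded r st : bounded w st -> bounded w (incr_st r st).
Proof.
move=> hb r'; rewrite /incr_st /incr /=; case: ifP => h; last exact: hb.
by rewrite /upd; case: eqP => _ //; apply: hb.
Qed.

Lemma upd0_bounded r st : bounded w st -> bounded w (upd st.1 r 0, st.2).
Proof. by move=> hb r'; rewrite /= /upd; case: eqP => // _; apply: hb. Qed.

Lemma sem_bounded c st : bounded w st -> bounded w (sem c st).
Proof.
elim: c st => [b|r|r|c1 IH1 c2 IH2|r r' c1 IH1 c2 IH2|i r c IH|r c IH] st hb //=.
- exact: incr_st_bounded.
- exact: upd0_bounded.
- by apply: IH2; apply: IH1.
- by case: ifP => _; [apply: IH1 | apply: IH2].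
- elim: (st.1 r) => [|k IHk] /=; first exact: upd0_bounded.
  by apply: incr_st_bounded; apply: IH.
- elim: (find _ _) => [|k IHk] //=.
  by apply: incr_st_bounded; apply: IH.
Qed.

Lemma incr_st_other i r st : r != i -> (incr_st i st).1 r = st.1 r.
Proof.
by move=> h; rewrite /incr_st /incr /=; case: ifP => // _; rewrite /upd (negbTE h).
Qed.

Lemma incr_st_same i st : st.1 i < size w -> (incr_st i st).1 i = (st.1 i).+1.
Proof. by move=> h; rewrite /incr_st /incr /= h /upd eqxx. Qed.

Lemma sem_unmodified c r st : ~~ modifies c r -> (sem c st).1 r = st.1 r.
Proof.
elim: c st => [b|r1|r1|c1 IH1 c2 IH2|r1 r' c1 IH1 c2 IH2|i r1 c IH|r1 c IH] st //=.
- exact: incr_st_other.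
- by rewrite /upd; case: eqP.
- by rewrite negb_or => /andP [h1 h2]; rewrite IH2 // IH1.
- by rewrite negb_or => /andP [h1 h2]; case: ifP => _; rewrite ?IH2 ?IH1.
- rewrite negb_or => /andP [h1 h2].
  elim: (st.1 r1) => [|k IHk]; first by rewrite /= /upd (negbTE h1).
  by rewrite iterS incr_st_other // IH.
- rewrite negb_or => /andP [h1 h2].
  elim: (find _ _) => [|k IHk] //.
  by rewrite iterS incr_st_other // IH.
Qed.

Definition code_at (code : seq instr) (a : nat) (l : seq instr) : Prop :=
  forall k, k < size l -> nth IHalt code (a + k) = nth IHalt l k.

Lemma code_at_cat code a l1 l2 : code_at code a (l1 ++ l2) ->
  code_at code a l1 /\ code_at code (a + size l1) l2.
Proof.
move=> h; split=> k hk.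
  by rewrite h ?nth_cat ?hk // size_cat; lia.
by rewrite -addnA h ?size_cat ?ltn_add2l // nth_cat ltnNge leq_addr addKn.
Qed.

Lemma code_at_cons code a i l : code_at code a (i :: l) ->
  nth IHalt code a = i /\ code_at code a.+1 l.
Proof.
move=> h; split; first by have := h 0 isT; rewrite addn0.
by move=> k hk; have := h k.+1 hk; rewrite addnS.
Qed.

Lemma compile_correct code c a x st : wf_cmd c -> bounded w st -> code_at code a (compile c a x) ->
  exists2 k, k <= cost c (size w) & iter k (fstep code w) (a, st) = (x, sem c st).
Proof.
elim: c a x st => [b|r|r|c1 IH1 c2 IH2|r r' c1 IH1 c2 IH2|i r c IH|r c IH] a x [rho o] /= hwf hb.
- by case/code_at_cons => h _; exists 1; rewrite //= h.
- by case/code_at_cons => h _; exists 1; rewrite //= h.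
- by case/code_at_cons => h _; exists 1; rewrite //= h.
- case/andP: hwf => wf1 wf2 /code_at_cat; rewrite size_compile => -[h1 h2].
  have [k1 b1 e1] := IH1 _ _ _ wf1 hb h1.
  have [k2 b2 e2] := IH2 _ _ _ wf2 (sem_bounded c1 hb) h2.
  by exists (k2 + k1); [rewrite addnC leq_add | rewrite iterD e1].
- case/andP: hwf => wf1 wf2 /code_at_cons [h0 /code_at_cat]; rewrite size_compile => -[h1 h2].
  case E: (rho r == rho r').
    have [k1 b1 e1] := IH1 _ _ _ wf1 hb h1.
    exists (k1 + 1); first by lia.
    by rewrite iterD [iter 1 _ _]/= h0 E.
  have [k2 b2 e2] := IH2 _ _ _ wf2 hb h2.
  exists (k2 + 1); first by lia.
  by rewrite iterD [iter 1 _ _]/= h0 E.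
- case/and4P: hwf => hir mi mr wf /code_at_cons [h0] /code_at_cons [h1] /code_at_cat.
  rewrite size_compile => -[h2 /code_at_cons [h3 _]].
  set B := fun s : state => incr_st i _; set st0 : state := (upd rho i 0, o).
  have hr := hb r; rewrite /= in hr.
  suff H : forall j, j <= rho r ->
    [/\ (iter j B st0).1 i = j, (iter j B st0).1 r = rho r, bounded w (iter j B st0) &
     exists2 k, k <= j * (cost c (size w) + 2) &
       iter k (fstep code w) (a.+1, st0) = (a.+1, iter j B st0)].
    have [ei er _ [k bk ek]] := H _ (leqnn (rho r)).
    exists (1 + (k + 1)); first by have := leq_mul hr (leqnn (cost c (size w) + 2)); lia.
    rewrite iterD [iter (k + 1) _ _]iterD [iter 1 _ (a, _)]/= h0 ek.
    move: ei er; case: (iter (rho r) B st0) => rho' o' /= ei er.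
    by rewrite h1 ei er eqxx.
  elim=> [|j IHj] hj.
    rewrite /st0; split=> //=; first by rewrite /upd eqxx.
    - by rewrite /upd eq_sym (negbTE hir).
    - exact: upd0_bounded hb.
    - by exists 0.
  have [ei er hbj [k bk ek]] := IHj (ltnW hj).
  set s := iter j B st0 in ei er hbj ek.
  have [k1 b1 e1] := IH _ _ _ wf hbj h2.
  have ui : (sem c s).1 i = j by rewrite sem_unmodified.
  have ur : (sem c s).1 r = rho r by rewrite sem_unmodified.
  rewrite [iter j.+1 B st0]/(B s) /B; split.
  + by rewrite incr_st_same ui //; lia.
  + by rewrite incr_st_other // eq_sym.
  + by apply: incr_st_bounded; apply: sem_bounded.
  exists (1 + (k1 + (1 + k))); first by rewrite mulSn; lia.
  rewrite iterD [iter (k1 + _) _ _]iterD [iter (1 + k) _ _]iterD ek.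
  have -> : iter 1 (fstep code w) (a.+1, s) = (a.+2, s).
    move: ei er; case: (s) => rho' o' /= ei er; rewrite h1 ei er.
    by rewrite (_ : j == rho r = false) //; apply/eqP; lia.
  rewrite e1 /=; case: (sem c s) => rho' o' /=.
  by rewrite h3.
- case/andP: hwf => mr wf /code_at_cons [h0] /code_at_cat.
  rewrite size_compile => -[h2 /code_at_cons [h3 _]].
  set B := fun s : state => incr_st r _; set st0 : state := (rho, o); set v := find _ _.
  have hr := hb r; rewrite /= in hr.
  have hv : rho r + v <= size w.
    by have := find_size negb (drop (rho r) w); rewrite size_drop -/v; lia.
  have hnth j : j < v -> onth w (rho r + j) = Some true.
    move=> hj; have := before_find false hj; rewrite nth_drop.
    rewrite onthE (nth_map false); last by lia.
    by case: nth.
  have hend : onth w (rho r + v) != Some true.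
    case: (ltnP v (size (drop (rho r) w))) => hlt.
      have : has negb (drop (rho r) w) by rewrite has_find.
      move/(nth_find false); rewrite nth_drop -/v.
      rewrite onthE (nth_map false); last by move: hlt; rewrite size_drop; lia.
      by case: nth.
    by rewrite onth_default //; move: hlt; rewrite size_drop; lia.
  suff H : forall j, j <= v ->
    [/\ (iter j B st0).1 r = rho r + j, bounded w (iter j B st0) &
     exists2 k, k <= j * (cost c (size w) + 2) &
       iter k (fstep code w) (a, st0) = (a, iter j B st0)].
    have [er _ [k bk ek]] := H _ (leqnn v).
    have hv' : v <= size w by lia.
    exists (1 + k); first by have := leq_mul hv' (leqnn (cost c (size w) + 2)); lia.
    rewrite iterD ek; move: er; case: (iter v B st0) => rho' o' /= er.
    by rewrite h0 er (negbTE hend).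
  elim=> [|j IHj] hj.
    by split=> //=; [rewrite addn0 | exists 0].
  have [er hbj [k bk ek]] := IHj (ltnW hj).
  set s := iter j B st0 in er hbj ek.
  have [k1 b1 e1] := IH _ _ _ wf hbj h2.
  have ur : (sem c s).1 r = rho r + j by rewrite sem_unmodified.
  rewrite [iter j.+1 B st0]/(B s) /B; split.
  + by rewrite incr_st_same ur ?addnS //; lia.
  + by apply: incr_st_bounded; apply: sem_bounded.
  exists (1 + (k1 + (1 + k))); first by rewrite mulSn; lia.
  rewrite iterD [iter (k1 + _) _ _]iterD [iter (1 + k) _ _]iterD ek.
  have -> : iter 1 (fstep code w) (a, s) = (a.+1, s).
    move: er; case: (s) => rho' o' /= er; rewrite h0 er.
    by rewrite hnth.
  rewrite e1 /=; case: (sem c s) => rho' o' /=.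
  by rewrite h3.
Qed.

End Semantics.

(** * Polynomial bounds and the running time of loop programs *)

Definition polyb (f : nat -> nat) : Prop := exists c k, forall n, f n <= c * n.+1 ^ k.

Lemma polyb_const a : polyb (fun=> a).
Proof. by exists a, 0 => n; rewrite muln1. Qed.

Lemma polyb_id : polyb id.
Proof. by exists 1, 1 => n; rewrite mul1n expn1. Qed.

Lemma polyb_mul f g : polyb f -> polyb g -> polyb (fun n => f n * g n).
Proof.
move=> [c [k hf]] [d [l hg]]; exists (c * d), (k + l) => n.
by rewrite expnD mulnACA leq_mul.
Qed.

Lemma polyb_add f g : polyb f -> polyb g -> polyb (fun n => f n + g n).
Proof.
move=> [c [k hf]] [d [l hg]]; exists (c + d), (k + l) => n.
rewrite mulnDl leq_add //; apply: (leq_trans (hf n) _) || apply: (leq_trans (hg n) _);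
  by rewrite leq_mul2l leq_pexp2l ?leq_addr ?leq_addl ?orbT.
Qed.

Lemma polyb_cost c : polyb (cost c).
Proof.
elim: c => /= *; try exact: polyb_const; try exact: polyb_add.
- apply: (@polyb_add (fun=> 1)); [exact: polyb_const | exact: polyb_add].
- apply: polyb_add; first exact: polyb_const.
  apply: polyb_mul; [exact: polyb_id | apply: polyb_add => //; exact: polyb_const].
- apply: polyb_add; first exact: polyb_const.
  apply: polyb_mul; [exact: polyb_id | apply: polyb_add => //; exact: polyb_const].
Qed.

Theorem cmd_poly_time (c : cmd) : wf_cmd c ->
  exists R : tm, valid_tm R /\ 3 <= tm_nsym R /\
  exists a k : nat, forall w, exists T, T <= a * (size w).+1 ^ k /\
    computes_within R (bits_to_syms w) T (bits_to_syms (sem w c (fun=> 0, [::])).2).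
Proof.
move=> hwf; pose code := compile c 0 (len c).
exists (flat_tm code); split; first exact: flat_tm_valid.
split; first exact: flat_tm_syms.
pose bnd n := 3 + cost c n * (2 * (n + cost c n) + 9).
have [a [k hak]] : polyb bnd.
  have pc := polyb_cost c.
  apply: polyb_add; first exact: polyb_const.
  apply: polyb_mul => //; apply: polyb_add; last exact: polyb_const.
  apply: polyb_mul; first exact: polyb_const.
  by apply: polyb_add => //; exact: polyb_id.
exists a, k => w.
have hsz : size code = len c by rewrite size_compile.
have hall : all (targets_ok code) code by apply: compile_targets; rewrite ?hsz ?add0n.
have hb : bounded w (fun=> 0, [::]) by [].
have hat : code_at code 0 (compile c 0 (len c)) by move=> j _; rewrite add0n.
have [j bj ej] := compile_correct hwf hb hat.
rewrite -hsz in ej.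
have [T hT hc] := flat_tm_computes hall ej.
exists T; split=> //; apply: leq_trans (hak _); apply: (leq_trans hT).
rewrite leq_add2l leq_mul // leq_add2r leq_mul2l /= leq_add2l //.
Qed.

(** * Games simulating guarded counters *)

(* State 0 is initial, 1 and 2 are sinks with loops of weight 0 (good for Eve) and -1 (good for
   Adam); the remaining states form one observation and are called tracks. *)
Definition tracks : seq nat := iota 3 14.
Definition trk (q : nat) : bool := q \in tracks.

(* [Move mv gs] sends the track listed at index [i] of [mv] to track [3 + i]; Adam may also answer
   a [Move] or an [Accept] by returning to the initial state along the guards [gs], where he wins
   exactly if some guard is negative.  [Pun t] lets Eve win if Adam has forgotten track [t]. *)
Inductive action (W : Type) :=
| Move of seq (nat * W) & seq (nat * W)
| Accept of seq (nat * W)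
| Pun of nat.
Arguments Pun {W}.

Section Transitions.

Variables (W : Type) (w0 wm1 : W).

Definition guard_edges (gs : seq (nat * W)) : seq (nat * nat * W) :=
  [seq (g.1, 0, g.2) | g <- gs].

Definition act_edges (a : action W) : seq (nat * nat * W) :=
  match a with
  | Move mv gs => [seq (p.2.1, p.1, p.2.2) | p <- zip tracks mv] ++ guard_edges gs
  | Accept gs => [seq (t, 1, w0) | t <- tracks] ++ guard_edges gs
  | Pun t0 => [seq (t, if t == t0 then 2 else 1, w0) | t <- tracks]
  end.

(** Only action 0 leads from the initial state to the tracks; after any other first action Adam can
    win in sink 2, so the opening is forced. On the tracks, action 0 keeps its meaning as a
    punishment. *)
Definition base_edges (init : seq W) (s : nat) : seq (nat * nat * W) :=
  (if s == 0 then [seq (0, p.1, p.2) | p <- zip tracks init] else [:: (0, 2, w0)])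
  ++ [:: (1, 1, w0); (2, 2, wm1)].

Definition edges init (acts : nat -> action W) s : seq (nat * nat * W) :=
  base_edges init s ++ act_edges (acts s).

End Transitions.

Definition with_action (A W : Type) (s : A) (l : seq (nat * nat * W)) : seq (nat * A * nat * W) :=
  [seq (e.1.1, s, e.1.2, e.2) | e <- l].

Definition game_obs : seq (seq nat) := [:: [:: 0]; [:: 1]; [:: 2]; tracks].

(** Speaks of endpoints only, so that for the reduction it can be decided by computation on fixed
    lists. The last clause says that the post-image is a union of observations; for the singletons
    this is automatic, and only the observation [tracks] has to be checked. *)
Definition edges_ok (l : seq (nat * nat)) : bool :=
  [&& uniq l, all (fun q => q \in unzip1 l) (iota 0 17),
      all (fun e => (e.1 < 17) && (e.2 < 17)) l &
      all (fun o : seq nat =>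
        has (fun e => (e.1 \in o) && trk e.2) l ==>
        all (fun t => has (fun e => (e.1 \in o) && (e.2 == t)) l) tracks) game_obs].

(** The last two conditions on a [Move] make track 3 a clock and keep track 4 constant; [hon_noterm]
    rests on them. *)
Definition act_ok (a : action int) : bool :=
  match a with
  | Move mv gs =>
    [&& size mv == 14, all (fun p => trk p.1) mv, all (fun p => trk p.1) gs,
        nth (0, 0%R) mv 0 == (3, (-1)%R) & nth (0, 0%R) mv 1 == (4, 0%R)]
  | Accept gs => all (fun p => trk p.1) gs
  | Pun t => trk t
  end.

Definition ofv (val : nat -> int) : Ffun := fun q => if trk q then Fin (val q) else Bot.
Definition pt (q0 : nat) (e : ext) : Ffun := fun q => if q == q0 then e else Bot.

Definition vnext (mv : seq (nat * int)) (val : nat -> int) : nat -> int :=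
  fun t => let p := nth (0, 0%R) mv (t - 3) in (val p.1 + p.2)%R.

Definition legal (val : nat -> int) (gs : seq (nat * int)) : bool :=
  all (fun g => (0 <= val g.1 + g.2)%R) gs.

(** The one finite weight with which Adam can reach state 0 along a nonempty list of guards. *)
Fixpoint gmin (val : nat -> int) (gs : seq (nat * int)) : int :=
  match gs with
  | [::] => 0%R
  | [:: g] => (val g.1 + g.2)%R
  | g :: gs' => Order.min (val g.1 + g.2)%R (gmin val gs')
  end.

Lemma gmin_mem val gs : gs != [::] -> exists2 g, g \in gs & gmin val gs = (val g.1 + g.2)%R.
Proof.
elim: gs => // g [|g' gs] IH _; first by exists g; rewrite ?mem_head.
have [//|g0 h0 e0] := IH.
rewrite [gmin _ _]/(Order.min _ (gmin val (g' :: gs))).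
case: leP => _; last by exists g; rewrite ?mem_head.
by exists g0 => //; rewrite inE h0 orbT.
Qed.

Lemma gmin_le val gs g : g \in gs -> (gmin val gs <= val g.1 + g.2)%R.
Proof.
elim: gs => // g1 [|g' gs] IH; first by rewrite inE => /eqP ->.
rewrite [gmin _ _]/(Order.min _ (gmin val (g' :: gs))) inE ge_min.
by case/orP => [/eqP ->|/IH ->]; rewrite ?lexx ?orbT.
Qed.

Lemma gmin_lt0 val gs : ~~ legal val gs -> (gmin val gs < 0)%R.
Proof. by case/allPn => g hg; rewrite -ltNge; apply: le_lt_trans; apply: gmin_le. Qed.

Lemma trkE q : trk q = (3 <= q < 17).
Proof. by rewrite /trk /tracks mem_iota. Qed.

Lemma mem_zip_tracks (W : eqType) (d : W) l t p : size l = 14 ->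
  ((t, p) \in zip tracks l) = trk t && (nth d l (t - 3) == p).
Proof.
move=> hl; have hz : size (zip tracks l) = 14 by rewrite size_zip hl.
have hn i : i < 14 -> nth (0, d) (zip tracks l) i = (3 + i, nth d l i).
  by move=> hi; rewrite nth_zip ?hl // nth_iota.
apply/(nthP (0, d))/andP => [[i]|[]].
  rewrite hz => hi; rewrite hn // => -[<- <-]; rewrite addKn eqxx trkE; split=> //; lia.
rewrite trkE => ht /eqP <-; exists (t - 3); first by rewrite hz; lia.
by rewrite hn; [congr (_, _); lia | lia].
Qed.

Section Game.

Variables (nS : nat) (acts : nat -> action int) (init : seq int).

Definition game : mpg :=
  MPG 17 nS 0
    (flatten [seq with_action s (edges 0%R (-1)%R init acts s) | s <- iota 0 nS]) game_obs.

Hypothesis nS_pos : 14 <= nS.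
Hypothesis acts_pun : forall t, trk t -> acts (t - 3) = Pun t.
Hypothesis acts_ok : forall s, s < nS -> act_ok (acts s).
Hypothesis acts_edges : forall s, s < nS ->
  edges_ok (map fst (edges 0%R (-1)%R init acts s)).
Hypothesis init_size : size init = 14.
Hypothesis init_V : nth 0%R init 0 = (-1)%R.
Hypothesis init_U : nth 0%R init 1 = 0%R.

Let E s := edges 0%R (-1)%R init acts s.

Lemma mem_delta x s y w :
  ((x, s, y, w) \in g_delta game) = (s < nS) && ((x, y, w) \in E s).
Proof.
apply/flatten_mapP/andP => [[s' hs' /mapP [[[x' y'] w'] h [-> -> -> ->]]]|[hs h]].
  by rewrite mem_iota in hs'; split.
exists s; first by rewrite mem_iota.
by apply/mapP; exists (x, y, w).
Qed.

Lemma trans_mem x s y : trans game x s y <-> s < nS /\ (x, y) \in map fst (E s).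
Proof.
split=> [[w]|[hs /mapP [[[x' y'] w] h [-> ->]]]].
  by rewrite mem_delta => /andP [hs h]; split=> //; apply/mapP; exists (x, y, w).
by exists w; rewrite mem_delta hs.
Qed.

Lemma game_valid : valid_mpg game.
Proof.
split; first by [].
split; first exact: leq_trans nS_pos.
split.
  move=> [[[x s] y] w]; rewrite mem_delta => /andP [hs h] /=; rewrite hs /=.
  case/and4P: (acts_edges hs) => _ _ /allP h' _.
  by apply: (h' (x, y)); apply/mapP; exists (x, y, w).
split.
  rewrite /game /= map_flatten -map_comp.
  have -> : flatten [seq ([eta map (fun e => e.1)] \o (fun s => with_action s (E s))) i
                       | i <- iota 0 nS]
          = [seq (e.1, s, e.2) | s <- iota 0 nS, e <- map fst (E s)].
    congr flatten; apply: eq_map => s /=.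
    by rewrite /with_action -!map_comp; apply: eq_map.
  apply: allpairs_uniq_dep => [|s|[s [a b]] [s' [a' b']] _ _ /= [-> -> ->]] //.
    exact: iota_uniq.
  by rewrite mem_iota => hs; case/and4P: (acts_edges hs).
split.
  move=> q s hq hs; case/and4P: (acts_edges hs) => _ /allP h _ _.
  have : q \in iota 0 17 by rewrite mem_iota.
  move/h => /mapP [[x y] hxy ->]; exists y.
  by apply/trans_mem.
split.
  move=> o; rewrite 4!inE => /or4P [] /eqP ->; split=> // q; rewrite ?mem_iota ?inE.
  - by move=> /eqP ->.
  - by move=> /eqP ->.
  - by move=> /eqP ->.
  - by case/andP.
split.
  move=> q hq; case: q hq => [|[|[|q]]] hq.
  - by exists [:: 0].
  - by exists [:: 1].
  - by exists [:: 2].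
  exists tracks; split=> //; rewrite -[_ \in _]/(trk q.+3) trkE; exact: hq.
split.
  move=> o o' q ho ho' hq hq'.
  suff -> : o = o' by [].
  by move: ho ho' hq hq'; rewrite 4!inE => /or4P [] /eqP ->; rewrite 4!inE => /or4P [] /eqP -> //;
    rewrite ?inE ?mem_iota; lia.
split; first by exists [:: 0].
move=> o o' s ho ho' [q1 [hq1 [q [hq /trans_mem [hs hqq]]]]] q' hq'.
case/and4P: (acts_edges hs) => _ _ _ /allP h.
move: ho' hq1 hq'; rewrite 4!inE.
case/or4P => /eqP ->; try by rewrite !inE => /eqP e1 /eqP e2; exists q; split=> //;
  apply/trans_mem; rewrite e2 -e1.
move=> h1 h2; have /implyP himp := h o ho.
have : has (fun e => (e.1 \in o) && trk e.2) (map fst (E s)).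
  by apply/hasP; exists (q, q1); rewrite //= hq.
move/himp/allP/(_ _ h2)/hasP => [[x y] hxy /= /andP [hx /eqP e]].
by exists x; split=> //; apply/trans_mem; rewrite -e.
Qed.

Lemma E_track s x y w : trk x -> ((x, y, w) \in E s) = ((x, y, w) \in act_edges 0%R (acts s)).
Proof.
move=> hx; rewrite /E /edges mem_cat.
suff -> : (x, y, w) \in base_edges 0%R (-1)%R init s = false by [].
apply/negP; rewrite mem_cat => /orP [|].
  case: eqP => _; last by rewrite inE => /eqP [e _ _]; rewrite e in hx.
  by case/mapP => p _ [e _ _]; rewrite e in hx.
by rewrite !inE => /orP [] /eqP [e _ _]; rewrite e in hx.
Qed.

Lemma E_low s x y w : s < nS -> ~~ trk x ->
  ((x, y, w) \in E s) = ((x, y, w) \in base_edges 0%R (-1)%R init s).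
Proof.
move=> hs hx; rewrite /E /edges mem_cat orbC.
suff -> : (x, y, w) \in act_edges 0%R (acts s) = false by [].
apply/negP; have := acts_ok hs; case: (acts s) => [mv gs|gs|t]; rewrite /act_ok /act_edges.
- case/and5P => h1 /allP h2 /allP h3 _ _; rewrite mem_cat => /orP [] /mapP.
    case=> -[t p]; rewrite (mem_zip_tracks (0, 0%R)) ?(eqP h1) // => /andP [ht /eqP hp] [e _ _].
    have : p \in mv by rewrite -hp; apply: mem_nth; rewrite (eqP h1); move: ht; rewrite trkE; lia.
    by move/h2; rewrite -e (negbTE hx).
  by case=> g h [e _ _]; have := h3 _ h; rewrite -e (negbTE hx).
- move/allP => h3; rewrite mem_cat => /orP [] /mapP.
    by case=> t h [e _ _]; move: hx; rewrite e /trk h.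
  by case=> g h [e _ _]; have := h3 _ h; rewrite -e (negbTE hx).
- by move=> _ /mapP [t' h [e _ _]]; move: hx; rewrite e /trk h.
Qed.

Lemma E_move s x y w mv gs : s < nS -> acts s = Move mv gs -> trk x ->
  ((x, y, w) \in E s) =
  (trk y && (nth (0, 0%R) mv (y - 3) == (x, w))) || ((y == 0) && ((x, w) \in gs)).
Proof.
move=> hs es hx; have := acts_ok hs; rewrite es => /and5P [/eqP h1 _ _ _ _].
rewrite E_track // es /act_edges mem_cat; congr (_ || _).
  rewrite -mem_zip_tracks //; apply/mapP/idP => [[[t p] h [-> -> ->]]|h].
    by rewrite -surjective_pairing.
  by exists (y, (x, w)).
apply/mapP/andP => [[[g v] h [-> -> ->]] //|[/eqP -> h]].
by exists (x, w).
Qed.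

Lemma E_accept s x y w gs : s < nS -> acts s = Accept gs -> trk x ->
  ((x, y, w) \in E s) = ((y == 1) && (w == 0%R)) || ((y == 0) && ((x, w) \in gs)).
Proof.
move=> hs es hx; rewrite E_track // es /act_edges mem_cat; congr (_ || _).
  apply/mapP/andP => [[t h [_ -> ->]] //|[/eqP -> /eqP ->]].
  by exists x.
apply/mapP/andP => [[[g v] h [-> -> ->]] //|[/eqP -> h]].
by exists (x, w).
Qed.

Lemma E_pun s x y w t : s < nS -> acts s = Pun t -> trk x ->
  ((x, y, w) \in E s) = (y == if x == t then 2 else 1) && (w == 0%R).
Proof.
move=> hs es hx; rewrite E_track // es /act_edges.
apply/mapP/andP => [[t' h [-> -> ->]] //|[/eqP -> /eqP ->]].
by exists x.
Qed.

Lemma E_init s y w : s < nS ->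
  ((0, y, w) \in E s) = if s == 0 then trk y && (nth 0%R init (y - 3) == w)
                        else (y == 2) && (w == 0%R).
Proof.
move=> hs; rewrite E_low // mem_cat orbC !inE /=; case: eqP => _.
  rewrite -mem_zip_tracks //; apply/mapP/idP => [[[t p] h [-> ->]] //|h].
  by exists (y, w).
by rewrite inE.
Qed.

Lemma E_sink s q y w : s < nS -> (q == 1) || (q == 2) ->
  ((q, y, w) \in E s) = (y == q) && (w == if q == 1 then 0%R else (-1)%R).
Proof.
move=> hs hq; rewrite E_low //; last by case/orP: hq => /eqP ->.
rewrite mem_cat.
have -> : (q, y, w) \in (if s == 0 then [seq (0, p.1, p.2) | p <- zip tracks init]
                          else [:: (0, 2, 0%R)]) = false.
  apply/negP; case: eqP => _; last by rewrite inE => /eqP [e _ _]; rewrite e in hq.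
  by case/mapP => p _ [e _ _]; rewrite e in hq.
by case/orP: hq => /eqP ->; rewrite !inE /= !xpair_eqE /= ?orbF.
Qed.

(** * Successors of the positions of the game *)

Definition suppO (f : Ffun) : Prop := forall q, f q <> Bot <-> trk q.

Lemma supp_cases f : supp_in_obs game f ->
  (exists q e, [/\ q < 3, e <> Bot & f = pt q e]) \/ suppO f.
Proof.
case=> o [ho h].
have hpt q : o = [:: q] -> f = pt q (f q) /\ f q <> Bot.
  move=> eo; split; last by apply/h; rewrite eo mem_head.
  apply: functional_extensionality => q'; rewrite /pt; case: eqP => [->//|hq].
  have : ~ (q' \in o) by rewrite eo inE => /eqP.
  by rewrite h; case: (f q') => // [|z] hh; case: hh.
move: ho; rewrite 4!inE => /or4P [] /eqP eo; last by right=> q; rewrite -h eo.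
- by left; have [e1 e2] := hpt _ eo; exists 0, (f 0).
- by left; have [e1 e2] := hpt _ eo; exists 1, (f 1).
- by left; have [e1 e2] := hpt _ eo; exists 2, (f 2).
Qed.

Lemma supp_pt q e : q < 3 -> e <> Bot -> supp_in_obs game (pt q e).
Proof.
move=> hq he; exists [:: q]; split; first by case: q hq => [|[|[|]]].
by move=> q'; rewrite inE /pt; case: eqP => // _; split.
Qed.

Lemma supp_ofv val : supp_in_obs game (ofv val).
Proof.
exists tracks; split=> // q; rewrite /ofv -[q \in tracks]/(trk q).
by case: (trk q).
Qed.

Lemma suppO_ofv val : suppO (ofv val).
Proof. by move=> q; rewrite /ofv; case: (trk q). Qed.

(** Away from the guards, the relevant edges into a state have a single source with a finite or
    forgotten value, so the minimum is over one term. *)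
Lemma min_val_unique f s y v x w : is_min_val game f s y v ->
  (forall q0 w', f q0 <> Bot -> s < nS -> (q0, y, w') \in E s -> q0 = x /\ w' = w) ->
  v = eadd (f x) w.
Proof.
move=> [[q0 [w' [hb [hd ->]]]] _] h.
by move: hd; rewrite mem_delta => /andP [hs /(h _ _ hb hs) [-> ->]].
Qed.

Lemma min_val_intro f s y x w : s < nS -> f x <> Bot -> (x, y, w) \in E s ->
  (forall q0 w', f q0 <> Bot -> (q0, y, w') \in E s -> q0 = x /\ w' = w) ->
  is_min_val game f s y (eadd (f x) w).
Proof.
move=> hs hb hd h; split.
  by exists x, w; rewrite mem_delta hs.
move=> q0 w' hb'; rewrite mem_delta => /andP [_ /(h _ _ hb') [-> ->]].
by case: (f x) hb => //= z _; apply: lexx.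
Qed.

Lemma succ_lt f s f' : succ game f s f' -> s < nS.
Proof.
case=> hs h _.
have [q hq] : exists q, f' q <> Bot.
  case/supp_cases: hs => [[q [e [_ he ->]]]|hO]; first by exists q; rewrite /pt eqxx.
  by exists 3; apply/hO.
by case: (h q hq) => q0 [_ /trans_mem []].
Qed.

Lemma succ_pt_intro f s q e x w : s < nS -> q < 3 -> f x <> Bot -> (x, q, w) \in E s ->
  e <> Bot -> (e = Inf \/ is_min_val game f s q e) -> succ game f s (pt q e).
Proof.
move=> hs hq hb hd he hm; split; first exact: supp_pt.
- move=> q'; rewrite /pt; case: eqP => // -> _; exists x; split=> //.
  by exists w; rewrite mem_delta hs.
- by move=> q'; rewrite /pt; case: eqP => // ->.
Qed.

Lemma succ_move val s mv gs : s < nS -> acts s = Move mv gs ->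
  succ game (ofv val) s (ofv (vnext mv val)).
Proof.
move=> hs es; split; first exact: supp_ofv.
  move=> q /suppO_ofv hq.
  have := acts_ok hs; rewrite es => /and5P [/eqP h1 /allP h2 _ _ _].
  have ht : trk (nth (0, 0%R) mv (q - 3)).1.
    by apply: h2; apply: mem_nth; rewrite h1; move: hq; rewrite trkE; lia.
  exists (nth (0, 0%R) mv (q - 3)).1; split; first exact/suppO_ofv.
  exists (nth (0, 0%R) mv (q - 3)).2.
  by rewrite mem_delta hs (E_move _ _ hs es) // hq -surjective_pairing eqxx.
move=> q /suppO_ofv hq; right.
have := acts_ok hs; rewrite es => /and5P [/eqP h1 /allP h2 _ _ _].
have ht : trk (nth (0, 0%R) mv (q - 3)).1.
  by apply: h2; apply: mem_nth; rewrite h1; move: hq; rewrite trkE; lia.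
have -> : ofv (vnext mv val) q
   = eadd (ofv val (nth (0, 0%R) mv (q - 3)).1) (nth (0, 0%R) mv (q - 3)).2.
  by rewrite /ofv hq ht.
apply: min_val_intro => //; first exact/suppO_ofv.
  by rewrite (E_move _ _ hs es) // hq -surjective_pairing eqxx.
move=> q0 w' /suppO_ofv h0; rewrite (E_move _ _ hs es) // hq /=.
case/orP => [/eqP -> //|/andP [/eqP e _]].
by rewrite e in hq.
Qed.

Definition guards (a : action int) : option (seq (nat * int)) :=
  match a with Move _ gs => Some gs | Accept gs => Some gs | Pun _ => None end.

Lemma E_guard s x w gs : s < nS -> guards (acts s) = Some gs -> trk x ->
  ((x, 0, w) \in E s) = ((x, w) \in gs).
Proof.
move=> hs hg hx; case ea : (acts s) hg => [mv gs'|gs'|t] //= [<-].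
- by rewrite (E_move _ _ hs ea) // !trkE.
- by rewrite (E_accept _ _ hs ea).
Qed.

Lemma guards_trk s gs g : s < nS -> guards (acts s) = Some gs -> g \in gs -> trk g.1.
Proof.
move=> hs; have := acts_ok hs; case: (acts s) => [mv gs'|gs'|t] //=.
- by case/and5P => _ _ /allP h _ _ [<-]; apply: h.
- by move/allP => h [<-]; apply: h.
Qed.

Lemma succ_guard val s gs : s < nS -> guards (acts s) = Some gs -> ~~ legal val gs ->
  succ game (ofv val) s (pt 0 (Fin (gmin val gs))).
Proof.
move=> hs hg hl.
have [|[x w] hgm em] := @gmin_mem val gs; first by case: (gs) hl.
have hx : trk x by apply: (guards_trk hs hg hgm).
have he : (x, 0, w) \in E s by rewrite (E_guard _ hs hg).
apply: (succ_pt_intro hs _ _ he) => //; first exact/suppO_ofv.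
right; split.
  exists x, w; split; first exact/suppO_ofv.
  by rewrite mem_delta hs; split=> //; rewrite /ofv hx em.
move=> q0 w0 /suppO_ofv h0; rewrite mem_delta => /andP [_].
rewrite (E_guard _ hs hg) // => hin; rewrite /ofv h0 /=.
exact: (gmin_le val hin).
Qed.

Lemma succ_pun val s t : s < nS -> acts s = Pun t -> trk t ->
  succ game (ofv val) s (pt 2 (Fin (val t))).
Proof.
move=> hs es ht.
have he : (t, 2, 0%R) \in E s by rewrite (E_pun _ _ hs es) // eqxx.
apply: (succ_pt_intro hs _ _ he) => //; first exact/suppO_ofv.
right; have -> : Fin (val t) = eadd (ofv val t) 0%R by rewrite /ofv ht /= addr0.
apply: min_val_intro => //; first exact/suppO_ofv.
move=> q0 w' /suppO_ofv h0; rewrite (E_pun _ _ hs es) //.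
by case: (q0 =P t) => [->|_] /andP [h /eqP ->].
Qed.

Lemma succ_init : succ game (fI game) 0 (ofv (fun t => nth 0%R init (t - 3))).
Proof.
have hs : 0 < nS by apply: leq_trans nS_pos.
split; first exact: supp_ofv.
  move=> q /suppO_ofv hq; exists 0; split=> //.
  by exists (nth 0%R init (q - 3)); rewrite mem_delta hs E_init //= hq eqxx.
move=> q /suppO_ofv hq; right.
have -> : ofv (fun t => nth 0%R init (t - 3)) q = eadd (fI game 0) (nth 0%R init (q - 3)).
  by rewrite /ofv hq /= add0r.
apply: min_val_intro => //; first by rewrite E_init //= hq eqxx.
move=> q0 w'; rewrite /fI; case: eqP => // -> _; rewrite E_init //= hq /=.
by move/eqP.
Qed.

Lemma succ_init_bad s : 0 < s < nS -> succ game (fI game) s (pt 2 (Fin 0)).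
Proof.
move=> /andP [h0 hs].
have he : (0, 2, 0%R) \in E s by rewrite E_init //; case: s h0 {hs}.
apply: (succ_pt_intro hs _ _ he) => //.
right; have -> : Fin 0 = eadd (fI game 0) 0%R by rewrite /= addr0.
apply: min_val_intro => //.
move=> q0 w'; rewrite /fI; case: eqP => // -> _; rewrite E_init //.
by case: s h0 {hs he} => // s _ /andP [_ /eqP].
Qed.

Lemma succ_bot m s : s < nS -> succ game (pt 2 (Fin m)) s (pt 2 (Fin (m - 1))).
Proof.
move=> hs.
have he : (2, 2, (-1)%R) \in E s by rewrite E_sink.
apply: (succ_pt_intro hs _ _ he) => //.
right; have -> : Fin (m - 1) = eadd (pt 2 (Fin m) 2) (-1)%R by [].
apply: min_val_intro => //.
move=> q0 w'; rewrite {1}/pt; case: eqP => // -> _; rewrite E_sink //.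
by case/andP => _ /eqP.
Qed.

Lemma succ_top_inf f s x w q : s < nS -> q < 3 -> f x <> Bot -> (x, q, w) \in E s ->
  succ game f s (pt q Inf).
Proof. by move=> hs hq hb he; apply: (succ_pt_intro hs hq hb he) => //; left. Qed.

Lemma succ_inv f s f' : succ game f s f' ->
  (exists q e, [/\ q < 3, e <> Bot & f' = pt q e] /\
     (exists x w, f x <> Bot /\ (x, q, w) \in E s) /\ (e = Inf \/ is_min_val game f s q e))
  \/ (suppO f' /\ (exists x w, f x <> Bot /\ (x, 3, w) \in E s) /\
      forall t, trk t -> f' t = Inf \/ is_min_val game f s t (f' t)).
Proof.
move=> hsucc; have hs := succ_lt hsucc; case: hsucc => /supp_cases hsup h1 h2.
case: hsup => [[q [e [hq he ef]]]|hO].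
  left; exists q, e; split=> //.
  have hb : f' q <> Bot by rewrite ef /pt eqxx.
  have [x [hx [w]]] := h1 q hb; rewrite mem_delta hs /= => hw.
  split; first by exists x, w.
  by have := h2 q hb; rewrite {1 2}ef /pt eqxx.
right; split=> //; split; last by move=> t /hO; apply: h2.
have [|x [hx [w]]] := h1 3; first exact/hO.
by rewrite mem_delta hs /= => hw; exists x, w.
Qed.

(** * Histories and wins that exclude the opponent's target *)

Notation last_f x := (fat game x (size x)).

Lemma fat_rcons x a i : i <= size x -> fat game (rcons x a) i = fat game x i.
Proof.
move=> hi; rewrite /fat /fseq map_rcons -rcons_cons nth_rcons /= size_map ltnS.
by rewrite hi.
Qed.

Lemma fat_rcons_last x s f : fat game (rcons x (s, f)) (size x).+1 = f.
Proof.
by rewrite /fat /fseq map_rcons -rcons_cons nth_rcons /= size_map ltnn eqxx.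
Qed.

Lemma last_rcons_f x s f : last_f (rcons x (s, f)) = f.
Proof. by rewrite size_rcons fat_rcons_last. Qed.

Definition noterm (x : hist) : Prop := forall i, i < size x ->
  ~ prec 0 (fat game x i) (last_f x) /\ ~ prec 1 (last_f x) (fat game x i).

(** [inPi] compares only positions before the last one, so a history in a target set belongs to
    [inPi] but has no extension in it; this is what [noterm] records. *)
Lemma inPi_rcons x s f :
  inPi game (rcons x (s, f)) <-> [/\ inPi game x, noterm x & succ game (last_f x) s f].
Proof.
have sat_l : sat (rcons x (s, f)) (size x) = s.
  by rewrite /sat map_rcons nth_rcons size_map ltnn eqxx.
have sat_i i : i < size x -> sat (rcons x (s, f)) i = sat x i.
  by move=> hi; rewrite /sat map_rcons nth_rcons size_map hi.
split=> [[h1 h2]|[[h1 h2] h3 h4]].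
  split.
  - split=> [i hi|i j hi hj].
      have := h1 i; rewrite size_rcons ltnS => /(_ (ltnW hi)).
      by rewrite !fat_rcons // ?sat_i // ltnW.
    have := h2 i j hi; rewrite size_rcons ltnS => /(_ (ltnW hj)).
    by rewrite !fat_rcons ?(ltnW hj) ?(ltnW (ltn_trans hi hj)).
  - move=> i hi; have := h2 i (size x) hi; rewrite size_rcons ltnS leqnn => /(_ isT).
    by rewrite !fat_rcons // ltnW.
  - by have := h1 (size x); rewrite size_rcons ltnS leqnn fat_rcons // fat_rcons_last sat_l; apply.
split=> [i|i j hi]; rewrite size_rcons ltnS leq_eqVlt => /orP [/eqP ej|hj].
- by rewrite ej fat_rcons // fat_rcons_last sat_l.
- by rewrite !fat_rcons ?sat_i ?(ltnW hj) //; apply: h1.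
- by rewrite ej in hi *; rewrite !fat_rcons ?(ltnW hi) //; apply: h3.
- by rewrite !fat_rcons ?(ltnW hj) ?(ltnW (ltn_trans hi hj)) //; apply: h2.
Qed.

Lemma inTE_term x : inTE game x -> ~ noterm x.
Proof. by case=> _ [i [hi hp]] /(_ i hi) []. Qed.

Lemma inTA_term x : inTA game x -> ~ noterm x.
Proof. by case=> _ [i [hi [hp _]]] /(_ i hi) []. Qed.

(* A history may lie in both target sets; excluding [inTA] makes a win of Eve in this sense refute
   any win of Adam, and dually for [adamwin]. *)
Inductive evewin (sE : hist -> nat) : hist -> Prop :=
| evewin_now x : inTE game x -> ~ inTA game x -> evewin sE x
| evewin_step x : ~ inTA game x -> (exists f, inPi game (rcons x (sE x, f))) ->
    (forall f, inPi game (rcons x (sE x, f)) -> evewin sE (rcons x (sE x, f))) -> evewin sE x.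

Inductive adamwin (sA : hist -> nat -> Ffun) : hist -> Prop :=
| adamwin_now x : inTA game x -> ~ inTE game x -> adamwin sA x
| adamwin_step x : ~ inTE game x -> (forall s, s < nS -> inPi game (rcons x (s, sA x s))) ->
    (forall s, s < nS -> adamwin sA (rcons x (s, sA x s))) -> adamwin sA x.

Lemma evewin_eve sE x : evewin sE x -> eve_wf game sE x.
Proof.
by elim=> {}x; [move=> h _; apply: EW_target | move=> _ h _ IH; apply: EW_step].
Qed.

Lemma adamwin_adam sA x : adamwin sA x -> adam_wf game sA x.
Proof.
elim=> {}x => [h _|_ h _ IH]; first exact: AW_target.
by apply: AW_step => s hs; split; [apply: h | apply: IH].
Qed.

(** At a target of Eve no extension exists, so Adam cannot have a step left; elsewhere the two
    strategies are played against each other. *)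
Lemma evewin_not_adam sE x : evewin sE x -> forall sA, ~ adam_wf game sA x.
Proof.
elim=> {}x => [hE hA|hA [f hf] _ IH] sA h.
  case: h hE hA => {}x // h hE _.
  have [|/inPi_rcons [_ hn _] _] := h 0; first exact: leq_trans nS_pos.
  exact: inTE_term hE hn.
have hs : sE x < nS by case/inPi_rcons: hf => _ _ /succ_lt.
case: h hA hs {f hf} IH => {}x // h _ hs IH.
by have [h1 h2] := h _ hs; apply: (IH _ h1 sA).
Qed.

Lemma adamwin_not_eve sA x : adamwin sA x -> forall sE, ~ eve_wf game sE x.
Proof.
elim=> {}x => [hA hE|hE h _ IH] sE he.
  case: he hA hE => {}x // [f /inPi_rcons [_ hn _]] _ hA _.
  exact: inTA_term hA hn.
case: he hE h IH => {}x // [f hf] hnext _ h IH.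
have hs : sE x < nS by case/inPi_rcons: hf => _ _ /succ_lt.
exact: IH _ hs sE (hnext _ (h _ hs)).
Qed.

(** * Leaving the tracks and forgetting a track *)

Definition chron (x : hist) : Prop := forall i, 0 < i <= size x -> suppO (fat game x i).

Lemma chron_bot x i q : chron x -> i <= size x -> 0 < q < 3 -> fat game x i q = Bot.
Proof.
move=> hc hi hq; case: i hi => [|i] hi; first by rewrite /fat /= /fI; case: q hq.
have := hc i.+1 hi q; rewrite trkE (_ : 2 < q < 17 = false); last by lia.
by case: (fat _ _ _ _) => // [|z] [h _]; have: false by apply: h.
Qed.

Lemma chron_bot0 x i : chron x -> 0 < i <= size x -> fat game x i 0 = Bot.
Proof.
move=> hc hi; have := hc i hi 0.
by case: (fat _ _ _ _) => // [|z] [h _]; have: false by apply: h.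
Qed.

Lemma prec_supp k f f' q : prec k f f' -> f q = Bot <-> f' q = Bot.
Proof. by case=> h _; apply: h. Qed.

Definition nonneg (e : ext) : Prop := e = Inf \/ exists2 m, (0 <= m)%R & e = Fin m.

(** Among the earlier positions only [fI] has support [{0}], so the comparison with its value 0
    decides the play. *)
Lemma return_eve sE x s e : chron x -> inPi game (rcons x (s, pt 0 e)) -> nonneg e ->
  evewin sE (rcons x (s, pt 0 e)).
Proof.
move=> hc hp he; set y := rcons x _.
have he' : e <> Bot by case: he => [->|[m _ ->]].
have hl : last_f y = pt 0 e by rewrite /y last_rcons_f.
have hsz : size y = (size x).+1 by rewrite /y size_rcons.
apply: evewin_now.
  split=> //; exists 0; rewrite hsz; split=> //; rewrite -hsz hl /y fat_rcons // /fat /=; split=> q.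
    by rewrite /fI /pt /=; case: eqP.
  rewrite /fI /pt /=; case: eqP => // _ _.
  by case: he => [->|[m hm ->]] //=; rewrite addr0.
move=> [_ [i []]]; rewrite hsz ltnS => hi [hpr _].
move: hpr; rewrite -hsz hl /y fat_rcons //; case: i hi => [|i] hi hpr.
  case: hpr => _ /(_ 0); rewrite /pt /= => /(_ he').
  by case: he => [->|[m hm ->]] //=; rewrite /fat /= /fI /=; lia.
have := prec_supp 0 hpr; rewrite (chron_bot0 hc) //= /pt /= => h.
by case: he'; apply/h.
Qed.

Lemma return_adam sA x s m : chron x -> inPi game (rcons x (s, pt 0 (Fin m))) -> (m < 0)%R ->
  adamwin sA (rcons x (s, pt 0 (Fin m))).
Proof.
move=> hc hp hm; set y := rcons x _.
have hl : last_f y = pt 0 (Fin m) by rewrite /y last_rcons_f.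
have hsz : size y = (size x).+1 by rewrite /y size_rcons.
apply: adamwin_now.
  split=> //; exists 0; rewrite hsz; split=> //; rewrite -hsz hl /y fat_rcons // /fat /=; split.
    split=> q; rewrite /fI /pt /=; first by case: eqP.
    by case: eqP => //= _ _; lia.
  by exists 0, 0%R.
move=> [_ [i []]]; rewrite hsz ltnS => hi.
rewrite -hsz hl /y fat_rcons //; case: i hi => [|i] hi hpr.
  by case: hpr => _ /(_ 0); rewrite /fat /= /fI /pt /= => /(_ ltac:(by [])); lia.
by have := prec_supp 0 hpr; rewrite (chron_bot0 hc) //= /pt /= => -[/(_ erefl)].
Qed.

Lemma sink_succ q e s f : (q == 1) || ((q == 2)) -> e <> Bot -> succ game (pt q e) s f ->
  exists e', [/\ e' <> Bot, f = pt q e' & e' = Inf \/ e' = eadd e (if q == 1 then 0%R else (-1)%R)].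
Proof.
move=> hq he hsucc; have hs := succ_lt hsucc.
have sup x : pt q e x <> Bot -> x = q by rewrite /pt; case: eqP.
case/succ_inv: hsucc => [[y [e' [[hy he' ->] [[x [w [/sup -> ]]]]]]]|].
  rewrite E_sink // => /andP [/eqP -> _] hm.
  exists e'; split=> //; case: hm => [|hm]; first by left.
  right; rewrite (min_val_unique (x := q) (w := if q == 1 then 0%R else (-1)%R) hm).
    by rewrite /pt eqxx.
  by move=> q0 w' /sup -> _; rewrite E_sink // => /andP [_ /eqP ->].
case=> _ [[x [w [/sup ->]]]].
by rewrite E_sink // => /andP [/eqP e3 _]; rewrite -e3 in hq.
Qed.

(** One round later the weight is the same or [Inf], which is Eve's target. If it was [Inf] before,
    [prec 1] holds between the two positions as well, and it is the finiteness clause of [inTA] that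
    denies Adam the win. *)
Lemma sink_eve sE x s q e : chron x -> inPi game (rcons x (s, pt q e)) -> e <> Bot ->
  q = 1 \/ (q = 2 /\ e = Inf) -> sE (rcons x (s, pt q e)) < nS ->
  evewin sE (rcons x (s, pt q e)).
Proof.
move=> hc hp he hq hsE; set y := rcons x _ in hsE *.
have hq12 : (q == 1) || (q == 2) by case: hq => [->|[-> _]].
have hl : last_f y = pt q e by rewrite /y last_rcons_f.
have hsz : size y = (size x).+1 by rewrite /y size_rcons.
have hbot i : i <= size x -> fat game y i q = Bot.
  move=> hi; rewrite /y fat_rcons //; apply: chron_bot => //.
  by case/orP: hq12 => /eqP ->.
have hlq : last_f y q <> Bot by rewrite hl /pt eqxx.
have hnt k i f : i <= size x -> f q <> Bot -> ~ prec k f (fat game y i) /\ ~ prec k (fat game y i) f.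
  by move=> hi hf; split=> /(prec_supp q) h; apply: hf; apply/h; apply: hbot.
have hno : noterm y.
  move=> i hi; rewrite hsz ltnS in hi.
  by split; [apply: (hnt 0%R i _ hi hlq).2 | apply: (hnt 1%R i _ hi hlq).1].
apply: evewin_step.
- by move=> hA; exact: inTA_term hA hno.
- exists (pt q Inf); apply/inPi_rcons; split=> //; rewrite hl.
  apply: (@succ_top_inf _ _ q (if q == 1 then 0%R else (-1)%R)) => //.
  + by case/orP: hq12 => /eqP ->.
  + by rewrite /pt eqxx.
  + by rewrite E_sink // !eqxx.
move=> f hf; have [_ _] := iffLR (inPi_rcons _ _ _) hf; rewrite hl.
case/(sink_succ hq12 he) => e' [he' ef hee].
set z := rcons y _ in hf *.
have hlz : last_f z = pt q e' by rewrite /z last_rcons_f.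
have hszz : size z = (size y).+1 by rewrite /z size_rcons.
have fz i : i <= size y -> fat game z i = fat game y i by move=> hi; rewrite /z fat_rcons.
have heq : e' = Inf \/ e' = e.
  case: hee => [->|->]; first by left.
  by case: hq => [->|[-> ->]]; [right; case: (e) => //= z0; rewrite addr0 | left].
apply: evewin_now.
  split=> //; exists (size y); rewrite hszz ltnSn; split=> //.
  rewrite -hszz hlz fz // hl; split=> q'; rewrite /pt; case: eqP => //= _ _.
  by case: heq => ->; case: (e) he => //= z0; rewrite addr0.
move=> [_ [i [hi [hpr [q0 [z0 hfin]]]]]].
move: hi; rewrite hszz ltnS hsz leq_eqVlt => /orP [/eqP ei|hi]; last first.
  move: hpr; rewrite hlz fz; last by lia.
  by apply: (hnt 1%R i _ hi _).1; rewrite /pt eqxx.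
move: hpr hfin; rewrite ei -hsz hlz fz // hl => hpr hfin.
have eq0 : q0 = q by move: hfin; rewrite /pt; case: eqP.
move: hfin; rewrite eq0 /pt eqxx => ee.
case: hpr => _ /(_ q); rewrite /pt eqxx => /(_ he').
by rewrite ee in heq *; case: heq => -> //=; lia.
Qed.

Definition bot_ok (sA : hist -> nat -> Ffun) : Prop := forall x s m,
  last_f x = pt 2 (Fin m) -> sA x s = pt 2 (Fin (m - 1)).

Lemma bot_adam sA x s m : bot_ok sA -> chron x -> inPi game (rcons x (s, pt 2 (Fin m))) ->
  adamwin sA (rcons x (s, pt 2 (Fin m))).
Proof.
move=> hsA hc hp; set y := rcons x _.
have hl : last_f y = pt 2 (Fin m) by rewrite /y last_rcons_f.
have hsz : size y = (size x).+1 by rewrite /y size_rcons.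
have hlq : last_f y 2 <> Bot by rewrite hl.
have hbot i : i <= size x -> fat game y i 2 = Bot.
  by move=> hi; rewrite /y fat_rcons //; apply: chron_bot.
have hnt k i f : i <= size x -> f 2 <> Bot -> ~ prec k f (fat game y i) /\ ~ prec k (fat game y i) f.
  by move=> hi hf; split=> /(prec_supp 2) h; apply: hf; apply/h; apply: hbot.
have hno : noterm y.
  move=> i hi; rewrite hsz ltnS in hi.
  by split; [apply: (hnt 0%R i _ hi hlq).2 | apply: (hnt 1%R i _ hi hlq).1].
apply: adamwin_step; first by move=> hE; exact: inTE_term hE hno.
all: move=> s' hs'; rewrite (hsA _ _ _ hl);
  have hp' : inPi game (rcons y (s', pt 2 (Fin (m - 1))))
    by apply/inPi_rcons; split=> //; rewrite hl; apply: succ_bot.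
  by [].
set z := rcons y _ in hp' *.
have hlz : last_f z = pt 2 (Fin (m - 1)) by rewrite /z last_rcons_f.
have hszz : size z = (size y).+1 by rewrite /z size_rcons.
have fz i : i <= size y -> fat game z i = fat game y i by move=> hi; rewrite /z fat_rcons.
apply: adamwin_now.
  split=> //; exists (size y); rewrite hszz ltnSn -hszz hlz fz // hl; split=> //; split.
    split=> q; rewrite /pt; case: eqP => //= _ _; lia.
  by exists 2, m.
move=> [_ [i [hi hpr]]].
move: hi; rewrite hszz ltnS hsz leq_eqVlt => /orP [/eqP ei|hi]; last first.
  move: hpr; rewrite hlz fz; last by lia.
  by apply: (hnt 0%R i _ hi _).2.
move: hpr; rewrite ei -hsz hlz fz // hl => -[_ /(_ 2)].
by rewrite /pt /= => /(_ ltac:(by [])); lia.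
Qed.

(* A history along which Adam always stayed on the tracks and never forgot one. *)
Definition hon (x : hist) (val : nat -> int) : Prop :=
  [/\ 0 < size x, inPi game x, last_f x = ofv val &
      forall i, 0 < i <= size x -> exists v,
        [/\ fat game x i = ofv v, v 4 = 0%R & v 3 = (- i%:Z)%R]].

Lemma hon_chron x val : hon x val -> chron x.
Proof. by case=> _ _ _ h i /h [v [-> _ _]]; apply: suppO_ofv. Qed.

(** The falling track 3 refutes [prec 0] from an earlier position to the last, the constant track 4
    refutes [prec 1] in the other direction, and position 0 has a different support. *)
Lemma hon_noterm x val : hon x val -> noterm x.
Proof.
case=> h0 hp hl h i hi.
have [|v [ev v4 v3]] := h (size x); first by lia.
case: i hi => [|i] hi.
  have e1 : fat game x 0 0 = Fin 0%R by [].
  have e2 : last_f x 0 = Bot by rewrite ev.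
  by split=> /(prec_supp 0); rewrite e1 e2 => -[h1 h2]; [have := h2 erefl | have := h1 erefl].
have [|u [eu u4 u3]] := h i.+1; first by lia.
rewrite ev eu; split=> -[_].
  by move/(_ 3); rewrite /ofv /= u3 v3 => /(_ ltac:(by [])); lia.
by move/(_ 4); rewrite /ofv /= u4 v4 => /(_ ltac:(by [])); lia.
Qed.

Lemma hon_extend x val s f : hon x val -> succ game (ofv val) s f ->
  inPi game (rcons x (s, f)).
Proof.
move=> hx hsucc; have hn := hon_noterm hx; case: hx => _ hp hl _.
by apply/inPi_rcons; rewrite hl.
Qed.

Lemma ofv_inj v v' t : ofv v = ofv v' -> trk t -> v t = v' t.
Proof. by move=> h ht; have := congr1 (fun f => f t) h; rewrite /ofv ht => -[]. Qed.

Lemma hon_step x val s mv gs : hon x val -> s < nS -> acts s = Move mv gs ->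
  hon (rcons x (s, ofv (vnext mv val))) (vnext mv val).
Proof.
move=> hx hs es; have hp := hon_extend hx (succ_move val hs es).
case: (hx) => h0 _ hl h; split=> //; first by rewrite size_rcons.
  by rewrite last_rcons_f.
move=> i; rewrite size_rcons => /andP [hi]; rewrite leq_eqVlt => /orP [/eqP ->|hi'].
  rewrite fat_rcons_last; exists (vnext mv val).
  have [|v [ev v4 v3]] := h (size x); first by lia.
  have hv t : trk t -> val t = v t by apply: ofv_inj; rewrite -hl.
  have := acts_ok hs; rewrite es => /and5P [_ _ _ /eqP e3 /eqP e4].
  split=> //; rewrite /vnext /=.
    by rewrite e4 /= hv // v4.
  by rewrite e3 /= hv // v3; lia.
by rewrite fat_rcons //; apply: h; rewrite hi.
Qed.

Definition vinit : nat -> int := fun t => nth 0%R init (t - 3).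

Lemma hon_init : hon [:: (0, ofv vinit)] vinit.
Proof.
split=> //.
  by apply/(inPi_rcons [::]); split=> //; exact: succ_init.
by case=> [|[|i]] // _; exists vinit; split.
Qed.

Definition full (x : hist) : Prop :=
  forall i, 0 < i <= size x -> exists v, fat game x i = ofv v.

Lemma hon_full x val : hon x val -> full x.
Proof. by case=> _ _ _ h i /h [v [-> _ _]]; exists v. Qed.

Definition punishes (sE : hist -> nat) : Prop :=
  (forall y, sE y < nS) /\
  forall y t, trk t -> last_f y t = Inf ->
    exists t', [/\ trk t', last_f y t' = Inf & acts (sE y) = Pun t'].

(** Eve names a forgotten track [t]. The other tracks lead to sink 1, and sink 2 is entered from [t]
    alone, hence with weight [Inf]: both cases are covered by [sink_eve]. *)
Lemma forget_eve x s f t0 sE : full x -> inPi game (rcons x (s, f)) -> suppO f ->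
  trk t0 -> f t0 = Inf -> punishes sE -> evewin sE (rcons x (s, f)).
Proof.
move=> hx hp hO ht0 hf0 [hsE hpun].
have [|t [ht + es]] := hpun (rcons x (s, f)) t0 ht0; first by rewrite last_rcons_f.
rewrite last_rcons_f => hf; set y := rcons x _ in hp es *.
have hl : last_f y = f by rewrite /y last_rcons_f.
have hsz : size y = (size x).+1 by rewrite /y size_rcons.
have hc : chron y.
  move=> i; rewrite hsz => /andP [h1]; rewrite leq_eqVlt => /orP [/eqP ->|h2].
    by rewrite -hsz hl.
  rewrite /y fat_rcons //; have [|v ->] := hx i; first by rewrite h1.
  exact: suppO_ofv.
have hfin i : i <= size x -> ~ prec 1 f (fat game y i).
  move=> hi; rewrite /y fat_rcons //; case: i hi => [|i] hi hpr.
    have := prec_supp 0 hpr; rewrite /fat /= /fI /= => -[h _].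
    have /h // : f 0 = Bot.
    by have [h1 h2] := hO 0; case: (f 0) h1 => // [|z] h1; have: false by apply: h1.
  have [v ev] := hx i.+1 hi.
  by case: hpr => _ /(_ t); rewrite hf ev /ofv ht /= => /(_ ltac:(by [])).
have hA : ~ inTA game y.
  move=> [_ [i [hi [hpr _]]]]; move: hpr; rewrite hl; apply: hfin.
  by rewrite hsz ltnS in hi.
(* The position with a forgotten track may already dominate an earlier one; then the play is over
   and Eve has won before punishing. *)
have [hE|hE] := Classical_Prop.classic (inTE game y); first exact: evewin_now.
have hno : noterm y.
  move=> i hi; split=> hpr; first by apply: hE; split=> //; exists i.
  by move: hpr; rewrite hl; apply: hfin; rewrite hsz ltnS in hi.
have hs := hsE y.
have [t' [ht' tt']] : exists t', trk t' /\ t' != t.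
  by case: (t =P 3) => [->|h]; [exists 4 | exists 3; split=> //; apply/eqP => e; apply: h].
apply: evewin_step => //.
  exists (pt 1 Inf); apply/inPi_rcons; split=> //; rewrite hl.
  apply: (@succ_top_inf _ _ t' 0%R) => //; first exact/hO.
  by rewrite (E_pun _ _ hs es) // (negbTE tt').
move=> g hg; have [_ _] := iffLR (inPi_rcons _ _ _) hg; rewrite hl => hsucc.
case: (succ_inv hsucc) => [[q [e [[hq he eg] [[x0 [w [hx0 hE0]]] hm]]]]|[_ [[x0 [w [hx0]]]]]]; last first.
  rewrite (E_pun _ _ hs es); last exact/hO.
  by case: (x0 == t).
move: hE0; rewrite (E_pun _ _ hs es); last exact/hO.
move=> /andP [/eqP eq _].
rewrite eg; apply: sink_eve => //; first by rewrite -eg.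
case: (x0 =P t) eq => _ eq; [right; split=> // | by left].
case: hm => // hm; rewrite (@min_val_unique _ _ _ _ t 0%R hm) ?hf //.
move=> q0 w' /hO h0 _; rewrite (E_pun _ _ hs es) // eq.
by case: (q0 =P t) => [->|_] /andP [h /eqP ->].
Qed.

Definition is_inf (e : ext) : bool := if e is Inf then true else false.

Lemma full_or_forget (f : Ffun) v : suppO f ->
  (forall t, trk t -> f t = Inf \/ f t = Fin (v t)) ->
  f = ofv v \/ exists t, trk t /\ f t = Inf.
Proof.
move=> hO h.
case: (boolP (has (fun t => is_inf (f t)) tracks)).
  by case/hasP => t ht; case E0 : (f t) => // _; right; exists t.
move/hasPn => hn; left; apply: functional_extensionality => q; rewrite /ofv.
case: (boolP (trk q)) => hq.
  by case: (h q hq) => // e; have := hn q hq; rewrite e.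
have [h1 _] := hO q; case: (f q) h1 => // [|z] h1; by rewrite h1 in hq.
Qed.

Lemma guard_nonneg val s gs e : s < nS -> guards (acts s) = Some gs -> legal val gs ->
  e = Inf \/ is_min_val game (ofv val) s 0 e -> nonneg e.
Proof.
move=> hs hg /allP hl [->|[[q0 [w [h0 [hd ->]]]] _]]; first by left.
move/suppO_ofv in h0; move: hd; rewrite mem_delta hs /= (E_guard _ hs hg) // => hin.
by right; exists (val q0 + w)%R; [apply: (hl _ hin) | rewrite /ofv h0].
Qed.

(** Besides the honest answer Adam can return, which loses since all guards are nonnegative, or
    forget a track, which is punished. *)
Lemma move_eve sE x val s mv gs f : punishes sE -> hon x val -> s < nS ->
  acts s = Move mv gs -> legal val gs -> inPi game (rcons x (s, f)) ->
  f = ofv (vnext mv val) \/ evewin sE (rcons x (s, f)).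
Proof.
move=> hsE hx hs es hl hp; have [_ _] := iffLR (inPi_rcons _ _ _) hp.
have -> : last_f x = ofv val by case: hx.
case/succ_inv => [[q [e [[hq he eg] [[x0 [w [hx0 hE0]]] hm]]]]|[hO [_ hm]]].
  move/suppO_ofv in hx0; move: hE0; rewrite (E_move _ _ hs es) // trkE.
  rewrite (_ : 2 < q < 17 = false) /=; last by lia.
  case/andP => /eqP e0 _; right; rewrite eg e0 in hp hm *.
  apply: return_eve => //; first exact: hon_chron hx.
  by apply: (guard_nonneg hs _ hl hm); rewrite es.
have [//|//|->|[t [ht hft]]] := @full_or_forget f (vnext mv val); last first.
- by right; apply: (forget_eve (hon_full hx) hp hO ht hft hsE).
- by left.
move=> t ht; case: (hm t ht) => [|hmin]; first by left.
right; rewrite (@min_val_unique _ _ _ _ (nth (0, 0%R) mv (t - 3)).1 (nth (0, 0%R) mv (t - 3)).2 hmin).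
  have := acts_ok hs; rewrite es => /and5P [/eqP h1 /allP h2 _ _ _].
  have ht' : trk (nth (0, 0%R) mv (t - 3)).1.
    by apply: h2; apply: mem_nth; rewrite h1; move: ht; rewrite trkE; lia.
  by rewrite /ofv ht'.
move=> q0 w' /suppO_ofv h0 _; rewrite (E_move _ _ hs es) // ht /=.
case/orP => [/eqP -> //|/andP [/eqP e0 _]].
by rewrite e0 in ht.
Qed.

Lemma accept_eve sE x val s gs f : punishes sE -> hon x val -> s < nS ->
  acts s = Accept gs -> legal val gs -> inPi game (rcons x (s, f)) ->
  evewin sE (rcons x (s, f)).
Proof.
move=> hsE hx hs es hl hp; have [_ _] := iffLR (inPi_rcons _ _ _) hp.
have -> : last_f x = ofv val by case: hx.
case/succ_inv => [[q [e [[hq he eg] [[x0 [w [hx0 hE0]]] hm]]]]|[hO [[x0 [w [hx0 hE0]]] hm]]].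
  move/suppO_ofv in hx0; move: hE0; rewrite (E_accept _ _ hs es) //.
  case/orP => /andP [/eqP e0 _]; rewrite eg e0 in hp hm *.
    by apply: sink_eve => //; [exact: hon_chron hx | left | case: hsE].
  apply: return_eve => //; first exact: hon_chron hx.
  by apply: (guard_nonneg hs _ hl hm); rewrite es.
by move/suppO_ofv in hx0; move: hE0; rewrite (E_accept _ _ hs es).
Qed.

Lemma init_eve sE f : punishes sE -> inPi game [:: (0, f)] ->
  f = ofv vinit \/ evewin sE [:: (0, f)].
Proof.
move=> hsE hp; have hs : 0 < nS by apply: leq_trans nS_pos.
have [_ _] := iffLR (inPi_rcons [::] _ _) hp.
rewrite [last_f _]/(fI game).
have sup x : fI game x <> Bot -> x = 0 by rewrite /fI; case: eqP.
case/succ_inv => [[q [e [[hq he eg] [[x0 [w [/sup ->]]]]]]]|[hO [_ hm]]].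
  by rewrite E_init //= trkE => /andP [h _]; lia.
have [//|//|->|[t [ht hft]]] := @full_or_forget f vinit; last first.
- by right; apply: (@forget_eve [::] 0 f t sE) => // i; case: i.
- by left.
move=> t ht; case: (hm t ht) => [|hmin]; first by left.
right; rewrite (@min_val_unique _ _ _ _ 0 (vinit t) hmin); first by rewrite /= add0r.
by move=> q0 w' /sup -> _; rewrite E_init //= ht => /eqP.
Qed.

(** Honest answers are determined by the actions, so a sequence of actions indexed by the round
    suffices. The index [k] of the first forgotten track is itself the number of the action that
    punishes it, by [acts_pun]. *)
Definition patrol (pth : nat -> nat) (x : hist) : nat :=
  let k := find (fun t => is_inf (last_f x t)) tracks in
  if k < 14 then k else if pth (size x) < nS then pth (size x) else 0.

Lemma patrol_punishes pth : punishes (patrol pth).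
Proof.
split=> [y|y t ht hf]; rewrite /patrol.
  case: ifP => h; first exact: leq_trans h nS_pos.
  by case: ifP => // _; apply: leq_trans nS_pos.
set p : pred nat := fun t => is_inf _; have hh : has p tracks by apply/hasP; exists t; rewrite // /p hf.
have hlt : find p tracks < 14 by have := hh; rewrite has_find size_iota.
rewrite hlt; have := nth_find 0 hh; move: hlt; set k := find p tracks => hlt.
rewrite nth_iota // => hp.
have hk : trk (3 + k) by rewrite trkE; lia.
exists (3 + k); split=> //; first by move: hp; rewrite /p; case: (last_f y _).
by rewrite -[in LHS](addKn 3 k) acts_pun.
Qed.

Lemma patrol_hon pth x : (forall t, trk t -> last_f x t <> Inf) -> pth (size x) < nS ->
  patrol pth x = pth (size x).
Proof.
move=> hx hs; rewrite /patrol hs.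
set p : pred nat := fun t => is_inf _; have hh : ~~ has p tracks.
  by apply/hasPn => t /hx; rewrite /p; case: (last_f x t).
by move: (hh); rewrite has_find -leqNgt ltnNge => ->.
Qed.

(** * From the game to reachability in the counter system *)

Inductive canacc : (nat -> int) -> Prop :=
| canacc_now val s gs : s < nS -> acts s = Accept gs -> legal val gs -> canacc val
| canacc_step val s mv gs : s < nS -> acts s = Move mv gs -> legal val gs ->
    canacc (vnext mv val) -> canacc val.

(** Stated for every [pth] that agrees with [p] from the current round on, so that the induction can
    prefix an action. *)
Lemma canacc_path val : canacc val -> exists p : seq nat, forall x pth,
  hon x val -> (forall k, k < size p -> pth (size x + k) = nth 0 p k) ->
  evewin (patrol pth) x.
Proof.
elim=> {}val s => [gs hs es hl|mv gs hs es hl _ [p IH]].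
  exists [:: s] => x pth hx hpth.
  have e : patrol pth x = s.
    have e0 : pth (size x) = s by have := hpth 0 isT; rewrite addn0.
    rewrite patrol_hon ?e0 // => t ht.
    by have -> : last_f x = ofv val by [case: hx]; rewrite /ofv ht.
  apply: evewin_step; rewrite ?e.
  - by move=> hA; apply: inTA_term hA (hon_noterm hx).
  - exists (pt 1 Inf); apply: (hon_extend hx).
    by apply: (@succ_top_inf _ _ 3 0%R) => //; rewrite (E_accept _ _ hs es).
  - by move=> f; apply: (accept_eve (patrol_punishes pth) hx hs es hl).
exists (s :: p) => x pth hx hpth.
have e : patrol pth x = s.
  have e0 : pth (size x) = s by have := hpth 0 isT; rewrite addn0.
  rewrite patrol_hon ?e0 // => t ht.
  by have -> : last_f x = ofv val by [case: hx]; rewrite /ofv ht.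
apply: evewin_step; rewrite ?e.
- by move=> hA; apply: inTA_term hA (hon_noterm hx).
- exists (ofv (vnext mv val)); apply: (hon_extend hx); exact: succ_move es.
move=> f hf; case: (move_eve (patrol_punishes pth) hx hs es hl hf) => // ->.
apply: IH; first exact: hon_step es.
by move=> k hk; rewrite size_rcons addSnnS hpth.
Qed.

Lemma canacc_eve_wins : canacc vinit -> eve_wins game.
Proof.
(* The leading 0 is the forced opening; the word [p] starts in round 1. *)
case/canacc_path => p hp; pose pth := nth 0 (0 :: p).
exists (patrol pth); apply: evewin_eve.
have hs : 0 < nS by apply: leq_trans nS_pos.
have e : patrol pth [::] = 0.
  by rewrite patrol_hon // => t; rewrite /fat /= /fI; case: eqP.
apply: evewin_step; rewrite ?e.
- by case=> _ [i []].
- by exists (ofv vinit); have [] := hon_init.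
move=> f hf; case: (init_eve (patrol_punishes pth) hf) => // ->.
by apply: hp; first exact: hon_init.
Qed.

(** An induction principle with a hypothesis for the recursive occurrence under the conjunction in
    [AW_step]. *)
Lemma adam_wf_rect (sA : hist -> nat -> Ffun) (P : hist -> Prop) :
  (forall x, inTA game x -> P x) ->
  (forall x, (forall s, s < nS -> inPi game (rcons x (s, sA x s)) /\
     adam_wf game sA (rcons x (s, sA x s)) /\ P (rcons x (s, sA x s))) -> P x) ->
  forall x, adam_wf game sA x -> P x.
Proof.
move=> h1 h2; fix IH 2 => x [y|y h]; first exact: h1.
apply: h2 => s hs; case: (h s hs) => ha hb.
exact: (conj ha (conj hb (IH _ hb))).
Qed.

(** Eve need not win here: a winning strategy of Adam is well-founded, so it would have to stop the
    honest play that she can always continue, or that ends with her accepting. *)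
Lemma invariant_not_adam (P : (nat -> int) -> Prop) :
  (forall val, P val -> (exists s gs, [/\ s < nS, acts s = Accept gs & legal val gs]) \/
     exists s mv gs, [/\ s < nS, acts s = Move mv gs, legal val gs & P (vnext mv val)]) ->
  P vinit -> ~ adam_wins game.
Proof.
move=> hP hinit [sA hA].
have hpun := patrol_punishes (fun=> 0).
have main x : adam_wf game sA x -> forall val, hon x val -> P val -> False.
  move: x; apply: (@adam_wf_rect sA (fun x => forall val, hon x val -> P val -> False)) => x.
    by move=> hx val hon_x _; exact: inTA_term hx (hon_noterm hon_x).
  move=> h val hon_x /hP hp.
  case: hp => [[s [gs [hs es hl]]]|[s [mv [gs [hs es hl hn]]]]].
    have [h1 [h2 _]] := h s hs.
    exact: evewin_not_adam (accept_eve hpun hon_x hs es hl h1) _ h2.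
  have [h1 [h2 IH]] := h s hs.
  case: (move_eve hpun hon_x hs es hl h1) => [ef|hw].
    by rewrite ef in IH; apply: (IH _ _ hn); apply: hon_step es.
  exact: evewin_not_adam hw _ h2.
have inv x : adam_wf game sA x -> inTA game x \/ forall s, s < nS ->
    inPi game (rcons x (s, sA x s)) /\ adam_wf game sA (rcons x (s, sA x s)).
  by case=> {}x h; [left | right].
case: (inv _ hA) => [[_ [i []]] //|h].
have [|h1 h2] := h 0; first exact: leq_trans nS_pos.
case: (init_eve hpun h1) => [ef|hw].
  by rewrite ef in h2; apply: (main _ h2 vinit) => //; exact: hon_init.
exact: evewin_not_adam hw _ h2.
Qed.

(** Well-foundedness matters: Adam must reach his target, so endless honest play is excluded and not
    only acceptance. *)
Inductive losing : (nat -> int) -> Prop :=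
| losing_intro val :
    (forall s gs, s < nS -> acts s = Accept gs -> ~~ legal val gs) ->
    (forall s mv gs, s < nS -> acts s = Move mv gs -> legal val gs -> losing (vnext mv val)) ->
    losing val.

Lemma legal_ext val val' s gs : (forall t, trk t -> val' t = val t) -> s < nS ->
  guards (acts s) = Some gs -> legal val' gs = legal val gs.
Proof.
move=> h hs hg; apply: eq_in_all => g /(guards_trk hs hg) ht; by rewrite h.
Qed.

Lemma ofv_vnext_ext val val' s mv gs : (forall t, trk t -> val' t = val t) -> s < nS ->
  acts s = Move mv gs -> ofv (vnext mv val') = ofv (vnext mv val).
Proof.
move=> h hs es; apply: functional_extensionality => t; rewrite /ofv.
case: (boolP (trk t)) => // ht; rewrite /vnext h //.
have := acts_ok hs; rewrite es => /and5P [/eqP h3 /allP h2 _ _ _].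
by apply: h2; apply: mem_nth; rewrite h3; move: ht; rewrite trkE; lia.
Qed.

Definition fin_part (e : ext) : int := if e is Fin z then z else 0%R.

(** The counter values are read off the current position and are arbitrary outside the tracks,
    whence [legal_ext] and [ofv_vnext_ext]. Every [Accept] is answered by a return, which is right
    at losing positions, where some guard is negative. *)
Definition check (x : hist) (s : nat) : Ffun :=
  let f := last_f x in
  match f 2, f 0 with
  | Fin m, _ => pt 2 (Fin (m - 1))
  | _, Fin _ => if s == 0 then ofv vinit else pt 2 (Fin 0)
  | _, _ =>
    let val := fun q => fin_part (f q) in
    match acts s with
    | Move mv gs => if legal val gs then ofv (vnext mv val) else pt 0 (Fin (gmin val gs))
    | Accept gs => pt 0 (Fin (gmin val gs))
    | Pun t => pt 2 (Fin (val t))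
    end
  end.

Lemma check_bot : bot_ok check.
Proof. by move=> x s m e; rewrite /check e. Qed.

Lemma losing_adam val : losing val -> forall x, hon x val -> adamwin check x.
Proof.
elim=> {}val h1 _ IH x hx.
have hl : last_f x = ofv val by case: hx.
pose val' q := fin_part (last_f x q).
have hv t : trk t -> val' t = val t by rewrite /val' hl /ofv => ->.
have ev : ofv val = ofv val'.
  by apply: functional_extensionality => q; rewrite /ofv; case: ifP => // /hv ->.
have hx' : hon x val' by case: hx => g1 g2 g3 g4; split=> //; rewrite -ev.
have hc := hon_chron hx.
have ec s : check x s = match acts s with
    | Move mv gs => if legal val' gs then ofv (vnext mv val') else pt 0 (Fin (gmin val' gs))
    | Accept gs => pt 0 (Fin (gmin val' gs))
    | Pun t => pt 2 (Fin (val' t))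
    end.
  by rewrite /check hl /= /val' hl.
suff H s : s < nS -> inPi game (rcons x (s, check x s)) /\ adamwin check (rcons x (s, check x s)).
  apply: adamwin_step; first by move=> hE; apply: inTE_term hE (hon_noterm hx).
  - by move=> s /H [].
  - by move=> s /H [].
move=> hs; rewrite ec.
have ret gs : guards (acts s) = Some gs -> ~~ legal val' gs ->
    inPi game (rcons x (s, pt 0 (Fin (gmin val' gs)))) /\
    adamwin check (rcons x (s, pt 0 (Fin (gmin val' gs)))).
  move=> hg hnl.
  have hp := hon_extend hx' (succ_guard hs hg hnl).
  by split=> //; apply: return_adam => //; apply: gmin_lt0.
have leg gs : guards (acts s) = Some gs -> legal val' gs = legal val gs.
  exact: legal_ext.
case es : (acts s) ret leg => [mv gs|gs|t] ret leg.
- case: ifP => hlg; last by apply: ret; rewrite ?hlg.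
  rewrite (ofv_vnext_ext hv hs es); split.
    by apply: (hon_extend hx); apply: succ_move es.
  by apply: (IH _ _ _ hs es); [rewrite -leg | apply: hon_step es].
- by apply: ret => //; rewrite leg //; apply: (h1 _ _ hs es).
have ht : trk t by have := acts_ok hs; rewrite es.
have hp := hon_extend hx' (succ_pun val' hs es ht).
by split=> //; apply: bot_adam => //; exact: check_bot.
Qed.

Lemma losing_adam_wins : losing vinit -> adam_wins game.
Proof.
move=> hl; exists check; apply: adamwin_adam.
apply: adamwin_step; first by case=> _ [i []].
  move=> s hs; apply/(inPi_rcons [::]); split=> //.
  rewrite /check /=; case: eqP => [->|h]; first exact: succ_init.
  by apply: succ_init_bad; rewrite hs andbT lt0n; apply/eqP.
move=> s hs; rewrite /check /=; case: eqP => [->|h].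
  exact: (losing_adam hl hon_init).
apply: (@bot_adam check [::]); [exact: check_bot | by case | ].
apply/(inPi_rcons [::]); split=> //.
by apply: succ_init_bad; rewrite hs andbT lt0n; apply/eqP.
Qed.

(** Follow Eve's strategy against honest answers. An illegal action or an unjustified [Pun] would
    allow a deviation after which [check] wins for Adam, so her actions form a legal path, and as
    her win is well-founded the path ends in an [Accept]. *)
Lemma eve_wins_canacc : eve_wins game -> canacc vinit.
Proof.
case=> sE hE.
have main x : eve_wf game sE x -> forall val, hon x val -> canacc val.
  elim=> {}x => [h|[f0 hf0] h IH] val hx.
    by case: (inTE_term h (hon_noterm hx)).
  have hs : sE x < nS by case/inPi_rcons: hf0 => _ _ /succ_lt.
  have hc := hon_chron hx.
  have ret gs : guards (acts (sE x)) = Some gs -> ~~ legal val gs -> canacc val.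
    move=> hg hnl; have hp := hon_extend hx (succ_guard hs hg hnl).
    have ha := return_adam check hc hp (gmin_lt0 hnl).
    by case: (adamwin_not_eve ha (h _ hp)).
  case es : (acts (sE x)) ret => [mv gs|gs|t] ret.
  - case: (boolP (legal val gs)) => hl; last exact: ret hl.
    apply: (canacc_step hs es hl).
    have hx' := hon_step hx hs es.
    by apply: (IH _ _ _ hx'); case: (hx').
  - case: (boolP (legal val gs)) => hl; last exact: ret hl.
    exact: (canacc_now hs es hl).
  have ht : trk t by have := acts_ok hs; rewrite es.
  have hp := hon_extend hx (succ_pun val hs es ht).
  have ha := bot_adam check_bot hc hp.
  by case: (adamwin_not_eve ha (h _ hp)).
have inv x : eve_wf game sE x -> inTE game x \/ (exists f, inPi game (rcons x (sE x, f))) /\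
    (forall f, inPi game (rcons x (sE x, f)) -> eve_wf game sE (rcons x (sE x, f))).
  by case=> {}x h; [left | right].
case: (inv _ hE) => [[_ [i []]] //|[[f0 hf0] h]].
have hs : sE [::] < nS by case/(inPi_rcons [::]): hf0 => _ _ /succ_lt.
case: (sE [::] =P 0) => h0.
  rewrite h0 in h; have hi := hon_init.
  by apply: (main _ _ _ hi); apply: h; case: hi.
have hp : inPi game (rcons [::] (sE [::], pt 2 (Fin 0))).
  apply/(inPi_rcons [::]); split=> //.
  by apply: succ_init_bad; rewrite hs andbT lt0n; apply/eqP.
have ha : adamwin check (rcons [::] (sE [::], pt 2 (Fin 0))).
  by apply: bot_adam => //; [exact: check_bot | case].
by case: (adamwin_not_eve ha (h _ hp)).
Qed.

End Game.

(** * The reduction *)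

Definition rN : reg := @Ordinal 17 0 isT.
Definition rS : reg := @Ordinal 17 1 isT.
Definition rS1 : reg := @Ordinal 17 2 isT.
Definition rstart : reg := @Ordinal 17 3 isT.
Definition racc : reg := @Ordinal 17 4 isT.
Definition rrej : reg := @Ordinal 17 5 isT.
Definition rptr : reg := @Ordinal 17 6 isT.
Definition rq : reg := @Ordinal 17 7 isT.
Definition ra : reg := @Ordinal 17 8 isT.
Definition rq' : reg := @Ordinal 17 9 isT.
Definition rb : reg := @Ordinal 17 10 isT.
Definition rd : reg := @Ordinal 17 11 isT.
Definition rlive : reg := @Ordinal 17 12 isT.
Definition rzero : reg := @Ordinal 17 13 isT.
Definition tmps : seq reg := [:: @Ordinal 17 14 isT; @Ordinal 17 15 isT; @Ordinal 17 16 isT].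

(** A sum of products of registers with natural coefficients: such a number can be printed in unary
    by nested loops. *)
Definition expr := seq (seq reg).

Definition ev_mon (rho : reg -> nat) (m : seq reg) : nat := foldr (fun r a => rho r * a) 1 m.
Definition eval (rho : reg -> nat) (e : expr) : nat := sumn (map (ev_mon rho) e).
Definition cst (k : nat) : expr := nseq k [::].

(* [(false, e)] stands for the weight [e] and [(true, e)] for [- (e + 1)]. *)
Definition weight := (bool * expr)%type.
Definition ev_weight (rho : reg -> nat) (w : weight) : int :=
  if w.1 then Negz (eval rho w.2) else Posz (eval rho w.2).

Definition pos (e : expr) : weight := (false, e).
Definition neg (e : expr) : weight := (true, e).

Definition index_expr : expr := [:: [:: rq; rS]; [:: ra]].
(** [rlive] times the location [q * S + a + 1], hence 0 at a halting state. *)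
Definition live_expr : expr := [:: [:: rlive]; [:: rlive; rq; rS]; [:: rlive; ra]].
Definition size_expr : expr := [:: [::]; [:: rS1]].

(** Unlisted tracks keep their value, except the clock 3, which falls by 1. *)
Fixpoint lookup (l : seq (nat * (nat * weight))) (t : nat) : nat * weight :=
  match l with
  | [::] => (t, if t == 3 then neg [::] else pos [::])
  | p :: l' => if p.1 == t then p.2 else lookup l' t
  end.

Definition moves (l : seq (nat * (nat * weight))) : seq (nat * weight) := map (lookup l) tracks.

(* Tracks: 3 counts steps downwards, 4 is constantly 0, 5 and 6 hold [p] and [- p] for the
   control location [p]; 7 and 8 hold [l] and [- l], 9 and 10 [r] and [- r], where [l] and [r]
   are the two halves of the tape read as numbers in base [S]; 11 and 12 hold [x] and [1 - x],
   13 and 14 [y] and [- y], 15 and 16 [z] and [- z] for auxiliary counters [x], [y], [z]. *)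
Definition far (d : bool) : nat := if d then 7 else 9.
Definition near (d : bool) : nat := if d then 9 else 7.

(** For a live entry the two guards say that the location is exactly the index plus 1. For a halting
    state the second one reads [- p >= 0], which fails because locations are positive; this is how
    rejection disables all entries. *)
Definition at_entry : seq (nat * weight) := [:: (5, neg index_expr); (6, pos live_expr)].

(* Three actions for each entry of the transition table, executed in the direction [d] of that
   entry: 0 moves a unit of the half tape behind the head to [x], which gains [S]; 1 moves [S]
   units of the half tape ahead to [y], which gains 1; 2 jumps to the first location of the new
   state once 0 and 1 are exhausted, leaving the symbol read next in [z]. *)
Definition entry_moves (d : bool) (j : nat) : seq (nat * (nat * weight)) :=
  match j with
  | 0 => [:: (far d, (far d, neg [::])); ((far d).+1, ((far d).+1, pos (cst 1)));
             (11, (11, pos size_expr)); (12, (12, neg [:: [:: rS1]]))]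
  | 1 => [:: (near d, (near d, neg [:: [:: rS1]])); ((near d).+1, ((near d).+1, pos size_expr));
             (13, (13, pos (cst 1))); (14, (14, neg [::]))]
  | _ => [:: (5, (4, pos [:: [::]; [:: rq'; rS]])); (6, (4, neg [:: [:: rq'; rS]]));
             (far d, (11, pos [:: [:: rb]])); ((far d).+1, (12, neg [:: [:: rb]]));
             (11, (far d, pos [::])); (12, ((far d).+1, pos (cst 1)));
             (15, (near d, pos [::])); (16, ((near d).+1, pos [::]));
             (near d, (13, pos [::])); ((near d).+1, (14, pos [::]));
             (13, (15, pos [::])); (14, (16, pos [::]))]
  end.

(** The guard on 16 demands that the symbol under the head has been read completely. The jump also
    demands 0 behind the head and at most [S - 1] ahead, so that what remains ahead is the next
    symbol. *)
Definition entry_guards (d : bool) (j : nat) : seq (nat * weight) :=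
  match j with
  | 0 => [:: (far d, neg [::]); (16, pos [::])]
  | 1 => [:: (near d, neg [:: [:: rS1]]); (16, pos [::])]
  | _ => [:: ((far d).+1, pos [::]); ((near d).+1, pos [:: [:: rS1]]); (16, pos [::])]
  end.

Definition acts_entry (d : bool) (j : nat) : action weight :=
  Move (moves (entry_moves d j)) (at_entry ++ entry_guards d j).

(** Moves one unit of the pending symbol [z] into the location, since the jump can only set the
    location for the new state, not for the symbol. *)
Definition act_read : action weight :=
  Move (moves [:: (15, (15, neg [::])); (16, (16, pos (cst 1)));
                  (5, (5, pos (cst 1))); (6, (6, neg [::]))])
       [:: (15, neg [::])].

(** The guards admit the whole block of locations of the accepting state, whether or not the symbol
    has been read. *)
Definition act_accept : action weight :=
  Accept [:: (5, neg [:: [:: racc; rS]]); (6, pos [:: [:: racc; rS]; [:: rS]])].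

Definition tinit : seq weight :=
  [:: neg [::]; pos [::]; pos [:: [::]; [:: rstart; rS]]; neg [:: [:: rstart; rS]];
      pos [::]; pos [::]; pos [::]; pos [::]; pos [::]; pos (cst 1);
      pos [::]; pos [::]; pos [::]; pos [::]].

Definition acts_const (s : nat) : action weight :=
  if s < 14 then Pun (3 + s) else if s == 14 then act_accept else act_read.

Definition act_map (W W' : Type) (f : W -> W') (a : action W) : action W' :=
  let g := map (fun p : nat * W => (p.1, f p.2)) in
  match a with Move mv gs => Move (g mv) (g gs) | Accept gs => Accept (g gs) | Pun t => Pun t end.

Notation nth_entry M e := (nth (0, 0, false) (tm_delta M) e).

(** The values that the registers occurring in expressions have when the program prints the
    corresponding edges; all other registers are given 0. *)
Definition env (M : tm) (q a : nat) (t : nat * nat * bool) : reg -> nat := fun r =>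
  nth 0 [:: tm_nst M; tm_nsym M; (tm_nsym M).-1; tm_start M; tm_acc M; tm_rej M; 0;
            q; a; t.1.1; t.1.2; 0; nat_of_bool ((q != tm_rej M) && (q != tm_acc M))] r.

Definition env_const (M : tm) : reg -> nat := env M 0 0 (0, 0, false).
Definition env_entry (M : tm) (e : nat) : reg -> nat :=
  env M (e %/ tm_nsym M) (e %% tm_nsym M) (nth_entry M e).

Definition acts (M : tm) (s : nat) : action int :=
  if s < 16 then act_map (ev_weight (env_const M)) (acts_const s)
  else let e := (s - 16) %/ 3 in
       act_map (ev_weight (env_entry M e)) (acts_entry (nth_entry M e).2 ((s - 16) %% 3)).

Definition red_nS (M : tm) : nat := 16 + (tm_nst M * tm_nsym M) * 3.

Definition red_init (M : tm) : seq int := map (ev_weight (env_const M)) tinit.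

Definition red (M : tm) : mpg := game (red_nS M) (acts M) (red_init M).

(** * Symbolic edges and validity of the game *)

Notation tedges := (edges (pos [::]) (neg [::]) tinit).

Lemma act_edges_map (W W' : Type) (f : W -> W') w0 a :
  act_edges (f w0) (act_map f a) = [seq (e.1, f e.2) | e <- act_edges w0 a].
Proof.
have hg gs : guard_edges (map (fun p : nat * W => (p.1, f p.2)) gs)
   = [seq (e.1, f e.2) | e <- guard_edges gs].
  by rewrite /guard_edges -!map_comp; apply: eq_map.
case: a => [mv gs|gs|t]; rewrite /act_edges /act_map ?map_cat ?hg -?map_comp //.
congr (_ ++ _); elim: tracks mv => [|t l IH] [|p mv] //=.
by rewrite IH.
Qed.

Lemma base_edges_map rho s :
  base_edges 0%R (-1)%R (map (ev_weight rho) tinit) s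
  = [seq (e.1, ev_weight rho e.2) | e <- base_edges (pos [::]) (neg [::]) tinit s].
Proof. by rewrite /base_edges; case: eqP. Qed.

Lemma base_edges_pos init s : 0 < s ->
  base_edges 0%R (-1)%R init s
  = [seq (e.1, ev_weight (fun=> 0) e.2) | e <- base_edges (pos [::]) (neg [::]) tinit 1].
Proof. by case: s. Qed.

Definition entry_edges (d : bool) (j : nat) : seq (nat * nat * weight) :=
  base_edges (pos [::]) (neg [::]) tinit 1 ++ act_edges (pos [::]) (acts_entry d j).

Lemma edges_const M s : s < 16 ->
  edges 0%R (-1)%R (red_init M) (acts M) s
  = [seq (e.1, ev_weight (env_const M) e.2) | e <- tedges acts_const s].
Proof.
move=> hs; rewrite /edges map_cat base_edges_map; congr (_ ++ _).
by rewrite /acts hs -(act_edges_map (ev_weight (env_const M)) (pos [::])).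
Qed.

Lemma acts_at M e j : j < 3 ->
  acts M (16 + (e * 3 + j)) = act_map (ev_weight (env_entry M e)) (acts_entry (nth_entry M e).2 j).
Proof.
move=> hj; rewrite /acts ltnNge leq_addr.
have -> : (16 + (e * 3 + j) - 16) %/ 3 = e by rewrite addKn divnMDl // divn_small // addn0.
by have -> : (16 + (e * 3 + j) - 16) %% 3 = j by rewrite addKn modnMDl modn_small.
Qed.

Lemma edges_entry M s e j : s = 16 + (e * 3 + j) -> j < 3 ->
  edges 0%R (-1)%R (red_init M) (acts M) s
  = [seq (x.1, ev_weight (env_entry M e) x.2) | x <- entry_edges (nth_entry M e).2 j].
Proof.
move=> -> hj; rewrite /edges /entry_edges map_cat base_edges_pos //; congr (_ ++ _).
by rewrite acts_at // -(act_edges_map (ev_weight (env_entry M e)) (pos [::])).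
Qed.

Lemma const_ok : all (fun s => edges_ok (map fst (tedges acts_const s))) (iota 0 16).
Proof. by vm_compute. Qed.

Lemma entry_ok d j : edges_ok (map fst (entry_edges d j)).
Proof. by case: d; case: j => [|[|j]]; vm_compute. Qed.

Lemma index_entry s : 16 <= s -> s = 16 + ((s - 16) %/ 3 * 3 + (s - 16) %% 3).
Proof. by move=> h; rewrite -divn_eq subnKC. Qed.

Section RedOk.
Variable M : tm.

Lemma red_nS_pos : 14 <= red_nS M.
Proof. exact: leq_addr. Qed.

Lemma red_pun t : trk t -> acts M (t - 3) = Pun t.
Proof.
rewrite trkE => ht; rewrite /acts /acts_const.
have [h14 h16] : t - 3 < 14 /\ t - 3 < 16 by lia.
by rewrite h14 h16 /=; congr Pun; lia.
Qed.

Lemma red_acts_ok s : s < red_nS M -> act_ok (acts M s).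
Proof.
move=> _; rewrite /acts; case: ltnP => hs.
  by do 16 (case: s hs => [|s] hs; first by vm_compute).
by case: (nth_entry M _).2; case: (_ %% 3) => [|[|j]].
Qed.

Lemma red_edges_ok s : s < red_nS M ->
  edges_ok (map fst (edges 0%R (-1)%R (red_init M) (acts M) s)).
Proof.
move=> _; case: (ltnP s 16) => hs.
  rewrite edges_const // -map_comp.
  by have /allP := const_ok; apply; rewrite mem_iota.
rewrite (edges_entry M (index_entry hs)) ?ltn_mod // -map_comp.
exact: entry_ok.
Qed.

Lemma red_valid : valid_mpg (red M).
Proof. exact: (game_valid red_nS_pos red_edges_ok). Qed.

End RedOk.

Definition template := (nat * expr * nat * weight)%type.
Definition ev_template (rho : reg -> nat) (t : template) : nat * nat * nat * int :=
  (t.1.1.1, eval rho t.1.1.2, t.1.2, ev_weight rho t.2).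

(** Three copies of the index, since entry number [i] owns the actions [16 + 3 * i + j]. *)
Definition action_expr (j : nat) : expr := cst (16 + j) ++ index_expr ++ index_expr ++ index_expr.

Definition templates_const : seq template :=
  flatten [seq with_action (cst s) (tedges acts_const s) | s <- iota 0 16].
Definition templates_entry (d : bool) : seq template :=
  flatten [seq with_action (action_expr j) (entry_edges d j) | j <- iota 0 3].

Lemma eval_cat rho e e' : eval rho (e ++ e') = eval rho e + eval rho e'.
Proof. by rewrite /eval map_cat sumn_cat. Qed.

Lemma eval_cst rho k : eval rho (cst k) = k.
Proof. by rewrite /eval map_nseq sumn_nseq mul1n. Qed.

Lemma flatten_iota_mul (T : Type) (F : nat -> seq T) b n m :
  flatten [seq F s | s <- iota b (n * m)]
  = flatten [seq flatten [seq F (b + (k * m + j)) | j <- iota 0 m] | k <- iota 0 n].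
Proof.
elim: n => [|n IH] //; rewrite -addn1 mulnDl mul1n !iotaD !map_cat !flatten_cat IH /= cats0.
congr (_ ++ flatten _); rewrite add0n -[b + n * m]addn0 iotaDl -map_comp.
by apply: eq_map => j /=; rewrite addnA.
Qed.

Lemma red_delta M :
  g_delta (red M) = map (ev_template (env_const M)) templates_const ++
    flatten [seq map (ev_template (env_entry M e)) (templates_entry (nth_entry M e).2)
            | e <- iota 0 (tm_nst M * tm_nsym M)].
Proof.
rewrite -[LHS]/(flatten [seq with_action s (edges 0%R (-1)%R (red_init M) (acts M) s)
                        | s <- iota 0 (red_nS M)]).
have -> : iota 0 (red_nS M) = iota 0 16 ++ iota 16 (tm_nst M * tm_nsym M * 3).
  by rewrite -(iotaD 0 16).
set F := fun s => with_action s _; rewrite (map_cat F) flatten_cat; congr (_ ++ _).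
rewrite flatten_iota_mul; congr flatten; apply: eq_map => e.
rewrite /templates_entry map_flatten -map_comp; congr flatten.
apply/eq_in_map => j; rewrite mem_iota => /andP [_ hj]; rewrite /F.
rewrite (edges_entry _ (erefl _)) // /comp /with_action -!map_comp; apply: eq_map => -[[x y] w].
rewrite -[LHS]/(x, 16 + (e * 3 + j), y, ev_weight (env_entry M e) w).
rewrite -[RHS]/(x, eval (env_entry M e) (action_expr j), y, ev_weight (env_entry M e) w).
rewrite /action_expr !eval_cat eval_cst; congr (_, _, _, _).
have -> : eval (env_entry M e) index_expr = e.
  rewrite /eval /= !muln1 addn0 /env_entry /env /=.
  by rewrite -divn_eq.
lia.
Qed.

(** * The loop program computing the reduction *)

Definition tmp (k : nat) : reg := nth rzero tmps k.

(** The product is printed without being stored, as it may exceed the input length and thus any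
    register. Each nesting depth has its own temporary, whence the limit of three factors. *)
Fixpoint emit_mon (m : seq reg) : cmd :=
  if m is r :: m' then For (tmp (size m')) r (emit_mon m') else Emit true.

Definition emit_expr (e : expr) : cmd :=
  foldr (fun m c => Seq (emit_mon m) c) (Emit false) e.

Definition skip : cmd := Zero (tmp 0).

Definition emit_list (es : seq expr) : cmd :=
  foldr (fun e c => Seq (emit_expr e) c) skip es.

Definition parse (x : reg) : cmd :=
  Seq (Zero x) (Seq (WhileRead rptr (Inc x)) (Inc rptr)).

Definition enc_template (t : template) : seq expr :=
  [:: cst t.1.1.1; t.1.1.2; cst t.1.2] ++
  (if t.2.1 then [:: cst 1; [::] :: t.2.2] else [:: [::]; t.2.2]).

Definition header_exprs : seq expr :=
  [:: cst 17; cst 16 ++ nseq 3 [:: rN; rS]; [::];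
      cst (size templates_const) ++ nseq (size (templates_entry true)) [:: rN; rS]].

Definition const_exprs : seq expr := flatten (map enc_template templates_const).
Definition entry_exprs (d : bool) : seq expr := flatten (map enc_template (templates_entry d)).
Definition obs_exprs : seq expr :=
  map cst (size game_obs :: flatten (map (fun o : seq nat => size o :: o) game_obs)).

(** There is no decrement: [rS1] is reset in round 0 and incremented in each later round. The value
    [S - 1] is needed because the weight [- S] is written as minus [S - 1] minus 1. *)
Definition parse_pred : cmd :=
  For (tmp 0) rS (IfEq (tmp 0) rzero (Zero rS1) (Inc rS1)).

Definition set_live : cmd :=
  Seq (Zero rlive) (IfEq rq rrej skip (IfEq rq racc skip (Inc rlive))).

Definition parse_header : cmd :=
  Seq (parse rN) (Seq (parse rS) (Seq (parse rstart) (Seq (parse racc) (Seq (parse rrej) parse_pred)))).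

(** The direction changes the endpoints of edges and not just their weights, so it selects between
    two lists of templates. *)
Definition do_entry : cmd :=
  Seq (parse rq') (Seq (parse rb) (Seq (parse rd)
    (IfEq rd rzero (emit_list (entry_exprs false)) (emit_list (entry_exprs true))))).

Definition reducer : cmd :=
  Seq parse_header
  (Seq (emit_list (header_exprs ++ const_exprs))
  (Seq (For rq rN (Seq set_live (For ra rS do_entry)))
       (emit_list obs_exprs))).

Lemma reducer_wf : wf_cmd reducer.
Proof. by vm_compute. Qed.

Definition vars_const : seq reg := [:: rN; rS; rS1; rstart; racc; rrej].
Definition vars_entry : seq reg := vars_const ++ [:: rq; ra; rq'; rb; rlive].

Definition expr_over (vs : seq reg) : pred expr :=
  all (fun m : seq reg => (size m <= 3) && all (fun r => r \in vs) m).
Definition exprs_over (vs : seq reg) : pred (seq expr) := all (expr_over vs).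

Lemma header_over : exprs_over vars_const (header_exprs ++ const_exprs).
Proof. by vm_compute. Qed.

Lemma entry_over d : exprs_over vars_entry (entry_exprs d).
Proof. by case: d; vm_compute. Qed.

Lemma obs_over : exprs_over vars_const obs_exprs.
Proof. by vm_compute. Qed.

Definition kept_regs : seq reg := [:: rq; ra; rlive] ++ rzero :: vars_const.

Lemma do_entry_keeps : all (fun r => ~~ modifies do_entry r) kept_regs.
Proof. by vm_compute. Qed.

Lemma size_templates_entry d : size (templates_entry d) = size (templates_entry true).
Proof. by case: d; vm_compute. Qed.

Opaque const_exprs entry_exprs templates_const templates_entry.

Lemma unary_enc_cat l l' : unary_enc (l ++ l') = unary_enc l ++ unary_enc l'.
Proof. by rewrite /unary_enc map_cat flatten_cat. Qed.

Lemma unary_enc_cons v l : unary_enc (v :: l) = nseq v true ++ false :: unary_enc l.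
Proof. by rewrite /unary_enc /= cat_rcons. Qed.

(** Numbers in the input are smaller than its length, so registers holding them never saturate. *)
Lemma mem_unary_enc v l : v \in l -> v < size (unary_enc l).
Proof.
elim: l => // u l IH; rewrite inE unary_enc_cons size_cat size_nseq /=.
by case/orP => [/eqP ->|/IH]; lia.
Qed.

Lemma ev_mon_ext rho rho' m : {in m, rho =1 rho'} -> ev_mon rho m = ev_mon rho' m.
Proof.
elim: m => //= r m IH h; rewrite h ?mem_head // IH // => r' hr'.
by apply: h; rewrite inE hr' orbT.
Qed.

Lemma eval_ext vs rho rho' e : expr_over vs e -> {in vs, rho =1 rho'} ->
  eval rho e = eval rho' e.
Proof.
move=> /allP he h; congr sumn; apply/eq_in_map => m /he /andP [_ /allP hm].
by apply: ev_mon_ext => r /hm /h.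
Qed.

(** * Printing expressions in unary *)

Section Run.

Variable w : seq bool.
Notation sem := (sem w).

Fixpoint emits (c : cmd) : bool :=
  match c with
  | Emit _ => true
  | Inc _ | Zero _ => false
  | Seq c1 c2 | IfEq _ _ c1 c2 => emits c1 || emits c2
  | For _ _ c | WhileRead _ c => emits c
  end.

Lemma sem_seq c1 c2 st : sem (Seq c1 c2) st = sem c2 (sem c1 st).
Proof. by []. Qed.

Lemma sem_silent c st : ~~ emits c -> (sem c st).2 = st.2.
Proof.
elim: c st => [b|r|r|c1 IH1 c2 IH2|r r' c1 IH1 c2 IH2|i r c IH|r c IH] st //=.
- by rewrite negb_or => /andP [h1 h2]; rewrite IH2 ?IH1.
- by rewrite negb_or => /andP [h1 h2]; case: ifP => _; rewrite ?IH2 ?IH1.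
- by move=> h; elim: (st.1 r) => //= k IHk; rewrite IH.
- by move=> h; elim: (find _ _) => //= k IHk; rewrite IH.
Qed.

Lemma sem_for (P : nat -> state -> Prop) i r c st : i != r -> ~~ modifies c i ->
  st.1 r <= size w -> P 0 (upd st.1 i 0, st.2) ->
  (forall k s, k < st.1 r -> s.1 i = k -> P k s -> P k.+1 (incr_st w i (sem c s))) ->
  P (st.1 r) (sem (For i r c) st).
Proof.
move=> hir hmi hr h0 hS /=.
suff H k : k <= st.1 r ->
   (iter k (fun s => incr_st w i (sem c s)) (upd st.1 i 0, st.2)).1 i = k /\
   P k (iter k (fun s => incr_st w i (sem c s)) (upd st.1 i 0, st.2)).
  by have [] := H _ (leqnn _).
elim: k => [|k IH] hk; first by rewrite /= /upd eqxx.
have [e hP] := IH (ltnW hk); rewrite iterS.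
set s := iter k _ _ in e hP *.
split; last exact: hS.
by rewrite incr_st_same sem_unmodified ?e //; lia.
Qed.

Lemma modifies_emit_mon m r : r \notin tmps -> size m <= 3 -> ~~ modifies (emit_mon m) r.
Proof.
move=> hr; elim: m => //= r' m IH hm; rewrite negb_or IH ?(ltnW hm) // andbT.
apply: contra hr => /eqP ->.
by rewrite /tmp; case: (size m) hm => [|[|[|]]].
Qed.

Lemma modifies_emit_expr vs e r : r \notin tmps -> expr_over vs e -> ~~ modifies (emit_expr e) r.
Proof.
move=> hr; elim: e => //= m e IH /andP [/andP [hm _] he].
by rewrite negb_or modifies_emit_mon // IH.
Qed.

Lemma modifies_emit_list vs es r : r \notin tmps -> exprs_over vs es ->
  ~~ modifies (emit_list es) r.
Proof.
move=> hr; elim: es => [_|e es IH /andP [he hes]] /=.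
  by apply: contra hr => /eqP ->.
by rewrite negb_or (modifies_emit_expr hr he) IH.
Qed.

Lemma nseqD (T : Type) a b (x : T) : nseq (a + b) x = nseq a x ++ nseq b x.
Proof. by elim: a => //= a ->. Qed.

Lemma sem_emit_mon m st : all (fun r => r \notin tmps) m -> size m <= 3 ->
  (sem (emit_mon m) st).2 = st.2 ++ nseq (ev_mon st.1 m) true.
Proof.
elim: m st => [|r m IH] st; first by move=> _ _ /=; rewrite cats1.
move=> /= /andP [hr hm] hs.
have htm : tmp (size m) \in tmps by rewrite /tmp; case: (size m) hs => [|[|[|]]].
suff H k : let s := iter k (fun s => incr_st w (tmp (size m)) (sem (emit_mon m) s))
                       (upd st.1 (tmp (size m)) 0, st.2) in
    (forall r', r' \notin tmps -> s.1 r' = st.1 r')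
    /\ s.2 = st.2 ++ nseq (k * ev_mon st.1 m) true.
  by have [_] := H (st.1 r).
elim: k => [|k [IH1 IH2]].
  rewrite /= cats0; split=> // r' hr'; rewrite /upd; case: eqP => // e.
  by rewrite e htm in hr'.
rewrite iterS; move: IH1 IH2; set s := iter k _ _ => IH1 IH2.
split=> [r' hr'|].
  rewrite incr_st_other; last by apply: contraNneq hr' => ->.
  by rewrite sem_unmodified ?IH1 // modifies_emit_mon // ltnW.
rewrite /incr_st [LHS]/= IH ?(ltnW hs) // IH2 -catA -nseqD mulSn addnC.
congr (_ ++ nseq (_ + _) _); apply: ev_mon_ext => r' /(allP hm); exact: IH1.
Qed.

Variable vs : seq reg.
Hypothesis vs_tmps : all (fun r => r \notin tmps) vs.

Lemma sem_emit_expr e st : expr_over vs e ->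
  (sem (emit_expr e) st).2 = st.2 ++ rcons (nseq (eval st.1 e) true) false.
Proof.
elim: e st => [|m e IH] st; first by rewrite /= cats1.
move=> /= /andP [/andP [hm hmv] he].
have hmt : all (fun r => r \notin tmps) m.
  by apply: sub_all hmv => r; apply: (allP vs_tmps).
rewrite IH // sem_emit_mon // -catA.
rewrite (_ : eval _ e = eval st.1 e); last first.
  apply: (eval_ext he) => r /(allP vs_tmps) hr.
  by rewrite sem_unmodified // modifies_emit_mon.
by rewrite /eval /= nseqD rcons_cat.
Qed.

Lemma sem_emit_list es st : exprs_over vs es ->
  (sem (emit_list es) st).2 = st.2 ++ unary_enc (map (eval st.1) es).
Proof.
elim: es st => [|e es IH] st; first by rewrite /= cats0.
move=> /= /andP [he hes]; rewrite IH // sem_emit_expr // -catA.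
congr (_ ++ (_ ++ unary_enc _)).
apply/eq_in_map => e' /(allP hes) he'; apply: (eval_ext he') => r /(allP vs_tmps) hr.
by rewrite sem_unmodified // (modifies_emit_expr hr he).
Qed.

End Run.

Section Parse.

Variables (l1 l2 : seq nat) (v : nat).
Notation w := (unary_enc (l1 ++ v :: l2)).

Lemma sem_parse x st : x != rptr -> st.1 rptr = size (unary_enc l1) ->
  (sem w (parse x) st).1 x = v /\
  (sem w (parse x) st).1 rptr = size (unary_enc (rcons l1 v)).
Proof.
move=> hx hp.
have hsz : size w = size (unary_enc l1) + (v + (size (unary_enc l2)).+1).
  by rewrite unary_enc_cat unary_enc_cons !size_cat size_nseq.
have -> : sem w (parse x) st = incr_st w rptr (iter (find negb (drop (upd st.1 x 0 rptr) w))
   (fun s => incr_st w rptr (incr_st w x s)) (upd st.1 x 0, st.2)) by [].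
have hup : upd st.1 x 0 rptr = size (unary_enc l1) by rewrite /upd eq_sym (negbTE hx).
rewrite hup.
have -> : find negb (drop (size (unary_enc l1)) w) = v.
  rewrite unary_enc_cat drop_size_cat // unary_enc_cons.
  by elim: v => //= k ->.
suff H k : k <= v -> let s := iter k (fun s => incr_st w rptr (incr_st w x s)) (upd st.1 x 0, st.2) in
   s.1 x = k /\ s.1 rptr = size (unary_enc l1) + k.
  have [h1 h2] := H _ (leqnn v); move: h1 h2; set s := iter v _ _ => h1 h2.
  rewrite incr_st_other // incr_st_same h2 ?hsz //; last by lia.
  split=> //; rewrite -cats1 unary_enc_cat unary_enc_cons size_cat /= size_cat size_nseq /=; lia.
elim: k => [|k IH] hk; first by rewrite /= addn0; split=> //; rewrite /upd eqxx.
have [h1 h2] := IH (ltnW hk); rewrite iterS; move: h1 h2; set s := iter k _ _ => h1 h2.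
have hx' : rptr != x by rewrite eq_sym.
split; first by rewrite incr_st_other // incr_st_same h1 //; lia.
by rewrite incr_st_same incr_st_other // h2 ?addnS //; lia.
Qed.

End Parse.

(** * Correctness of the loop program *)

Section Reducer.

Variable M : tm.
Hypothesis M_valid : valid_tm M.
Notation N := (tm_nst M).
Notation S := (tm_nsym M).
Notation l := (enc_tm M).
Notation w := (unary_enc l).
Notation sem := (sem w).

Definition header : seq nat := [:: N; S; tm_start M; tm_acc M; tm_rej M].
Definition triple (t : nat * nat * bool) : seq nat := [:: t.1.1; t.1.2; nat_of_bool t.2].
(** The part of the input already consumed when entry [e] is about to be parsed; the length of its
    encoding is the value of [rptr]. *)
Definition prefix_at (e : nat) : seq nat := header ++ flatten (map triple (take e (tm_delta M))).

Lemma size_delta : size (tm_delta M) = N * S.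
Proof. by case/and5P: M_valid => _ _ _ _ /and3P [_ /eqP]. Qed.

Lemma enc_tmE e : e < N * S ->
  l = prefix_at e ++ triple (nth_entry M e) ++ flatten (map triple (drop e.+1 (tm_delta M))).
Proof.
move=> he; rewrite /enc_tm /prefix_at -catA; congr (_ ++ _).
rewrite -{1}(cat_take_drop e (tm_delta M)) map_cat flatten_cat; congr (_ ++ _).
by rewrite (drop_nth (0, 0, false)) ?size_delta.
Qed.

Lemma prefix_atS e : e < N * S -> prefix_at e.+1 = prefix_at e ++ triple (nth_entry M e).
Proof.
move=> he; rewrite /prefix_at -catA; congr (_ ++ _).
by rewrite (take_nth (0, 0, false)) ?size_delta // map_rcons flatten_rcons.
Qed.

Definition core (st : state) : bool :=
  all (fun r => st.1 r == env_const M r) (rzero :: vars_const).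

Lemma core_sem c st : all (fun r => ~~ modifies c r) (rzero :: vars_const) -> core st ->
  core (sem c st).
Proof.
move=> /allP h /allP hc; apply/allP => r hr; rewrite sem_unmodified; first exact: hc.
exact: h.
Qed.

Lemma core_reg st r : core st -> r \in rzero :: vars_const -> st.1 r = env_const M r.
Proof. by move=> /allP h /h /eqP. Qed.

Lemma core_incr i st : i \notin rzero :: vars_const -> core st -> core (incr_st w i st).
Proof.
move=> hi /allP h; apply/allP => r hr; rewrite incr_st_other; first exact: h.
by apply: contraNneq hi => <-.
Qed.

Lemma sem_parse_header st : (forall r, st.1 r = 0) -> st.2 = [::] ->
  let s := sem parse_header st in
  [/\ core s, s.1 rptr = size (unary_enc (prefix_at 0)) & s.2 = [::]].
Proof.
move=> h0 ho.
have S_pos : 0 < S by case/and5P: M_valid => _ _ _ _ /and3P [].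
have hS : S < size w by apply: mem_unary_enc; rewrite !inE eqxx orbT.
pose rest := flatten (map triple (tm_delta M)).
have pN : l = [::] ++ N :: ([:: S; tm_start M; tm_acc M; tm_rej M] ++ rest) by [].
have pS : l = [:: N] ++ S :: ([:: tm_start M; tm_acc M; tm_rej M] ++ rest) by [].
have p3 : l = [:: N; S] ++ tm_start M :: ([:: tm_acc M; tm_rej M] ++ rest) by [].
have p4 : l = [:: N; S; tm_start M] ++ tm_acc M :: ([:: tm_rej M] ++ rest) by [].
have p5 : l = [:: N; S; tm_start M; tm_acc M] ++ tm_rej M :: rest by [].
pose s1 := sem (parse rN) st; pose s2 := sem (parse rS) s1; pose s3 := sem (parse rstart) s2.
pose s4 := sem (parse racc) s3; pose s5 := sem (parse rrej) s4.
have [a1 b1] : s1.1 rN = N /\ s1.1 rptr = size (unary_enc [:: N]).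
  by apply: (@sem_parse [::] _ N rN st).
have [a2 b2] : s2.1 rS = S /\ s2.1 rptr = size (unary_enc [:: N; S]).
  exact: (@sem_parse [:: N] _ S rS s1).
have [a3 b3] : s3.1 rstart = tm_start M /\ s3.1 rptr = size (unary_enc [:: N; S; tm_start M]).
  exact: (@sem_parse [:: N; S] _ _ rstart s2).
have [a4 b4] : s4.1 racc = tm_acc M /\
    s4.1 rptr = size (unary_enc [:: N; S; tm_start M; tm_acc M]).
  exact: (@sem_parse [:: N; S; tm_start M] _ _ racc s3).
have [a5 b5] : s5.1 rrej = tm_rej M /\ s5.1 rptr = size (unary_enc header).
  exact: (@sem_parse [:: N; S; tm_start M; tm_acc M] rest _ rrej s4).
have -> : sem parse_header st = sem parse_pred s5 by [].
have keep c r s : ~~ modifies c r -> (sem c s).1 r = s.1 r by exact: sem_unmodified.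
have z5 : s5.1 rzero = 0 by rewrite /s5 /s4 /s3 /s2 /s1 5?keep.
have eS : s5.1 rS = S by rewrite /s5 /s4 /s3 3?keep.
have hS1 : (sem parse_pred s5).1 rS1 = S.-1.
  suff [] : (sem parse_pred s5).1 rS1 = (s5.1 rS).-1 /\ (sem parse_pred s5).1 rzero = 0.
    by rewrite eS.
  apply: (sem_for (P := fun k s => s.1 rS1 = k.-1 /\ s.1 rzero = 0)) => //.
  - by rewrite eS ltnW.
  - split=> //; rewrite -[LHS]/(s5.1 rS1) /s5 /s4 /s3 /s2 /s1 5?keep // h0.
  - move=> k s hk ei [h1 h2]; split; rewrite incr_st_other //; last by rewrite keep.
    rewrite /= ei h2; case: (k =P 0) => [->|hk0] /=; first by rewrite /upd eqxx.
    rewrite -[LHS]/((incr_st w rS1 s).1 rS1) incr_st_same ?h1; first by lia.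
    by rewrite eS in hk; lia.
have ho5 : (sem parse_pred s5).2 = [::].
  by rewrite sem_silent // /s5 /s4 /s3 /s2 /s1 5?sem_silent.
split=> //; last by rewrite keep // b5 /prefix_at take0 cats0.
have fz : (sem parse_pred s5).1 rzero = 0 by rewrite keep.
have fN : (sem parse_pred s5).1 rN = N by rewrite keep // /s5 /s4 /s3 /s2 4?keep.
have fS : (sem parse_pred s5).1 rS = S by rewrite keep.
have fst : (sem parse_pred s5).1 rstart = tm_start M by rewrite keep // /s5 /s4 2?keep.
have facc : (sem parse_pred s5).1 racc = tm_acc M by rewrite keep // /s5 1?keep.
have frej : (sem parse_pred s5).1 rrej = tm_rej M by rewrite keep.
move: (sem parse_pred s5) hS1 fz fN fS fst facc frej => s e1 e2 e3 e4 e5 e6 e7.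
by rewrite /core /= e1 e2 e3 e4 e5 e6 e7 /env_const /env /= !eqxx.
Qed.

Definition entry_out (e : nat) : seq nat :=
  map (eval (env_entry M e)) (entry_exprs (nth_entry M e).2).

Lemma env_entry_agree e st : core st -> st.1 rq = e %/ S -> st.1 ra = e %% S ->
  st.1 rq' = (nth_entry M e).1.1 -> st.1 rb = (nth_entry M e).1.2 ->
  st.1 rlive = nat_of_bool ((e %/ S != tm_rej M) && (e %/ S != tm_acc M)) ->
  {in vars_entry, st.1 =1 env_entry M e}.
Proof.
move=> hc h1 h2 h3 h4 h5 r; rewrite mem_cat => /orP [hr|].
  rewrite (core_reg hc); last by rewrite in_cons hr orbT.
  by move: hr; rewrite !inE => /or4P [|||/or3P []] /eqP ->.
by rewrite !inE => /or4P [|||/orP []] /eqP ->.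
Qed.

Lemma sem_do_entry q a st : q < N -> a < S -> core st -> st.1 rq = q -> st.1 ra = a ->
  st.1 rlive = nat_of_bool ((q != tm_rej M) && (q != tm_acc M)) ->
  st.1 rptr = size (unary_enc (prefix_at (q * S + a))) ->
  (sem do_entry st).1 rptr = size (unary_enc (prefix_at (q * S + a).+1)) /\
  (sem do_entry st).2 = st.2 ++ unary_enc (entry_out (q * S + a)).
Proof.
move=> hq ha hc eq ea elive hp; set e := q * S + a in hp *.
have he : e < N * S.
  apply: (@leq_trans (q.+1 * S)); last by rewrite leq_mul2r hq orbT.
  by rewrite /e mulSn [S + _]addnC ltn_add2l.
have ediv : e %/ S = q by rewrite /e divnMDl ?(leq_ltn_trans _ ha) // divn_small // addn0.
have emod : e %% S = a by rewrite /e modnMDl modn_small.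
have el := enc_tmE he; move: el (prefix_atS he).
set t := nth_entry M e; set rest := flatten _ => el epre.
have el1 : l = prefix_at e ++ t.1.1 :: (t.1.2 :: nat_of_bool t.2 :: rest) by rewrite el.
have el2 : l = rcons (prefix_at e) t.1.1 ++ t.1.2 :: (nat_of_bool t.2 :: rest).
  by rewrite cat_rcons.
have el3 : l = rcons (rcons (prefix_at e) t.1.1) t.1.2 ++ nat_of_bool t.2 :: rest.
  by rewrite !cat_rcons.
pose s1 := sem (parse rq') st; pose s2 := sem (parse rb) s1; pose s3 := sem (parse rd) s2.
have [a1 b1] : s1.1 rq' = t.1.1 /\ s1.1 rptr = size (unary_enc (rcons (prefix_at e) t.1.1)).
  by rewrite /s1 [in sem _ _]el1; apply: sem_parse.
have [a2 b2] : s2.1 rb = t.1.2 /\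
    s2.1 rptr = size (unary_enc (rcons (rcons (prefix_at e) t.1.1) t.1.2)).
  by rewrite /s2 [in sem _ _]el2; apply: sem_parse.
have [a3 b3] : s3.1 rd = nat_of_bool t.2 /\ s3.1 rptr = size (unary_enc (prefix_at e.+1)).
  rewrite epre /triple -[_ ++ [:: _; _; _]]cats0 -catA.
  have -> : prefix_at e ++ [:: t.1.1; t.1.2; nat_of_bool t.2] ++ [::]
     = rcons (rcons (rcons (prefix_at e) t.1.1) t.1.2) (nat_of_bool t.2).
    by rewrite -!cats1 -!catA.
  by rewrite /s3 [in sem _ _]el3; apply: sem_parse.
have keep c r s : ~~ modifies c r -> (sem c s).1 r = s.1 r by exact: sem_unmodified.
have hc3 : core s3 by rewrite /s3 /s2 /s1; do 3 (apply: core_sem => //).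
have z3 : s3.1 rzero = 0 by rewrite (core_reg hc3).
have -> : sem do_entry st = sem (emit_list (entry_exprs t.2)) s3.
  have -> : sem do_entry st = if s3.1 rd == s3.1 rzero then sem (emit_list (entry_exprs false)) s3
                 else sem (emit_list (entry_exprs true)) s3 by [].
  by rewrite a3 z3; case: (t.2).
split; first by rewrite keep // (modifies_emit_list _ (entry_over t.2)).
rewrite (@sem_emit_list w vars_entry) ?entry_over //.
have -> : s3.2 = st.2 by rewrite /s3 /s2 /s1 3?sem_silent.
congr (_ ++ unary_enc _); apply/eq_in_map => x /(allP (entry_over t.2)) hx.
apply: (eval_ext hx) => r hr.
apply: (env_entry_agree hc3) => //; rewrite ?ediv ?emod.
- by rewrite /s3 /s2 /s1 3?keep.
- by rewrite /s3 /s2 /s1 3?keep.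
- by rewrite /s3 /s2 2?keep.
- by rewrite /s3 1?keep.
- by rewrite /s3 /s2 /s1 3?keep.
Qed.

Definition entries_out (k : nat) : seq nat := flatten [seq entry_out e | e <- iota 0 k].

Lemma entries_outS k : entries_out k.+1 = entries_out k ++ entry_out k.
Proof. by rewrite /entries_out -addn1 iotaD map_cat flatten_cat /= cats0. Qed.

Lemma sem_entries st : core st -> st.1 rptr = size (unary_enc (prefix_at 0)) ->
  let s := sem (For rq rN (Seq set_live (For ra rS do_entry))) st in
  core s /\ s.2 = st.2 ++ unary_enc (entries_out (N * S)).
Proof.
move=> hc hp s.
have S_pos : 0 < S by case/and5P: M_valid => _ _ _ _ /and3P [].
have hS : S <= size w by apply/ltnW/mem_unary_enc; rewrite !inE eqxx orbT.
have hN : N <= size w by apply/ltnW/mem_unary_enc; rewrite !inE eqxx.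
have eN : st.1 rN = N by rewrite (core_reg hc).
have keep c r s0 : ~~ modifies c r -> (sem c s0).1 r = s0.1 r by exact: sem_unmodified.
have mod_entry r : r \in kept_regs -> ~~ modifies do_entry r by apply: (allP do_entry_keeps).
suff [] : [/\ core s, s.1 rptr = size (unary_enc (prefix_at (st.1 rN * S))) &
          s.2 = st.2 ++ unary_enc (entries_out (st.1 rN * S))] by rewrite eN.
apply: (sem_for (P := fun q s => [/\ core s, s.1 rptr = size (unary_enc (prefix_at (q * S))) &
          s.2 = st.2 ++ unary_enc (entries_out (q * S))])) => //.
- by rewrite eN.
- rewrite mul0n; split; [exact: (@core_sem (Zero rq) st) | exact: hp | by rewrite cats0].
move=> q s0 hq eq [hc0 hp0 ho0]; rewrite eN in hq.
pose s1 := sem set_live s0.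
have hc1 : core s1 by apply: core_sem.
have el : s1.1 rlive = nat_of_bool ((q != tm_rej M) && (q != tm_acc M)).
  rewrite /s1 /set_live /= /upd /= eq.
  have -> : s0.1 rrej = tm_rej M by rewrite (core_reg hc0).
  have -> : s0.1 racc = tm_acc M by rewrite (core_reg hc0).
  case: (q =P tm_rej M) => //= _; case: (q =P tm_acc M) => //= _.
  by rewrite /incr /upd /= (leq_trans S_pos hS).
have eq1 : s1.1 rq = q by rewrite keep.
have eS1 : s1.1 rS = S by rewrite (core_reg hc1).
have H : [/\ core (sem (For ra rS do_entry) s1), (sem (For ra rS do_entry) s1).1 rq = q,
   (sem (For ra rS do_entry) s1).1 rlive = nat_of_bool ((q != tm_rej M) && (q != tm_acc M)),
   (sem (For ra rS do_entry) s1).1 rptr = size (unary_enc (prefix_at (q * S + s1.1 rS))) &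
   (sem (For ra rS do_entry) s1).2 = st.2 ++ unary_enc (entries_out (q * S + s1.1 rS))].
  apply: (sem_for (P := fun a s => [/\ core s, s.1 rq = q,
     s.1 rlive = nat_of_bool ((q != tm_rej M) && (q != tm_acc M)),
     s.1 rptr = size (unary_enc (prefix_at (q * S + a))) &
     s.2 = st.2 ++ unary_enc (entries_out (q * S + a))])) => //.
  - by rewrite eS1.
  - rewrite addn0; split; [exact: (@core_sem (Zero ra) s1) | exact: eq1 | exact: el | |].
    + by rewrite -hp0 -[LHS]/(s1.1 rptr) keep.
    + by rewrite -ho0 -[LHS]/(s1.2) sem_silent.
  move=> a s2 ha ea [g1 g2 g3 g4 g5]; rewrite eS1 in ha.
  have [h1 h2] := sem_do_entry hq ha g1 g2 ea g3 g4.
  rewrite addnS; split.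
  - apply: core_incr; first by [].
    apply: core_sem; last exact: g1.
    by apply/allP => r hr; apply: mod_entry; rewrite mem_cat hr orbT.
  - by rewrite incr_st_other // keep; [exact: g2 | apply: mod_entry].
  - by rewrite incr_st_other // keep; [exact: g3 | apply: mod_entry].
  - by rewrite incr_st_other.
  - by rewrite [LHS]/= h2 g5 -catA -unary_enc_cat -entries_outS.
move: H; rewrite eS1 addnC -mulSn => -[g1 g2 g3 g4 g5].
have -> : sem (Seq set_live (For ra rS do_entry)) s0 = sem (For ra rS do_entry) s1 by [].
split=> //.
- exact: core_incr.
- by rewrite incr_st_other.
Qed.

Lemma enc_templateE rho t : let e := ev_template rho t in
  map (eval rho) (enc_template t) = [:: e.1.1.1; e.1.1.2; e.1.2] ++ enc_int e.2.
Proof.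
case: t => [[[x s] y] [b e]]; rewrite /enc_template /ev_template /ev_weight /= !eval_cst.
by case: b.
Qed.

Lemma enc_templatesE rho ts :
  flatten (map (fun e : nat * nat * nat * int => [:: e.1.1.1; e.1.1.2; e.1.2] ++ enc_int e.2)
     (map (ev_template rho) ts)) = map (eval rho) (flatten (map enc_template ts)).
Proof.
rewrite map_flatten -!map_comp; congr flatten; apply: eq_map => t.
exact: (esym (enc_templateE rho t)).
Qed.

Lemma flatten_map_flatten (A B C : Type) (f : B -> seq C) (g : A -> seq B) r :
  flatten (map f (flatten (map g r))) = flatten [seq flatten (map f (g x)) | x <- r].
Proof. by elim: r => //= x r IH; rewrite map_cat flatten_cat IH. Qed.

Lemma reducer_correct : (sem reducer (fun=> 0, [::])).2 = unary_enc (enc_mpg (red M)).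
Proof.
have [hc1 hp1 ho1] := @sem_parse_header (fun=> 0, [::]) (fun=> erefl) erefl.
move: hc1 hp1 ho1; set s1 := sem _ _ => hc1 hp1 ho1.
pose s2 := sem (emit_list (header_exprs ++ const_exprs)) s1.
have hv r : r \in rzero :: vars_const -> r \notin tmps.
  by move: r; apply/allP.
have hvars : all (fun r => r \notin tmps) vars_const by [].
have hc2 : core s2.
  apply: core_sem; last exact: hc1.
  by apply/allP => r /hv hr; exact: (modifies_emit_list hr header_over).
have hp2 : s2.1 rptr = size (unary_enc (prefix_at 0)).
  by rewrite sem_unmodified; [exact: hp1 | apply: (modifies_emit_list _ header_over)].
have [hc3 ho3] := sem_entries hc2 hp2.
move: hc3 ho3; set s3 := sem _ s2 => hc3 ho3.
have ev st es : core st -> exprs_over vars_const es ->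
    map (eval st.1) es = map (eval (env_const M)) es.
  move=> hc /allP hes; apply/eq_in_map => e /hes he; apply: (eval_ext he) => r hr.
  by apply: (core_reg hc); rewrite inE hr orbT.
have out_obs : (sem reducer (fun=> 0, [::])).2
    = s3.2 ++ unary_enc (map (eval (env_const M)) obs_exprs).
  rewrite /reducer 3!sem_seq -/s1 -/s2 -/s3.
  by rewrite (sem_emit_list w hvars s3 obs_over) (ev _ _ hc3 obs_over).
have out_header : s2.2 = unary_enc (map (eval (env_const M)) (header_exprs ++ const_exprs)).
  by rewrite (sem_emit_list w hvars s1 header_over) ho1 (ev _ _ hc1 header_over).
rewrite out_obs ho3 out_header.
rewrite -!unary_enc_cat; congr unary_enc; rewrite map_cat /enc_mpg.
have hdelta := red_delta M.
have hsize : size (g_delta (red M)) = eval (env_const M)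
   (cst (size templates_const) ++ nseq (size (templates_entry true)) [:: rN; rS]).
  rewrite hdelta eval_cat eval_cst size_cat size_map; congr (_ + _).
  rewrite size_flatten /shape -map_comp.
  rewrite (eq_map (g := fun=> size (templates_entry true))); last first.
    by move=> e /=; rewrite size_map size_templates_entry.
  rewrite /eval map_nseq sumn_nseq.
  have -> : ev_mon (env_const M) [:: rN; rS] = N * S by rewrite /ev_mon /= muln1.
  elim: (N * S) 0 => [|k IH] b /=; first by rewrite mul0n.
  by rewrite IH mulSn.
have hentries : flatten (map (fun e : nat * nat * nat * int =>
      [:: e.1.1.1; e.1.1.2; e.1.2] ++ enc_int e.2)
    (flatten [seq map (ev_template (env_entry M e)) (templates_entry (nth_entry M e).2)
            | e <- iota 0 (N * S)])) = entries_out (N * S).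
  rewrite flatten_map_flatten; congr flatten; apply: eq_map => e; exact: enc_templatesE.
rewrite hsize hdelta map_cat flatten_cat enc_templatesE hentries.
have -> : map (eval (env_const M)) obs_exprs
    = [:: size game_obs] ++ flatten (map (fun o : seq nat => size o :: o) game_obs).
  rewrite /obs_exprs -map_comp -[RHS]map_id.

  by apply: eq_map => k /=; apply: eval_cst.
have -> : map (eval (env_const M)) header_exprs = [:: g_nQ (red M); g_nS (red M); g_qI (red M);
    eval (env_const M)
      (cst (size templates_const) ++ nseq (size (templates_entry true)) [:: rN; rS])].
  rewrite /header_exprs; rewrite 3!map_cons; congr [:: _, _, _ & _].
    rewrite eval_cat eval_cst /eval map_nseq sumn_nseq.
    by rewrite /ev_mon /= muln1.
by rewrite -!catA.
Qed.

End Reducer.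

(** * Simulation of the Turing machine *)

Section Simulation.

Variable M : tm.
Hypothesis M_valid : valid_tm M.

Notation S := (tm_nsym M).
Notation cfg n := (tm_run M (tm_init M [::]) n).
Notation st_at n := (cfg n).1.1.

Lemma S_pos : 0 < S.
Proof. by case/and5P: M_valid => _ _ _ _ /and3P []. Qed.

Lemma start_lt : tm_start M < tm_nst M.
Proof. by case/and3P: M_valid. Qed.

Lemma acc_neq_rej : tm_acc M != tm_rej M.
Proof. by case/and4P: M_valid => _ _ _ /andP []. Qed.

Lemma entry_lt e : ((nth_entry M e).1.1 < tm_nst M) && ((nth_entry M e).1.2 < S).
Proof.
case/and5P: (M_valid) => h1 _ _ _ /and3P [h2 _ /allP h].
case: (ltnP e (size (tm_delta M))) => he; first by apply: h; apply: mem_nth.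
by rewrite nth_default //= h2 (leq_ltn_trans _ h1).
Qed.

Definition halted (q : nat) : bool := (q == tm_acc M) || (q == tm_rej M).

Lemma cfgS n : cfg n.+1 = tm_step M (cfg n).
Proof. by []. Qed.

Lemma cfg_halted n m : halted (st_at n) -> n <= m -> cfg m = cfg n.
Proof.
move=> hh /subnK <-; elim: (m - n) => [|k IH] //.
rewrite addSn cfgS IH.
by case: (cfg n) hh => [[q t] h] /= hh; rewrite -/(halted q) hh.
Qed.

Lemma cfg_valid n : st_at n < tm_nst M /\ forall i, (cfg n).1.2 i < S.
Proof.
elim: n => [|n [IH1 IH2]].
  by split; [exact: start_lt | case=> i; rewrite /= ?nth_nil S_pos].
rewrite cfgS.
move: IH1 IH2; case: (cfg n) => [[q t] h] /= IH1 IH2; case: ifP => //= _.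
have := entry_lt (q * S + t h).
case: nth => [[q' b] d] /= /andP [hq hb]; split=> // i.
by case: eqP.
Qed.

(* [l] and [r] are the tape left and right of the head, read in base [S] from the head outwards. *)
Definition stacks (c : tconfig) (l r : nat) : Prop := forall i : nat,
  c.1.2 (c.2 - 1 - i%:Z)%R = (l %/ S ^ i) %% S /\ c.1.2 (c.2 + 1 + i%:Z)%R = (r %/ S ^ i) %% S.

(** Seen in the direction of motion: [f] lies behind the head and [g] ahead. *)
Definition dstacks (d : bool) c f g : Prop := if d then stacks c f g else stacks c g f.

Definition entry_at n : nat := st_at n * S + (cfg n).1.2 (cfg n).2.
Definition dir_at n : bool := (nth_entry M (entry_at n)).2.

Lemma entry_at_div n : entry_at n %/ S = st_at n.
Proof.
have [_ h] := cfg_valid n; rewrite /entry_at divnMDl ?S_pos // divn_small ?addn0 //.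
Qed.

Lemma entry_at_lt n : entry_at n < tm_nst M * S.
Proof.
have [h1 h2] := cfg_valid n.
apply: (@leq_trans ((st_at n).+1 * S)); last by rewrite leq_mul2r h1 orbT.
by rewrite /entry_at mulSn [S + _]addnC ltn_add2l.
Qed.

Lemma cfg_step n : ~~ halted (st_at n) ->
  [/\ st_at n.+1 = (nth_entry M (entry_at n)).1.1,
      (cfg n.+1).2 = ((cfg n).2 + (if dir_at n then 1 else -1))%R &
      forall i, (cfg n.+1).1.2 i = if i == (cfg n).2 then (nth_entry M (entry_at n)).1.2
                                   else (cfg n).1.2 i].
Proof.
rewrite cfgS /dir_at /entry_at.
case: (cfg n) => [[q t] h] /= hh; rewrite -/(halted q) (negbTE hh).
by case: nth => [[q' b] d] /=; split=> //; case: d.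
Qed.

(** The written symbol becomes the last digit of the half behind the head, and the last digit of the
    half ahead becomes the symbol read next. *)
Lemma stacks_step n f g : ~~ halted (st_at n) -> dstacks (dir_at n) (cfg n) f g ->
  (cfg n.+1).1.2 (cfg n.+1).2 = g %% S /\
  dstacks (dir_at n) (cfg n.+1) (f * S + (nth_entry M (entry_at n)).1.2) (g %/ S).
Proof.
move=> hh; have [_ e2 e3] := cfg_step hh; have := entry_lt (entry_at n).
set b := (nth_entry M (entry_at n)).1.2 => /andP [_ hb].
have push i : ((f * S + b) %/ S ^ i.+1) %% S = (f %/ S ^ i) %% S.
  by rewrite expnS divnMA divnMDl ?S_pos // (divn_small hb) addn0.
have pop i : (g %/ S %/ S ^ i) %% S = (g %/ S ^ i.+1) %% S by rewrite -divnMA -expnS.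
have push0 : ((f * S + b) %/ S ^ 0) %% S = b by rewrite divn1 modnMDl modn_small.
move: e2; case: (dir_at n) => e2 hs; rewrite /dstacks; (split=> [|i]; rewrite ?e2 ?e3).
- rewrite (_ : _ == _ = false); last by apply/eqP; lia.
  by have [_] := hs 0; rewrite addr0 divn1 => <-.
- split.
    case: i => [|i]; first by rewrite push0 (_ : _ == _) //; apply/eqP; lia.
    rewrite (_ : _ == _ = false); last by apply/eqP; lia.
    rewrite push; have [<- _] := hs i; congr (_ _); lia.
  rewrite (_ : _ == _ = false); last by apply/eqP; lia.
  rewrite pop; have [_ <-] := hs i.+1; congr (_ _); lia.
- rewrite (_ : _ == _ = false); last by apply/eqP; lia.
  by have [+ _] := hs 0; rewrite subr0 divn1 => <-.
- split.
    rewrite (_ : _ == _ = false); last by apply/eqP; lia.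
    rewrite pop; have [<- _] := hs i.+1; congr (_ _); lia.
  case: i => [|i]; first by rewrite push0 (_ : _ == _) //; apply/eqP; lia.
  rewrite (_ : _ == _ = false); last by apply/eqP; lia.
  rewrite push; have [_ <-] := hs i; congr (_ _); lia.
Qed.

(** [z] is the part of the symbol not yet read, which the location still lacks. Track 12 holds
    [1 - x] because the jump turns it into [- (x + b)] by the weight [- (b + 1)]; with [- x] the
    weight would be [- b], which has not the required form when [b = 0]. *)
Record counters (val : nat -> int) (d : bool) (e z f g x y : nat) : Prop := Counters {
  val_u : val 4 = 0%R;
  val_p : val 5 = (e.+1%:Z - z%:Z)%R;
  val_p' : val 6 = (z%:Z - e.+1%:Z)%R;
  val_f : val (far d) = Posz f; val_f' : val (far d).+1 = (- f%:Z)%R;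
  val_g : val (near d) = Posz g; val_g' : val (near d).+1 = (- g%:Z)%R;
  val_x : val 11 = Posz x; val_x' : val 12 = (1 - x%:Z)%R;
  val_y : val 13 = Posz y; val_y' : val 14 = (- y%:Z)%R;
  val_z : val 15 = Posz z; val_z' : val 16 = (- z%:Z)%R }.

(** Each unit taken from [F] has become [S] units of [x], and each [S] units taken from [G] one unit
    of [y]. When the jump is legal, [x = F * S], while [y] and [g] are quotient and remainder of [G]
    by [S]. *)
Definition sim_inv (n : nat) (val : nat -> int) : Prop :=
  exists z f g x y F G,
  [/\ counters val (dir_at n) (entry_at n) z f g x y, dstacks (dir_at n) (cfg n) F G,
      z <= (cfg n).1.2 (cfg n).2, f * S + x = F * S & g + S * y = G].

(** Each action within a machine step lowers one of the two half tapes or the pending symbol and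
    leaves the other two unchanged. *)
Definition mu (val : nat -> int) : nat := `|val 7| + `|val 9| + `|val 15|.

Lemma env_entry_index e : eval (env_entry M e) index_expr = e.
Proof. by rewrite /eval /= !muln1 addn0 /env_entry /env /= -divn_eq. Qed.

Lemma env_entry_live e : eval (env_entry M e) live_expr = (~~ halted (e %/ S)) * e.+1.
Proof.
rewrite /eval /= !muln1 addn0 /env_entry /env /=.
rewrite /halted negb_or andbC; case: (_ && _) => /=; rewrite ?mul0n // !mul1n.
by rewrite -divn_eq.
Qed.

Lemma at_entry_legal val e gs : legal val (map (fun p => (p.1, ev_weight (env_entry M e) p.2))
     (at_entry ++ gs)) ->
  [/\ (e.+1%:Z <= val 5%N)%R, (- e.+1%:Z <= val 6%N)%R, ~~ halted (e %/ S) || (0 <= val 6%N)%R &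
      legal val (map (fun p => (p.1, ev_weight (env_entry M e) p.2)) gs)].
Proof.
rewrite /legal map_cat all_cat => /andP [/= /and3P [h1 h2 _] ->].
move: h1 h2; rewrite /ev_weight /= env_entry_index env_entry_live.
by case: (halted _) => /=; rewrite ?mul0n ?mul1n => h1 h2; split=> //; lia.
Qed.

Lemma acts_move s mv gs : s < red_nS M -> acts M s = Move mv gs ->
  (s = 15 /\ act_map (ev_weight (env_const M)) act_read = Move mv gs) \/
  exists e j, [/\ s = 16 + (e * 3 + j), j < 3, e < tm_nst M * S &
     act_map (ev_weight (env_entry M e)) (acts_entry (nth_entry M e).2 j) = Move mv gs].
Proof.
move=> hs; rewrite /acts; case: ltnP => h16.
  rewrite /acts_const; case: ltnP => // h14; case: eqP => // h15 e.
  by left; split=> //; lia.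
move=> e; right; exists ((s - 16) %/ 3), ((s - 16) %% 3); split=> //.
- exact: index_entry.
- by rewrite ltn_mod.
- by rewrite ltn_divLR // ltn_subLR.
Qed.

Lemma mu_dir val d : mu val = `|val (far d)| + `|val (near d)| + `|val 15|.
Proof. by rewrite /mu; case: d => //=; rewrite [`|val 9| + _]addnC. Qed.

Lemma preserve n val s mv gs : sim_inv n val -> s < red_nS M -> acts M s = Move mv gs ->
  legal val gs ->
  (sim_inv n (vnext mv val) /\ mu (vnext mv val) < mu val) \/
  (~~ halted (st_at n) /\ sim_inv n.+1 (vnext mv val)).
Proof.
move=> [z [f [g [x [y [F [G [hc hst hz hF hG]]]]]]]] hs es hl.
have hS := S_pos.
case: (acts_move hs es) => [[_ [<- egs]]|[e [j [_ hj _ ea]]]].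
  left; case: hc => v4 v5 v6 vf vf' vg vg' vx vx' vy vy' vz vz'.
  have hz0 : 0 < z by move: hl; rewrite -egs /legal /= vz /ev_weight /=; lia.
  split.
    exists z.-1, f, g, x, y, F, G; split=> //; last by lia.
    by case: (dir_at n) vf vf' vg vg' => /= vf vf' vg vg';
      split; rewrite /vnext /ev_weight /eval /=; lia.
  by rewrite /mu /vnext /ev_weight /eval /=; lia.
set Ev := fun p : nat * weight => (p.1, ev_weight (env_entry M e) p.2).
have egs : map Ev (at_entry ++ entry_guards (nth_entry M e).2 j) = gs :=
  Some_inj (congr1 guards ea).
have emv : map Ev (moves (entry_moves (nth_entry M e).2 j)) = mv :=
  congr1 (fun a => if a is Move m _ then m else [::]) ea.
move: hl; rewrite -egs -emv => /at_entry_legal [hp1 hp2 hlive] {egs emv ea es}.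
move=> hl.
have hz16 : z = 0.
  have : (0 <= val 16%N)%R; last by case: hc => *; lia.
  by move: hl; case: j hj => [|[|[|]]] // _; rewrite /legal /= /ev_weight /eval /=; lia.
(* With [z = 0] the location is [entry_at n + 1], and the two guards on it leave no other entry. *)
have ee : e = entry_at n by case: hc => *; lia.
have hnh : ~~ halted (st_at n).
  have hneg : (0 <= val 6%N)%R = false by case: hc => *; lia.
  by move: hlive; rewrite ee entry_at_div hneg orbF.
rewrite {}/Ev ee -/(dir_at n) in hl *.
set E := env_entry M (entry_at n) in hl *.
have ES1 : E rS1 = S.-1 by [].
have ES : E rS = S by [].
have Eb : E rb = (nth_entry M (entry_at n)).1.2 by [].
have Eq : E rq' = (nth_entry M (entry_at n)).1.1 by [].
case: j hj hl => [|[|[|]]] // _ hl.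
- left; rewrite !(mu_dir _ (dir_at n)) /sim_inv; case: hc hl.
  case: (dir_at n) hst => hst /= v4 v5 v6 vf vf' vg vg' vx vx' vy vy' vz vz';
    rewrite /legal /= vf /ev_weight /= => /and3P [hf _ _];
    have fpos : 0 < f by [move: hf; rewrite /eval /=; lia];
    have fS : f * S = S + f.-1 * S by [rewrite -mulSn prednK];
    (split; last by rewrite /vnext /ev_weight /eval /= ?ES1; lia);
    exists 0, f.-1, g, (x + S), y, F, G; split=> //;
    first [ by split; rewrite /vnext /ev_weight /eval /= ?ES1; lia | by lia ].
- left; rewrite !(mu_dir _ (dir_at n)) /sim_inv; case: hc hl.
  case: (dir_at n) hst => hst /= v4 v5 v6 vf vf' vg vg' vx vx' vy vy' vz vz';
    rewrite /legal /= vg /ev_weight /eval /= ES1 => /and3P [hg _ _];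
    (split; last by rewrite /vnext /ev_weight /eval /= ?ES1; lia);
    exists 0, f, (g - S), x, y.+1, F, G; split=> //;
    first [ by split; rewrite /vnext /ev_weight /eval /= ?ES1; lia
          | by rewrite -hG mulnS; lia ].
right; split=> //.
have [hsym hst'] := stacks_step hnh hst.
have [hq' _ _] := cfg_step hnh.
have ent : entry_at n.+1 = (nth_entry M (entry_at n)).1.1 * S + G %% S.
  by rewrite /entry_at hq' hsym.
move: hl; rewrite /legal /= => /and4P [h1 h2 _ _].
have f0 : f = 0.
  by move: h1; case: hc => _ _ _ _ -> _ _ _ _ _ _ _ _; rewrite /ev_weight /eval /=; lia.
have gS : g < S.
  by move: h2; case: hc => _ _ _ _ _ _ -> _ _ _ _ _ _; rewrite /ev_weight /eval /= ES1; lia.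
have eg : g = G %% S by rewrite -hG addnC mulnC modnMDl modn_small.
have ey : y = G %/ S by rewrite -hG addnC mulnC divnMDl // divn_small // addn0.
set b := (nth_entry M (entry_at n)).1.2 in Eb hst'.
rewrite f0 mul0n add0n in hF.
(* The next entry may point the other way, and then the two halves exchange the roles of [f] and
   [g]. *)
pose d' := dir_at n.+1.
exists g, (if d' == dir_at n then x + b else y), (if d' == dir_at n then y else x + b), 0, 0,
  (if d' == dir_at n then x + b else y), (if d' == dir_at n then y else x + b); split; first last.
- by rewrite muln0 addn0.
- by rewrite addn0.
- by rewrite hsym eg.
- by rewrite ey hF -/d'; move: hst'; case: (dir_at n); case: (d').
case: hc; rewrite ent -eg -/d'; case: (dir_at n); case: (d') => /= v4 v5 v6 vf vf' vg vg' vx vx' vy vy' vz vz';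
  by split; rewrite /vnext /ev_weight /eval /= ?ES ?Eb ?Eq ?muln1 ?addn0; lia.
Qed.

End Simulation.

(** * Halting behaviour and the outcome of the game *)

Section Outcome.

Variable M : tm.
Hypothesis M_valid : valid_tm M.

Notation S := (tm_nsym M).
Notation cfg n := (tm_run M (tm_init M [::]) n).
Notation st_at n := (cfg n).1.1.
Notation vinit := (vinit (red_init M)).

Lemma sim_inv_init : sim_inv M 0 vinit.
Proof.
have e0 : entry_at M 0 = tm_start M * S by rewrite /entry_at /= addn0.
exists 0, 0, 0, 0, 0, 0, 0; split=> //; last by rewrite muln0.
  rewrite e0; case: (dir_at M 0); split;
    rewrite /vinit /red_init /ev_weight /eval /env_const /env /= ?muln1 ?addn0; lia.
have t0 i : tape_of [::] i = 0 by case: i => // k; rewrite /= nth_nil.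
by rewrite /dstacks; case: (dir_at M 0) => i; rewrite div0n mod0n; split; exact: t0.
Qed.

(** Since [z] never exceeds the symbol read, the location stays between [q * S + 1] and [q * S + S]
    during the whole step from state [q], and these blocks are disjoint. *)
Lemma accept_legal n val s gs : sim_inv M n val -> s < red_nS M -> acts M s = Accept gs ->
  legal val gs = (st_at n == tm_acc M).
Proof.
move=> [z [f [g [x [y [F [G [hc _ hz _ _]]]]]]]] hs es.
have hS := S_pos M_valid.
have [_ hsym] := cfg_valid M_valid n.
have : act_map (ev_weight (env_const M)) act_accept = Accept gs.
  move: es; rewrite /acts; case: ltnP => h16 //.
  by rewrite /acts_const; case: ltnP => // h14; case: eqP.
case=> <-; rewrite /legal /= /ev_weight /eval /= !muln1 !addn0 /env_const /env /=.
case: hc => _ -> -> _ _ _ _ _ _ _ _ _ _; rewrite /entry_at.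
move: hz (hsym (cfg n).2); set a := (cfg n).1.2 (cfg n).2; set q := st_at n => hz ha.
case: (ltngtP q (tm_acc M)) => hq.
- have : q.+1 * S <= tm_acc M * S by rewrite leq_mul2r hq orbT.
  by rewrite mulSn => h; apply/negP; lia.
- have : (tm_acc M).+1 * S <= q * S by rewrite leq_mul2r hq orbT.
  by rewrite mulSn => h; apply/negP; lia.
- by rewrite hq; lia.
Qed.

Lemma acts_accept : exists2 gs, acts M 14 = Accept gs & 14 < red_nS M.
Proof. by eexists; [reflexivity | rewrite /red_nS; lia]. Qed.

(** The honest action is to read while [z] is positive, then to empty the half behind, then to bring
    the half ahead below [S], then to jump. *)
Lemma progress n val : sim_inv M n val -> ~~ halted M (st_at n) ->
  exists s mv gs, [/\ s < red_nS M, acts M s = Move mv gs & legal val gs].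
Proof.
move=> [z [f [g [x [y [F [G [hc hst hz hF hG]]]]]]]] hnh.
have hS := S_pos M_valid.
case: (posnP z) => [z0|zpos]; last first.
  exists 15; eexists; eexists; split; [by rewrite /red_nS; lia | reflexivity | ].
  by case: hc => _ _ _ _ _ _ _ _ _ _ _ vz _; rewrite /legal /= vz /ev_weight /eval /=; lia.
have he := entry_at_lt M_valid n.
suff [j hj hl] : exists2 j, j < 3 & legal val
    (map (fun p => (p.1, ev_weight (env_entry M (entry_at M n)) p.2))
      (at_entry ++ entry_guards (dir_at M n) j)).
  exists (16 + (entry_at M n * 3 + j)); eexists; eexists; split; last exact: hl.
  - by rewrite /red_nS ltn_add2l; lia.
  - by rewrite acts_at.
have hat gs : legal val (map (fun p => (p.1, ev_weight (env_entry M (entry_at M n)) p.2)) gs) ->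
    legal val (map (fun p => (p.1, ev_weight (env_entry M (entry_at M n)) p.2)) (at_entry ++ gs)).
  rewrite /legal map_cat all_cat => ->; rewrite andbT /= /ev_weight /=.
  rewrite env_entry_index env_entry_live (entry_at_div M_valid) hnh mul1n.
  by case: hc => _ -> -> _ _ _ _ _ _ _ _ _ _; lia.
have ES1 : env_entry M (entry_at M n) rS1 = S.-1 by [].
case: hc => _ _ _ vf vf' vg vg' _ _ _ _ vz vz'.
case: (posnP f) => [f0|fpos]; last first.
  exists 0 => //; apply: hat; rewrite /legal /= vf vz' /ev_weight /eval /=; lia.
case: (ltnP g S) => hg; last first.
  exists 1 => //; apply: hat; rewrite /legal /= vg vz' /ev_weight /eval /= ES1; lia.
exists 2 => //; apply: hat; rewrite /legal /= vf' vg' vz' /ev_weight /eval /= ES1; lia.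
Qed.

Lemma halted_lt n K : halted M (st_at K) -> ~~ halted M (st_at n) -> n < K.
Proof.
by move=> hK; rewrite ltnNge; apply: contra => h; rewrite (cfg_halted hK h).
Qed.

(* Each legal move shortens the time left until halting or keeps it and decreases [mu]. *)
Lemma legal_ind (P : (nat -> int) -> Prop) K : halted M (st_at K) ->
  (forall n val, sim_inv M n val ->
     (forall s mv gs, s < red_nS M -> acts M s = Move mv gs -> legal val gs -> P (vnext mv val)) ->
     P val) ->
  forall n val, sim_inv M n val -> P val.
Proof.
move=> hK hP.
suff H k m : forall n val, K - n <= k -> mu val <= m -> sim_inv M n val -> P val.
  by move=> n val; apply: H.
elim: k m => [|k IHk] m; elim: m => [|m IHm] n val hk hm hi; apply: (hP _ _ hi) => s mv gs hs es hl.
all: case: (preserve M_valid hi hs es hl) => [[hi' hmu]|[hnh hi']].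
all: try (have hlt := halted_lt hK hnh).
all: try (by lia).
- by apply: (IHm n) => //; lia.
- by apply: (IHk (mu (vnext mv val)) n.+1) => //; lia.
- by apply: (IHm n) => //; lia.
- by apply: (IHk (mu (vnext mv val)) n.+1) => //; lia.
Qed.

Lemma init_size : size (red_init M) = 14.
Proof. by []. Qed.

Lemma init_V : nth 0%R (red_init M) 0 = (-1)%R.
Proof. by []. Qed.

Lemma init_U : nth 0%R (red_init M) 1 = 0%R.
Proof. by []. Qed.

Lemma acc_rej_excl n m : st_at n = tm_acc M -> st_at m = tm_rej M -> False.
Proof.
move=> hn hm.
have h1 : halted M (st_at n) by rewrite /halted hn eqxx.
have h2 : halted M (st_at m) by rewrite /halted hm eqxx orbT.
have := cfg_halted h1 (leq_maxl n m); rewrite (cfg_halted h2 (leq_maxr n m)) => e.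
by move: (acc_neq_rej M_valid); rewrite -hn -hm e eqxx.
Qed.

Lemma eve_accept : eve_wins (red M) <-> tm_halts_accept M.
Proof.
split=> [hw|[K hK]].
  have hca := eve_wins_canacc (red_nS_pos M) (@red_acts_ok M) init_size init_V init_U hw.
  suff H val : canacc (red_nS M) (acts M) val -> forall n, sim_inv M n val -> tm_halts_accept M.
    by apply: (H _ hca); exact: sim_inv_init.
  elim=> {}val s => [gs hs es hl|mv gs hs es hl _ IH] n hi.
    by exists n; apply/eqP; rewrite -(accept_legal hi hs es).
  by case: (preserve M_valid hi hs es hl) => [[hi' _]|[_ hi']]; apply: IH hi'.
apply: (canacc_eve_wins (red_nS_pos M) (@red_pun M) (@red_acts_ok M) init_size init_V init_U).
have hh : halted M (st_at K) by rewrite /halted hK eqxx.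
apply: (legal_ind hh _ sim_inv_init) => n val hi IH.
case: (boolP (halted M (st_at n))) => [hn|hn].
  have hacc : st_at n = tm_acc M.
    by case/orP: hn => /eqP // hr; case: (acc_rej_excl hK hr).
  have [gs es hs] := acts_accept.
  by apply: (canacc_now hs es); rewrite (accept_legal hi hs es) hacc.
have [s [mv [gs [hs es hl]]]] := progress hi hn.
exact: (canacc_step hs es hl (IH _ _ _ hs es hl)).
Qed.

(** Unless [M] rejects, some legal action exists at every point of the simulation, which denies Adam
    a win even if the run is infinite. If [M] rejects, no [Accept] is ever legal and [legal_ind]
    bounds the honest play. *)
Lemma adam_reject : adam_wins (red M) <-> tm_halts_reject M.
Proof.
split=> [ha|[K hK]].
  apply: NNPP => hnr; move: ha.
  apply: (invariant_not_adam (red_nS_pos M) (@red_pun M) (@red_acts_ok M) init_size init_V init_U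
     (P := fun val => exists n, sim_inv M n val)); last first.
    by exists 0; exact: sim_inv_init.
  move=> val [n hi]; case: (boolP (halted M (st_at n))) => [hn|hn].
    have hacc : st_at n = tm_acc M.
      by case/orP: hn => /eqP // hr; case: hnr; exists n.
    have [gs es hs] := acts_accept.
    by left; exists 14, gs; split=> //; rewrite (accept_legal hi hs es) hacc.
  have [s [mv [gs [hs es hl]]]] := progress hi hn.
  right; exists s, mv, gs; split=> //.
  by case: (preserve M_valid hi hs es hl) => [[hi' _]|[_ hi']]; [exists n | exists n.+1].
apply: (losing_adam_wins (red_nS_pos M) (@red_acts_ok M) init_size init_V init_U).
have hh : halted M (st_at K) by rewrite /halted hK eqxx orbT.
apply: (legal_ind hh _ sim_inv_init) => n val hi IH.
apply: losing_intro => // s gs hs es; rewrite (accept_legal hi hs es).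
by apply/negP => /eqP hacc; apply: (acc_rej_excl hacc hK).
Qed.

End Outcome.

Theorem theorem5 :
  exists red : tm -> mpg,
    poly_time_reduction red /\
    forall M : tm, valid_tm M ->
      [/\ valid_mpg (red M),
          eve_wins (red M) <-> tm_halts_accept M &
          adam_wins (red M) <-> tm_halts_reject M].
Proof.
exists red; split; last first.
  by move=> M hM; split; [exact: red_valid | exact: eve_accept | exact: adam_reject].
have [R [hv [hs [a [k H]]]]] := cmd_poly_time reducer_wf.
exists R; split=> //; split=> //; exists a, k => M hM.
have [T [hT hc]] := H (unary_enc (enc_tm M)).
exists T; split; first by rewrite size_map.
by rewrite (reducer_correct hM) in hc.
Qed.
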